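(* Let $(Z_n)$ be a BPREI as in the context satisfying (H1) $p_0=0$ a.s. and $\mathbf E\log M\in(0,\infty)$; (H2) $\mathbf P(h_0>0,\ 0<p_1<1)>0$; (H3) $\mathbf E\bigl[M^{-1}\sum_{j\ge1}j\log^+j\,p_j\bigr]<\infty$; (H4) $\mathbf EM^\delta<\infty$ for some $\delta>0$; (H5) $\mathbf E\eta<\infty$. For $r>0$ and $i\ge1$ put $c_r:=\mathbf E[M^{-r}]$, $\gamma_i:=\mathbf E[h_0p_1^i]=\mathbf P_i(Z_1=i)$, $r_i:=\sup\{r>0:c_r>\gamma_i\}\in(0,\infty]$ and $H_{i,n}(r):=\mathbf E_i[Z_n^{-r}]$. Then for every $i\ge1$ there are finite, strictly positive constants such that $$\lim_{n\to\infty}c_r^{-n}H_{i,n}(r)=C^{\mathrm{env}}_{i,r}\quad(0<r<r_i),$$ $$\lim_{n\to\infty}\frac{H_{i,n}(r)}{n\gamma_i^n}=C^{\mathrm{bd}}_i\quad(r=r_i<\infty),$$ $$\lim_{n\to\infty}\gamma_i^{-n}H_{i,n}(r)=C^{\mathrm{sm}}_{i,r}\quad(r>r_i).$$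
   Context: BPREI (branching process in an i.i.d. random environment with immigration). $\mathcal E_n=(Q_n,G_n)$, $n\ge0$, are i.i.d. marks, where $Q_n$ (reproduction law) and $G_n$ (immigration law) are random probability measures on $\{0,1,2,\dots\}$, possibly dependent on each other. Conditional on the environment, $Z_{n+1}=\sum_{i=1}^{Z_n}\xi_{n,i}+\eta_{n+1}$, where all the variables $\xi_{n,i},\eta_{n+1}$ are independent, $\xi_{n,i}\sim Q_n$, $\eta_{n+1}\sim G_n$. $\mathbf P_i,\mathbf E_i$ refer to $Z_0=i$ (annealed law). For a generic mark $(Q,G)$: $p_j:=Q(\{j\})$, $h_j:=G(\{j\})$ (random through the mark), $M:=\sum_{j\ge0}jp_j\in(0,\infty)$ a.s., and $\eta$ is a random variable with conditional law $G$. *)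

(* Defs.v *)
From HB Require Import structures.
From mathcomp Require Import all_boot all_order all_algebra.
From mathcomp Require Import all_classical all_reals all_analysis.
Set Implicit Arguments.
Unset Strict Implicit.
Unset Printing Implicit Defensive.
Import Order.TTheory GRing.Theory Num.Theory.
Import numFieldNormedType.Exports.
Local Open Scope classical_set_scope.
Local Open Scope ring_scope.

(* Marks (Q, G), with the product of the sigma-algebras generated by the
   evaluations of Q and of G at sets. *)
Definition mark (R : realType) :=
  (pprobability nat R * pprobability nat R)%type.

Section mark_functionals.
Context {R : realType}.
Implicit Type e : mark R.

Definition repro e : probability nat R := e.1.
Definition immig e : probability nat R := e.2.

Definition p_ e (j : nat) : R := fine (repro e [set j]).
Definition h_ e (j : nat) : R := fine (immig e [set j]).

Definition M_ext e : \bar R := (\sum_(0 <= j <oo) (j%:R * p_ e j)%:E)%E.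

(* The real value of M; it is 0 when the mean is infinite. *)
Definition M_ e : R := fine (M_ext e).

Definition log_plus (x : R) : R := Num.max 0 (ln x).

Definition xlogx_moment e : \bar R :=
  (\sum_(1 <= j <oo) (j%:R * log_plus j%:R * p_ e j)%:E)%E.

End mark_functionals.

Section bprei.
Context {d : measure_display} {T : measurableType d} {R : realType}
  (P : probability T R).

Definition iid_marks (env : nat -> {RV P >-> mark R}) : Prop :=
  (forall n (B : set (mark R)), measurable B ->
     P (env n @^-1` B) = P (env 0%N @^-1` B)) /\
  (forall (N : nat) (B : nat -> set (mark R)), (forall n, measurable (B n)) ->
     P [set w | forall n, (n < N)%N -> B n (env n w)] =
     (\prod_(n < N) P (env n @^-1` B n))%E).

Definition env_sigma (env : nat -> {RV P >-> mark R}) : set (set T) :=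
  <<s [set A | exists n (B : set (mark R)),
         measurable B /\ A = env n @^-1` B] >>.

(* Conditionally on the sigma-algebra of the environment, all the variables
   offspring n i and immigrants n.+1 are independent, offspring n i has law
   Q_n and immigrants n.+1 has law G_n. Taking some of the B n i, D n to be
   setT covers every finite subfamily. The variable immigrants 0 is unused and
   unconstrained. *)
Definition cond_law (env : nat -> {RV P >-> mark R})
    (offspring : nat -> nat -> {RV P >-> nat})
    (immigrants : nat -> {RV P >-> nat}) : Prop :=
  forall A : set T, env_sigma env A ->
  forall (N K : nat) (B : nat -> nat -> set nat) (D : nat -> set nat),
    P (A `&` [set w | forall n, (n < N)%N ->
         D n (immigrants n.+1 w) /\
         forall i, (i < K)%N -> B n i (offspring n i w)]) =
    (\int[P]_(w in A) \prod_(n < N)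
       (immig (env n w) (D n) * \prod_(i < K) repro (env n w) (B n i)))%E.

Record bprei := BPREI {
  env : nat -> {RV P >-> mark R};
  offspring : nat -> nat -> {RV P >-> nat};
  immigrants : nat -> {RV P >-> nat};
  env_iid : iid_marks env;
  noise_law : cond_law env offspring immigrants }.

Variable X : bprei.

(* Z_ i n is Z_n started from Z_0 = i; the offspring of generation n are
   numbered from 0. *)
Fixpoint Z_ (i n : nat) (w : T) : nat :=
  if n is m.+1 then
    (\sum_(k < Z_ i m w) offspring X m k w + immigrants X m.+1 w)%N
  else i.

(* The generic mark is the one at time 0. The expectations below are those of
   variables with values in [0, 1] a.s. as soon as p_0 = 0 a.s., hence the use
   of fine. *)
Definition c_ (r : R) : R :=
  fine 'E_P[(fun w => M_ (env X 0%N w) `^ (- r))%R]%E.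

Definition gamma_ (i : nat) : R :=
  fine 'E_P[(fun w => h_ (env X 0%N w) 0%N * p_ (env X 0%N w) 1%N ^+ i)%R]%E.

Definition rcrit (i : nat) : \bar R :=
  ereal_sup [set r%:E | r in [set r : R | 0 < r /\ gamma_ i < c_ r]].

Definition H_ (i n : nat) (r : R) : R :=
  fine 'E_P[(fun w => (Z_ i n w)%:R `^ (- r))%R]%E.

End bprei.

(* Main.v *)
Require Import Defs.
From HB Require Import structures.
From mathcomp Require Import all_boot all_order all_algebra.
From mathcomp Require Import all_classical all_reals all_analysis.
From mathcomp Require Import measurable_realfun ring lra zify.
Import Order.TTheory GRing.Theory Num.Theory.
Import numFieldNormedType.Exports.
Local Open Scope classical_set_scope.
Local Open Scope ring_scope.

(* As p_0 = 0, the population never decreases, and from j it remains at j with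
   probability gamma_j, which is strictly decreasing in j. So the one-step
   operator Q of the Markov chain is upper triangular with diagonal gamma, and
   weights supported near the origin decay at any rate above gamma_i on [i, oo).
   A second-order expansion gives Q(k^-r)(j) = c_r j^-r (1 + O(eps_j)), where
   eps_j = E[M^-1 xi^2 / (j + xi)] + E[eta] / j. The sequence
   u_j = E[M^-1 xi ln (1 + xi / j)] + E[eta] / j, finite by (H3) and (H5), tends
   to 0 and satisfies u_j - u_l >= (1 - j/l) eps_j for l >= j; as
   c_r > c_(r+1), its drift absorbs the error, so k^-r (1 + K u_k) and
   k^-r (1 - K u_k) are a super- and a subsolution of Q f = c_r f away from the
   origin. If gamma_i < c_r, this gives the convergence of c_r^-n Q^n(k^-r)(i).
   Otherwise one splits off the time spent at i: the contribution of the states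
   above i is summable against gamma_i^n when c_r < gamma_i, and is asymptotically
   constant when c_r = gamma_i (whence the factor n, by a Cesaro mean). *)

(** The obstacle is that (H3) gives no rate at which [eps_j] tends to [0], so a lower-order power of
    [k] cannot be expected to absorb an error of this size. The correction is therefore built from
    [eps] itself: [u_j] is the integral of [eps_s ds / s] over [s >= j], and the logarithm in (H3)
    makes it finite. A step from [j] to [l] lowers [u] by at least [(1 - j/l) eps_j]; weighting by
    [l^-r] turns [1] into [c_r] and [j/l] into [c_(r+1)], up to small errors. The sequence
    [c_r^-n Q^n(k^-r)] need not be monotone. The supersolution supplies a nonincreasing majorant;
    its distance to the sequence vanishes because [u] is small except near the origin, where weights
    decay faster than [c_r^n]; the subsolution keeps the limit positive. No second moment of the
    offspring is assumed. Truncating each offspring number at the population size [j] costs a bias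
    of order [eps_j], and the average of [j] truncated numbers, divided by [M], has a variance of
    the same order. *)

Definition bounded_seq {R : realType} (f : nat -> R) :=
  exists B : R, forall k, `|f k| <= B.

(** * Bounded sequences, the functions on which the operator acts *)

Section bounded_seq.
Context {R : realType}.
Implicit Types f g : nat -> R.

Lemma bounded_seq_cst (a : R) : bounded_seq (fun=> a).
Proof. by exists `|a|. Qed.

Lemma bounded_seqD f g : bounded_seq f -> bounded_seq g ->
  bounded_seq (fun k => f k + g k).
Proof.
by move=> [A fA] [B gB]; exists (A + B) => k; rewrite (le_trans (ler_normD _ _)) // lerD.
Qed.

Lemma bounded_seqM f g : bounded_seq f -> bounded_seq g ->
  bounded_seq (fun k => f k * g k).
Proof.
move=> [A fA] [B gB]; exists (A * B) => k.
by rewrite normrM ler_pM.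
Qed.

Lemma bounded_seqN f : bounded_seq f -> bounded_seq (fun k => - f k).
Proof. by move=> [A fA]; exists A => k; rewrite normrN. Qed.

Lemma bounded_seq_if (b : pred nat) f g : bounded_seq f -> bounded_seq g ->
  bounded_seq (fun k => if b k then f k else g k).
Proof.
move=> [A fA] [B gB]; exists (A + B) => k.
have A0 : 0 <= A by exact: le_trans (fA 0%N).
have B0 : 0 <= B by exact: le_trans (gB 0%N).
by case: ifP => _; [rewrite (le_trans (fA k)) // lerDl|rewrite (le_trans (gB k)) // lerDr].
Qed.

Lemma bounded_seqW f : bounded_seq f -> exists2 B : R, 0 < B & forall k, f k <= B.
Proof.
move=> [A fA]; exists (A + 1); last first.
  by move=> k; rewrite (le_trans (ler_norm _)) // (le_trans (fA k)) // lerDl.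
by rewrite ltr_pwDr // (le_trans _ (fA 0%N)).
Qed.

End bounded_seq.

Section negative_power.
Context {R : realType}.

(** By the convention of [powR], the value at [k = 0] is [0] when [r != 0], so the sequence is
    bounded on all of [nat] for [r > 0]. *)
Definition npow (r : R) (k : nat) : R := k%:R `^ (- r).

Lemma npow_ge0 r k : 0 <= npow r k. Proof. exact: powR_ge0. Qed.

Lemma npow_gt0 r k : (0 < k)%N -> 0 < npow r k.
Proof. by move=> k0; rewrite powR_gt0 // ltr0n. Qed.

Lemma npow_le1 r k : 0 < r -> npow r k <= 1.
Proof.
move=> r0; rewrite /npow; case: k => [|k].
  by rewrite powR0 // oppr_eq0 gt_eqF.
by rewrite -[leRHS](powRr0 (k.+1%:R : R)) ler_powR ?ler1n // oppr_le0 ltW.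
Qed.

Lemma bounded_npow r : 0 < r -> bounded_seq (npow r).
Proof. by move=> r0; exists 1 => k; rewrite ger0_norm ?npow_ge0 // npow_le1. Qed.

Lemma npowS r k : (0 < k)%N -> npow (r + 1) k = npow r k / k%:R.
Proof.
move=> k0; rewrite /npow opprD powRD; last by rewrite pnatr_eq0 -lt0n k0 implybT.
by rewrite powR_inv1.
Qed.

End negative_power.

(** * Asymptotics of the iterates of an upper triangular operator *)

Section upward_markov.
Context {R : realType} (Q : (nat -> R) -> nat -> R) (gam : nat -> R).
(** Positivity and upper triangularity at once: the comparison is required on [[j, oo)] only, so
    [Q f j] cannot depend on [f] below [j]. *)
Hypothesis Q_le : forall f g j, bounded_seq f -> bounded_seq g ->
  (forall k, (j <= k)%N -> f k <= g k) -> Q f j <= Q g j.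
Hypothesis Q_lin : forall a b f g j, bounded_seq f -> bounded_seq g ->
  Q (fun k => a * f k + b * g k) j = a * Q f j + b * Q g j.
Hypothesis Q_cst1 : forall j, Q (fun=> 1) j = 1.
Hypothesis Q_hit : forall j : nat, Q (fun k => (k == j)%:R) j = gam j.
(** In probabilistic terms, a state [j > 0] is left with positive probability: [f] may vanish at [j]
    itself. *)
Hypothesis Q_gt0 : forall f j, bounded_seq f -> (0 < j)%N ->
  (forall k, (j <= k)%N -> 0 <= f k) -> (forall k, (j < k)%N -> 0 < f k) ->
  0 < Q f j.

Lemma Q_eq f g j : bounded_seq f -> bounded_seq g ->
  (forall k, (j <= k)%N -> f k = g k) -> Q f j = Q g j.
Proof.
move=> bf bg fg; apply/eqP; rewrite eq_le !Q_le // => k jk; first by rewrite fg.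
by rewrite fg.
Qed.

Lemma Q_scale a f j : bounded_seq f -> Q (fun k => a * f k) j = a * Q f j.
Proof.
move=> bf; have /= := Q_lin a 0 f f j bf bf; rewrite mul0r addr0 => <-.
by congr (Q _ j); apply/funext => k; rewrite mul0r addr0.
Qed.

Lemma Q_add f g j : bounded_seq f -> bounded_seq g ->
  Q (fun k => f k + g k) j = Q f j + Q g j.
Proof.
move=> bf bg; have /= := Q_lin 1 1 f g j bf bg; rewrite !mul1r => <-.
by congr (Q _ j); apply/funext => k; rewrite !mul1r.
Qed.

Lemma Q_cst a j : Q (fun=> a) j = a.
Proof.
have := Q_scale a (fun=> 1) j (bounded_seq_cst 1); rewrite Q_cst1 mulr1 => H.
by rewrite -[RHS]H; congr (Q _ j); apply/funext => k; rewrite mulr1.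
Qed.

Lemma Q_ge0 f j : bounded_seq f -> (forall k, (j <= k)%N -> 0 <= f k) -> 0 <= Q f j.
Proof. by move=> bf f0; rewrite -[leLHS](Q_cst 0 j) Q_le //; exact: bounded_seq_cst. Qed.

Lemma bounded_Q f : bounded_seq f -> bounded_seq (Q f).
Proof.
move=> bf; case: (bf) => B fB; exists B => k; rewrite ler_norml.
have bc a : bounded_seq (fun=> a : R) by exact: bounded_seq_cst.
rewrite -{1}(Q_cst (- B) k) -{2}(Q_cst B k) !Q_le // => l _.
  by have := fB l; rewrite ler_norml => /andP[].
by have := fB l; rewrite ler_norml => /andP[].
Qed.

Lemma bounded_iterQ n f : bounded_seq f -> bounded_seq (iter n Q f).
Proof. by elim: n => // n ih bf; exact/bounded_Q/ih. Qed.

Lemma iterQ_le n f g j : bounded_seq f -> bounded_seq g ->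
  (forall k, (j <= k)%N -> f k <= g k) -> iter n Q f j <= iter n Q g j.
Proof.
move=> bf bg; elim: n j => [|n ih] j fg /=; first exact: fg.
apply: Q_le => [||k jk]; [exact: bounded_iterQ|exact: bounded_iterQ|].
by apply: ih => l kl; apply: fg; exact: leq_trans kl.
Qed.

Lemma iterQ_lin n a b f g : bounded_seq f -> bounded_seq g ->
  iter n Q (fun k => a * f k + b * g k) =
  (fun k => a * iter n Q f k + b * iter n Q g k).
Proof.
move=> bf bg; elim: n => [//|n ih] /=; rewrite ih; apply/funext => k.
by apply: Q_lin; exact: bounded_iterQ.
Qed.

Lemma iterQ_ge0 n f j : bounded_seq f -> (forall k, (j <= k)%N -> 0 <= f k) ->
  0 <= iter n Q f j.
Proof.
move=> bf; elim: n j => [|n ih] j f0 /=; first exact: f0.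
apply: Q_ge0 => [|k jk]; first exact: bounded_iterQ.
by apply: ih => l kl; apply: f0; exact: leq_trans kl.
Qed.

(** Upper triangularity makes the supersolution property on [[j, oo)] sufficient, because the
    iterates at [j] never look below [j]. *)
Lemma iterQ_super n c f j : 0 <= c -> bounded_seq f ->
  (forall k, (j <= k)%N -> Q f k <= c * f k) -> iter n Q f j <= c ^+ n * f j.
Proof.
move=> c0 bf; elim: n j => [|n ih] j fc; first by rewrite mul1r.
have bcf : bounded_seq (fun k => c ^+ n * f k).
  by apply: bounded_seqM => //; exact: bounded_seq_cst.
rewrite iterS (@le_trans _ _ (Q (fun k => c ^+ n * f k) j)) //.
  apply: Q_le => [||k jk] //; first exact: bounded_iterQ.
  by apply: ih => l kl; apply: fc; exact: leq_trans kl.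
by rewrite Q_scale // exprSr -mulrA ler_wpM2l ?exprn_ge0 // fc.
Qed.

Definition above (j : nat) (f : nat -> R) (k : nat) : R := if (j < k)%N then f k else 0.

Lemma bounded_above j f : bounded_seq f -> bounded_seq (above j f).
Proof. by move=> bf; apply: bounded_seq_if => //; exact: bounded_seq_cst. Qed.

(** The first step either stays at [j], with weight [gam j], or goes strictly above [j]. *)
Lemma Q_first f j : bounded_seq f -> Q f j = gam j * f j + Q (above j f) j.
Proof.
move=> bf.
have bi : bounded_seq (fun k => (k == j)%:R : R).
  by exists 1 => k; case: eqP => _; rewrite ?normr1 ?normr0.
have <- : Q (fun k => f j * (k == j)%:R) j = gam j * f j.
  by rewrite Q_scale // Q_hit mulrC.
rewrite -Q_add; last 2 first.
- by apply: bounded_seqM => //; exact: bounded_seq_cst.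
- exact: bounded_above.
apply: Q_eq => // [|k].
  apply: bounded_seqD; last exact: bounded_above.
  by apply: bounded_seqM => //; exact: bounded_seq_cst.
rewrite leq_eqVlt => /predU1P[<-|jk].
  by rewrite eqxx mulr1 /above ltnn addr0.
by rewrite gtn_eqF // mulr0 add0r /above jk.
Qed.

Lemma gam_ge0 j : 0 <= gam j.
Proof.
rewrite -Q_hit; apply: Q_ge0 => // .
by exists 1 => k; case: eqP => _; rewrite ?normr1 ?normr0.
Qed.

Hypothesis gam_dec : forall j k, (0 < j)%N -> (j < k)%N -> gam k < gam j.

Lemma gam_le j k : (0 < j)%N -> (j <= k)%N -> gam k <= gam j.
Proof. by move=> j0; rewrite leq_eqVlt => /predU1P[->//|jk]; exact/ltW/gam_dec. Qed.

(* A geometric weight on the states below [J]: it contracts at any rate above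
   the holding probability. *)
Definition low_weight (q : R) (J k : nat) : R :=
  if (k < J)%N then q^-1 ^+ (J - k) else 0.

Section low_weight.
Variables (q : R).
Hypotheses (q0 : 0 < q) (q1 : q <= 1).

Let iq : 1 <= q^-1. Proof. by rewrite -[leLHS]invr1 lef_pV2 ?posrE. Qed.

Lemma low_weight_ge0 J k : 0 <= low_weight q J k.
Proof. by rewrite /low_weight; case: ifP => // _; rewrite exprn_ge0 // invr_ge0 ltW. Qed.

Lemma low_weight_ge1 J k : (k < J)%N -> 1 <= low_weight q J k.
Proof. by move=> kJ; rewrite /low_weight kJ exprn_ege1. Qed.

Lemma low_weight_le J k l : (k <= l)%N -> low_weight q J l <= low_weight q J k.
Proof.
move=> kl; rewrite /low_weight; case: ifP => lJ; last first.
  by case: ifP => // _; rewrite exprn_ge0 // invr_ge0 ltW.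
by rewrite (leq_ltn_trans kl lJ) ler_weXn2l // leq_sub2l.
Qed.

Lemma low_weightS J k : low_weight q J k.+1 <= q * low_weight q J k.
Proof.
rewrite /low_weight; case: ifP => [kJ|_]; last first.
  by case: ifP => // _; rewrite ?mulr0 // mulr_ge0 ?exprn_ge0 ?invr_ge0 ?ltW.
by rewrite (ltnW kJ) subnS -[in leRHS](@prednK (J - k)) ?subn_gt0 ?(ltnW kJ) //
  exprS mulrA divff ?mul1r ?gt_eqF.
Qed.

Lemma bounded_low_weight J : bounded_seq (low_weight q J).
Proof.
exists (low_weight q J 0%N) => k; rewrite ger0_norm ?low_weight_ge0 //.
exact: low_weight_le.
Qed.

(** Staying at [j] costs [gam j]; any move goes up by at least one, which multiplies the weight by
    at most [q]. *)
Lemma Q_low_weight J j : Q (low_weight q J) j <= (gam j + q) * low_weight q J j.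
Proof.
have bl := bounded_low_weight J.
rewrite Q_first // mulrDl lerD2l.
rewrite -[leRHS](Q_cst _ j) Q_le //; [exact: bounded_above|exact: bounded_seq_cst|].
move=> k _; rewrite /above; case: ifP => jk; last by rewrite mulr_ge0 ?low_weight_ge0 // ltW.
by rewrite (le_trans _ (low_weightS _ _)) // low_weight_le.
Qed.

End low_weight.

(* A supersolution far from the origin becomes one on [i0, +oo[ after adding a
   multiple of a low weight. *)
Lemma supersolution_extend (i0 J : nat) (lam q : R) (phi : nat -> R) :
  (0 < i0)%N -> 0 < q -> q <= 1 -> gam i0 + 2 * q <= lam ->
  bounded_seq phi -> (forall k, 0 <= phi k) ->
  (forall j, (J <= j)%N -> Q phi j <= lam * phi j) ->
  exists2 B : R, 0 <= B & forall j, (i0 <= j)%N ->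
    Q (fun k => phi k + B * low_weight q J k) j <=
    lam * (phi j + B * low_weight q J j).
Proof.
move=> i00 q0 q1 glam bphi phi0 phiJ.
have [S S0 phiS] := bounded_seqW _ bphi.
have bl := bounded_low_weight _ q0 q1 J.
(* As [gam j + q <= lam - q], the weight leaves a spare term [B * q * low_weight q J j]. With
   [B = S / q] it is at least [S >= Q phi j] below [J], where the weight is at least [1]. *)
exists (S / q) => [|j ij]; first by rewrite divr_ge0 ?ltW.
have SQ : Q phi j <= S by rewrite -[leRHS](Q_cst S j) Q_le //; exact: bounded_seq_cst.
have ll := low_weight_ge0 _ q0 J j.
rewrite Q_add //; last by apply: bounded_seqM => //; exact: bounded_seq_cst.
rewrite Q_scale //.
have gj : gam j + q <= lam - q by have := gam_le _ _ i00 ij; lra.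
have := Q_low_weight _ q0 q1 J j.
set QL := Q _ j; set L := low_weight _ _ _ in ll * => QLL.
have Sq : 0 <= S / q by rewrite divr_ge0 ?ltW.
have SE : S = S / q * q by rewrite divfK // gt_eqF.
have QL2 : S / q * QL <= S / q * ((lam - q) * L).
  by rewrite ler_wpM2l // (le_trans QLL) // ler_wpM2r.
have aqL : 0 <= S / q * q * L by rewrite mulr_ge0 // -SE ltW.
have [Jj|jJ] := leqP J j; first by have := phiJ _ Jj; lra.
have L1 : S / q * q <= S / q * q * L.
  by rewrite ler_peMr ?(low_weight_ge1 _ q0 q1) // -SE ltW.
have lam0 : 0 <= lam by have := gam_ge0 i0; lra.
have : 0 <= lam * phi j by rewrite mulr_ge0.
by lra.
Qed.

(** * Correction of negative powers into super- and subsolutions *)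

Variables (cc : R -> R) (eps u : nat -> R).
Hypothesis cc_gt0 : forall r : R, 0 < r -> 0 < cc r.
Hypothesis cc_le1 : forall r : R, 0 < r -> cc r <= 1.
Hypothesis cc_dec : forall r s : R, 0 < r -> r < s -> cc s < cc r.
Hypothesis Q_npow : forall r : R, 0 < r -> exists2 C : R, 0 <= C &
  forall j, (0 < j)%N ->
    `|Q (npow r) j - cc r * npow r j| <= C * eps j * npow r j.
Hypothesis eps_ge0 : forall j, 0 <= eps j.
Hypothesis u_ge0 : forall j, 0 <= u j.
Hypothesis bu : bounded_seq u.
Hypothesis u_small : forall e : R, 0 < e -> exists J, forall j, (J <= j)%N -> u j <= e.
Hypothesis u_drop : forall j l, (0 < j)%N -> (j <= l)%N ->
  (1 - j%:R / l%:R) * eps j <= u j - u l.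

(** Taking [l = 2 * j] in [u_drop] yields [eps j <= 2 * u j]. *)
Lemma eps_small (e : R) : 0 < e -> exists J, forall j, (J <= j)%N -> eps j <= e.
Proof.
move=> e0; have [|J uJ] := u_small (e / 2); first by rewrite divr_gt0.
exists (maxn J 1) => j; rewrite geq_max => /andP[Jj j0].
have := uJ j Jj; have := u_drop j (2 * j)%N j0 (leq_pmull _ _).
rewrite natrM invfM mulrCA mulfV ?mulr1 ?pnatr_eq0 -?lt0n // => /(_ isT).
by have := u_ge0 (2 * j)%N; lra.
Qed.

(** For [k >= j], [u_drop] bounds [u k] by [u j - eps j * (1 - j / k)]. The factor [1 / k] changes
    [npow r] into [npow (r + 1)], so the bound involves only one-step moments covered by
    [Q_npow]. *)
Lemma Q_npow_u r j : 0 < r -> (0 < j)%N ->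
  Q (fun k => npow r k * u k) j <=
  u j * Q (npow r) j - eps j * (Q (npow r) j - j%:R * Q (npow (r + 1)) j).
Proof.
move=> r0 j0; have r10 : 0 < r + 1 by rewrite addr_gt0.
have bf := bounded_npow r r0; have bf1 := bounded_npow _ r10.
rewrite [leRHS](_ : _ =
    Q (fun k => (u j - eps j) * npow r k + (eps j * j%:R) * npow (r + 1) k) j); last first.
  by rewrite Q_lin //; ring.
have bc (a : R) f : bounded_seq f -> bounded_seq (fun k => a * f k).
  by move=> bf'; apply: bounded_seqM => //; exact: bounded_seq_cst.
apply: Q_le; [exact: bounded_seqM|by apply: bounded_seqD; exact: bc|].
move=> k jk; have k0 : (0 < k)%N := leq_trans j0 jk.
rewrite npowS //; have := u_drop j k j0 jk; have := @npow_ge0 R r k.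
set f := npow r k => f0 drop.
have : f * ((1 - j%:R / k%:R) * eps j) <= f * (u j - u k) by rewrite ler_wpM2l.
by lra.
Qed.

(* The drift of [u] along a step dominates the defect of [npow r], because
   [cc r - cc (r + 1) > 0]. *)
Lemma corrected_npow r : 0 < r -> exists K J, [/\ 0 < K, (0 < J)%N &
  forall j, (J <= j)%N -> [/\ K * u j <= 2^-1,
    Q (fun k => npow r k * (1 + K * u k)) j <= cc r * (npow r j * (1 + K * u j)) &
    cc r * (npow r j * (1 - K * u j)) <= Q (fun k => npow r k * (1 - K * u k)) j]].
Proof.
move=> r0; have r10 : 0 < r + 1 by rewrite addr_gt0.
have [C C0 QC] := Q_npow r r0; have [C' C'0 QC'] := Q_npow _ r10.
have kap : cc (r + 1) < cc r by apply: cc_dec => //; rewrite ltrDl.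
pose kappa := (cc r - cc (r + 1)) / 2.
have kappa0 : 0 < kappa by rewrite divr_gt0 // subr_gt0.
(* The drift gains [K * kappa * eps j = 2 * (C + 1) * eps j] relative to [npow r j], which exceeds
   the defect [C * eps j] amplified by [1 + K * u j <= 3 / 2]. *)
pose K := 2 * (C + 1) / kappa.
have K0 : 0 < K by rewrite divr_gt0 // mulr_gt0 // ltr_wpDl.
have [|J1 uJ] := u_small ((2 * K)^-1); first by rewrite invr_gt0 mulr_gt0.
(* Beyond [J2] the defects of [npow r] and [npow (r + 1)] together use at most half of the gap
   [cc r - cc (r + 1)]; the other half is [kappa]. *)
have [|J2 eJ] := eps_small (kappa / (C + C' + 1)).
  by rewrite divr_gt0 // ltr_wpDl // addr_ge0.
exists K, (maxn 1 (maxn J1 J2)); split => //; first by rewrite leq_max.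
move=> j; rewrite !geq_max => /and3P[j0 J1j J2j].
have Ku : K * u j <= 2^-1.
  have := uJ j J1j; rewrite -(ler_pM2l K0) invfM mulrCA mulfV ?mulr1 // gt_eqF //.
have Ku0 : 0 <= K * u j by rewrite mulr_ge0 // ltW.
have KK : K * kappa = 2 * (C + 1) by rewrite /K divfK // gt_eqF.
have := eJ _ J2j; rewrite ler_pdivlMr; last by rewrite ltr_wpDl // addr_ge0.
move: (eps_ge0 j) => e0 eK.
have bf := bounded_npow r r0.
have bfu : bounded_seq (fun k => npow r k * u k) by exact: bounded_seqM.
have f0 : 0 < npow r j := npow_gt0 r j j0.
have := QC j j0; have := QC' j j0; rewrite !ler_norml npowS // => /andP[a1 a2] /andP[b1 b2].
have jr0 : (0 : R) < j%:R by rewrite ltr0n.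
have drift : kappa * npow r j <= Q (npow r) j - j%:R * Q (npow (r + 1)) j.
  have : j%:R * Q (npow (r + 1)) j <= (cc (r + 1) + C' * eps j) * npow r j.
    rewrite -ler_pdivlMl //.
    move: a2; rewrite lerBlDr; move/le_trans; apply.
    by rewrite le_eqVlt; apply/orP; left; apply/eqP; ring.
  have : (C + C') * eps j * npow r j <= kappa * npow r j.
    by rewrite ler_pM2r //; move: eK; rewrite /kappa; lra.
  by rewrite /kappa; lra.
have := Q_npow_u r j r0 j0.
have : eps j * (kappa * npow r j) <=
    eps j * (Q (npow r) j - j%:R * Q (npow (r + 1)) j) by rewrite ler_wpM2l.
set D := eps j * (Q _ _ - _); set QU := Q (fun k => _ * u k) j => D1 QUD.
have KQU : K * QU <= K * (u j * Q (npow r) j) - K * (eps j * (kappa * npow r j)).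
  by rewrite -mulrBr ler_pM2l //; lra.
have E1 : K * (eps j * (kappa * npow r j)) = 2 * (C + 1) * (eps j * npow r j).
  by rewrite -KK; ring.
have ef0 : 0 <= eps j * npow r j by rewrite mulr_ge0 // ltW.
have Cef : 0 <= C * (eps j * npow r j) by rewrite mulr_ge0.
have Eplus : Q (fun k => npow r k * (1 + K * u k)) j = Q (npow r) j + K * QU.
  have := Q_lin 1 K _ _ j bf bfu; rewrite mul1r => <-.
  by congr (Q _ j); apply/funext => k; ring.
have Eminus : Q (fun k => npow r k * (1 - K * u k)) j = Q (npow r) j - K * QU.
  have := Q_lin 1 (- K) _ _ j bf bfu; rewrite mul1r mulNr => <-.
  by congr (Q _ j); apply/funext => k; ring.
split => //.
- rewrite Eplus.
  have : (1 + K * u j) * Q (npow r) j <=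
      (1 + K * u j) * (cc r * npow r j + C * eps j * npow r j).
    by rewrite ler_wpM2l //; lra.
  have : (K * u j) * (C * (eps j * npow r j)) <= 2^-1 * (C * (eps j * npow r j)).
    by rewrite ler_wpM2r.
  by lra.
- rewrite Eminus.
  have : (1 - K * u j) * (cc r * npow r j - C * eps j * npow r j) <=
      (1 - K * u j) * Q (npow r) j.
    by rewrite ler_wpM2l //; lra.
  have : 0 <= (K * u j) * (C * (eps j * npow r j)) by rewrite mulr_ge0.
  by lra.
Qed.

Lemma bounded_seqZ (a : R) f : bounded_seq f -> bounded_seq (fun k => a * f k).
Proof. by move=> bf; apply: bounded_seqM => //; exact: bounded_seq_cst. Qed.

Lemma iterQ_scale n a f : bounded_seq f ->
  iter n Q (fun k => a * f k) = (fun k => a * iter n Q f k).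
Proof.
move=> bf; have /= := iterQ_lin n a 0 f f bf bf.
under eq_fun do rewrite mul0r addr0; move=> ->.
by apply/funext => k; rewrite mul0r addr0.
Qed.

(** Applying the monotone [iter n Q] to [Q phi <= c * phi] shows that [c ^- n * iter n Q phi k]
    cannot increase with [n] when [c > 0]. *)
Lemma iterQ_superS n c phi i0 k : bounded_seq phi ->
  (forall j, (i0 <= j)%N -> Q phi j <= c * phi j) ->
  (i0 <= k)%N -> iter n.+1 Q phi k <= c * iter n Q phi k.
Proof.
move=> bphi phic ik; rewrite iterSr.
have := iterQ_scale n c phi bphi => /(congr1 (@^~ k)) <-.
apply: iterQ_le; [exact: bounded_Q|exact: bounded_seqZ|].
by move=> l kl; apply: phic; exact: leq_trans kl.
Qed.

Lemma iterQ_subS n c psi i0 k : bounded_seq psi ->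
  (forall j, (i0 <= j)%N -> c * psi j <= Q psi j) ->
  (i0 <= k)%N -> c * iter n Q psi k <= iter n.+1 Q psi k.
Proof.
move=> bpsi psic ik; rewrite [in leRHS]iterSr.
have := iterQ_scale n c psi bpsi => /(congr1 (@^~ k)) <-.
apply: iterQ_le; [exact: bounded_seqZ|exact: bounded_Q|].
by move=> l kl; apply: psic; exact: leq_trans kl.
Qed.

(** The function [npow r * (1 - K * u)] is cut to [0] below [J]. The subsolution inequality
    survives: at [j >= J] the operator does not see the cut, and at [j < J] the left side is [0].
    The last clause provides the positive lower bound for the limits. *)
Lemma npow_subsolution r : 0 < r -> exists psi, [/\ bounded_seq psi,
  forall j, 0 <= psi j <= npow r j,
  forall j, cc r * psi j <= Q psi j &
  forall j, (0 < j)%N -> exists m, forall n k, (m <= n)%N -> (j <= k)%N ->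
    0 < iter n Q psi k].
Proof.
move=> r0; have [K [J [K0 J0 KJ]]] := corrected_npow r r0.
have c0 := cc_gt0 r r0.
pose psi k := if (J <= k)%N then npow r k * (1 - K * u k) else 0.
have bphi : bounded_seq (fun k => npow r k * (1 - K * u k)).
  apply: bounded_seqM; first exact: bounded_npow.
  by apply: bounded_seqD; [exact: bounded_seq_cst|apply: bounded_seqN; exact: bounded_seqZ].
have bpsi : bounded_seq psi by apply: bounded_seq_if => //; exact: bounded_seq_cst.
have psi0 j : 0 <= psi j <= npow r j.
  rewrite /psi; case: ifP => [Jj|_]; last by rewrite lexx npow_ge0.
  have [Ku _ _] := KJ _ Jj; have Ku0 : 0 <= K * u j by rewrite mulr_ge0 // ltW.
  by rewrite mulr_ge0 ?npow_ge0 ?ler_piMr ?npow_ge0 //; lra.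
have psic j : cc r * psi j <= Q psi j.
  rewrite {1}/psi; case: ifP => [Jj|_]; last first.
    by rewrite mulr0 Q_ge0 // => k _; case/andP: (psi0 k).
  have [_ _ /le_trans] := KJ _ Jj; apply.
  by apply: Q_le => // k jk; rewrite /psi (leq_trans Jj jk).
have psin m k : 0 < iter m Q psi k -> forall n, (m <= n)%N -> 0 < iter n Q psi k.
  move=> mk0 n /subnK <-; elim: (n - m)%N => [//|l ih].
  rewrite addSn; apply: lt_le_trans (iterQ_subS _ (cc r) _ 0 _ bpsi _ _) => //.
  by rewrite mulr_gt0.
exists psi; split => //.
have base k : (J <= k)%N -> forall n, 0 < iter n Q psi k.
  move=> Jk n; apply: (psin 0%N) => //; rewrite /= /psi Jk mulr_gt0 //.
    by rewrite npow_gt0 // (leq_trans J0).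
  by have [Ku _ _] := KJ _ Jk; lra.
have iter0 n k : 0 <= iter n Q psi k.
  by apply: iterQ_ge0 => // l _; case/andP: (psi0 l).
(* Positivity is carried downwards one state at a time: each state below [J] needs one more
   iteration, in which mass escapes strictly above it. *)
suff H l j : (J <= j + l)%N -> (0 < j)%N -> exists m, forall n k, (m <= n)%N ->
    (j <= k)%N -> 0 < iter n Q psi k.
  by move=> j j0; apply: (H J) => //; rewrite leq_addl.
elim: l j => [|l ih] j; first by rewrite addn0 => Jj _; exists 0%N => n k _ jk; apply: base; exact: leq_trans jk.
rewrite -addSnnS => /ih{}ih j0; have [//|m Hm] := ih.
exists m.+1 => n k mn; rewrite leq_eqVlt => /predU1P[<-|jk].
  by apply: (psin m.+1) => //=; apply: Q_gt0 => // [|l' jl]; [exact: bounded_iterQ|exact: Hm].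
by apply: Hm => //; exact: ltnW.
Qed.

(** The last clause says that passing from [npow r] to [phi] is harmless at scale [cc r ^+ n]. Far
    away the relative excess [K * u] is small, and near the origin the excess is dominated by low
    weights, whose iterates decay at a rate below [cc r]. *)
Lemma npow_supersolution r (i0 : nat) : 0 < r -> (0 < i0)%N -> gam i0 < cc r ->
  exists phi, [/\ bounded_seq phi, forall j, npow r j <= phi j,
    forall j, (i0 <= j)%N -> Q phi j <= cc r * phi j &
    forall e : R, 0 < e -> exists N, forall n j, (N <= n)%N -> (i0 <= j)%N ->
      iter n Q phi j - iter n Q (npow r) j <= e * cc r ^+ n].
Proof.
move=> r0 i00 gc; have [K [J [K0 J0 KJ]]] := corrected_npow r r0.
have c0 := cc_gt0 r r0; have c1 := cc_le1 r r0; have g0 := gam_ge0 i0.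
(* Half of the gap: low weights contract at rate [rho = gam i0 + q], strictly between [gam i0] and
   [cc r]. *)
pose q := (cc r - gam i0) / 2.
have q0 : 0 < q by rewrite divr_gt0 // subr_gt0.
have q1 : q <= 1 by rewrite /q; lra.
have gq : gam i0 + 2 * q <= cc r by rewrite /q; lra.
pose rho := gam i0 + q.
have rho0 : 0 <= rho by rewrite addr_ge0 // ltW.
have rhoc : rho < cc r by rewrite /rho /q; lra.
pose f := npow r; have bf : bounded_seq f := bounded_npow r r0.
have f0 k : 0 <= f k := npow_ge0 r k.
have bu1 : bounded_seq (fun k => 1 + K * u k).
  by apply: bounded_seqD; [exact: bounded_seq_cst|exact: bounded_seqZ].
have bphi0 : bounded_seq (fun k => f k * (1 + K * u k)) by exact: bounded_seqM.
have phi00 k : 0 <= f k * (1 + K * u k).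
  by rewrite mulr_ge0 // addr_ge0 // mulr_ge0 // ltW.
have bw J' := bounded_low_weight q q0 q1 J'.
have w0 J' k := low_weight_ge0 q q0 J' k.
have [|B B0 HB] := supersolution_extend i0 J (cc r) q _ i00 q0 q1 gq bphi0 phi00.
  by move=> j Jj; have [] := KJ j Jj.
pose phi k := f k * (1 + K * u k) + B * low_weight q J k.
have bphi : bounded_seq phi by apply: bounded_seqD => //; exact: bounded_seqZ.
have fphi j : f j <= phi j.
  rewrite /phi mulrDr mulr1 -addrA lerDl addr_ge0 //; last exact: mulr_ge0.
  by rewrite mulr_ge0 // mulr_ge0 // ltW.
exists phi; split => // e e0.
have wcontr J' n j : (i0 <= j)%N ->
    iter n Q (low_weight q J') j <= rho ^+ n * low_weight q J' j.
  move=> ij; apply: iterQ_super => // k jk.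
  rewrite (le_trans (Q_low_weight _ q0 q1 _ _)) // ler_wpM2r // lerD2r.
  by rewrite gam_le // (leq_trans ij).
have [S S0 phiS] := bounded_seqW _ bphi.
have [U U0 uU] := bounded_seqW _ bu.
(* Chosen so that [K * e1] times the bound [cc r ^+ n * S] on [iter n Q f] equals
   [e / 2 * cc r ^+ n]; the low weights receive the other half. *)
pose e1 := e / (2 * K * S).
have e10 : 0 < e1 by rewrite divr_gt0 // !mulr_gt0.
have [J' uJ'] := u_small e1 e10.
have [W W0 wW] := bounded_seqW _ (bw J).
have [W' W'0 wW'] := bounded_seqW _ (bw J').
have fu k : K * (f k * u k) <= K * e1 * f k + K * U * low_weight q J' k.
  suff : f k * u k <= e1 * f k + U * low_weight q J' k.
    by move=> /(ler_wpM2l (ltW K0)); lra.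
  have Uw : 0 <= U * low_weight q J' k by rewrite mulr_ge0 // ltW.
  have ef : 0 <= e1 * f k by rewrite mulr_ge0 // ltW.
  have [Jk|kJ] := leqP J' k.
    have : f k * u k <= f k * e1 by rewrite ler_wpM2l // uJ'.
    by lra.
  suff : f k * u k <= U * low_weight q J' k by lra.
  have fU : f k * u k <= 1 * U by rewrite ler_pM //; exact: npow_le1.
  by rewrite (le_trans fU) // mul1r ler_peMr ?(low_weight_ge1 _ q0 q1) // ltW.
pose A := K * U * W' + B * W.
have A0 : 0 <= A by rewrite addr_ge0 // mulr_ge0 // ltW // mulr_gt0.
have [N HN] : exists N, forall n, (N <= n)%N -> A * rho ^+ n <= e / 2 * cc r ^+ n.
  have : (fun n => A * (rho / cc r) ^+ n) @ \oo --> (A * 0 : R).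
    apply: cvgMr; apply: cvg_expr.
    by rewrite ger0_norm ?ltr_pdivrMr ?mul1r // divr_ge0 // ltW.
  rewrite mulr0 => /cvgrPdist_le /(_ (e / 2)) [|N _ HN]; first by rewrite divr_gt0.
  exists N => n Nn; have /= := HN n Nn; rewrite sub0r normrN ger0_norm; last first.
    by rewrite mulr_ge0 // exprn_ge0 // divr_ge0 // ltW.
  by rewrite expr_div_n mulrA ler_pdivrMr // exprn_gt0.
exists N => n j Nn ij; have fS : iter n Q f j <= cc r ^+ n * S.
  rewrite (@le_trans _ _ (iter n Q phi j)) ?iterQ_le //.
  rewrite (@le_trans _ _ (cc r ^+ n * phi j)) ?ler_pM2l ?exprn_gt0 //.
  apply: iterQ_super => //; first exact: ltW.
  by move=> k jk; apply: HB; exact: leq_trans jk.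
have res : iter n Q phi j <= (1 + K * e1) * iter n Q f j +
    (K * U * iter n Q (low_weight q J') j + B * iter n Q (low_weight q J) j).
  have bg : bounded_seq (fun k => K * U * low_weight q J' k + B * low_weight q J k).
    by apply: bounded_seqD; exact: bounded_seqZ.
  rewrite (_ : _ + _ = iter n Q (fun k => (1 + K * e1) * f k +
      1 * (K * U * low_weight q J' k + B * low_weight q J k)) j); last first.
    by rewrite iterQ_lin // mul1r iterQ_lin.
  apply: iterQ_le => //.
    by apply: bounded_seqD; exact: bounded_seqZ.
  by move=> k _; rewrite /phi mul1r mulrDr mulr1 mulrDl mul1r; have := fu k; lra.
have l1 : K * U * iter n Q (low_weight q J') j <= K * U * W' * rho ^+ n.
  rewrite -(mulrA _ W') ler_wpM2l ?mulr_ge0 // ?(ltW K0) ?(ltW U0) // (le_trans (wcontr _ _ _ ij)) //.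
  by rewrite mulrC ler_wpM2r ?exprn_ge0.
have l2 : B * iter n Q (low_weight q J) j <= B * W * rho ^+ n.
  rewrite -(mulrA _ W) ler_wpM2l // (le_trans (wcontr _ _ _ ij)) //.
  by rewrite mulrC ler_wpM2r ?exprn_ge0.
have l3 : K * e1 * iter n Q f j <= e / 2 * cc r ^+ n.
  have -> : e / 2 * cc r ^+ n = K * e1 * (cc r ^+ n * S).
    by rewrite /e1; field; rewrite !gt_eqF.
  by rewrite ler_wpM2l // ltW // mulr_gt0.
by have := HN n Nn; rewrite /A; lra.
Qed.

(** * The three regimes for the abstract operator *)

Lemma env_regime (L : (nat -> R) -> R) (i0 : nat) r :
  (forall f g, bounded_seq f -> bounded_seq g ->
    (forall k, (i0 <= k)%N -> f k <= g k) -> L f <= L g) ->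
  (forall a b f g, bounded_seq f -> bounded_seq g ->
    L (fun k => a * f k + b * g k) = a * L f + b * L g) ->
  (forall f, bounded_seq f -> (forall k, (i0 <= k)%N -> 0 < f k) -> 0 < L f) ->
  0 < r -> (0 < i0)%N -> gam i0 < cc r ->
  exists2 C : R, 0 < C &
    (fun n => cc r ^- n * L (iter n Q (npow r))) @ \oo --> C.
Proof.
move=> L_le L_lin L_gt0 r0 i00 gc.
have [phi [bphi fphi phic phi_small]] := npow_supersolution r i0 r0 i00 gc.
have [psi [bpsi psif psic psi_pos]] := npow_subsolution r r0.
have c0 := cc_gt0 r r0; have bf := bounded_npow r r0.
have cn n : 0 < cc r ^- n by rewrite invr_gt0 exprn_gt0.
have biphi n : bounded_seq (iter n Q phi) by exact: bounded_iterQ.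
have bipsi n : bounded_seq (iter n Q psi) by exact: bounded_iterQ.
have bif n : bounded_seq (iter n Q (npow r)) by exact: bounded_iterQ.
have L_scale a f : bounded_seq f -> L (fun k => a * f k) = a * L f.
  move=> bf'; have := L_lin a 0 f f bf' bf'; rewrite mul0r addr0 => <-.
  by congr L; apply/funext => k; rewrite mul0r addr0.
(* The sequence [x] is nonincreasing and dominates the sequence of interest [y]. As [x n - y n]
   tends to [0] and [y] is eventually at least [low > 0], both converge to one positive limit. *)
pose x n := cc r ^- n * L (iter n Q phi).
pose y n := cc r ^- n * L (iter n Q (npow r)).
have L1 : 0 < L (fun=> 1) by apply: L_gt0 => //; exact: bounded_seq_cst.
have x_dec : nonincreasing_seq x.
  apply/nonincreasing_seqP => n; rewrite /x ler_pdivrMl ?exprn_gt0 //.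
  have -> a : cc r ^+ n.+1 * (cc r ^- n * a) = cc r * a.
    by rewrite exprS; field; rewrite expf_neq0 ?gt_eqF.
  rewrite -L_scale //.
  apply: L_le => [||k ik]; [exact: (biphi _.+1)|exact: bounded_seqZ|].
  exact: iterQ_superS bphi phic ik.
have y_le_x n : y n <= x n.
  by rewrite ler_pM2l // L_le // => k _; exact: iterQ_le.
have [m Hm] := psi_pos i0 i00.
pose low := cc r ^- m * L (iter m Q psi).
have low0 : 0 < low by rewrite mulr_gt0 // L_gt0 // => k ik; exact: Hm.
have y_ge n : (m <= n)%N -> low <= y n.
  move=> /subnKC <-; rewrite (@le_trans _ _ (cc r ^- (m + (n - m)) * L (iter (m + (n - m)) Q psi))) //.
    elim: (n - m)%N => [|l ih]; first by rewrite addn0.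
    apply: le_trans ih _; rewrite addnS exprSr invfM -mulrA ler_pM2l //.
    rewrite ler_pdivlMl // -L_scale //.
    apply: L_le => [||k _]; [exact: bounded_seqZ|exact: (bipsi _.+1)|].
    exact: (iterQ_subS _ _ _ 0).
  by rewrite ler_pM2l // L_le // => k _; apply: iterQ_le => // l _; case/andP: (psif l).
have x_cvg : x @ \oo --> limn x.
  apply: nonincreasing_is_cvgn => //; exists 0 => _ [n _ <-].
  rewrite mulr_ge0 ?(ltW (cn n)) //.
  rewrite -(mul0r (L (fun=> 1))) -L_scale; last exact: bounded_seq_cst.
  apply: L_le => [||k _]; [by apply: bounded_seqZ; exact: bounded_seq_cst|exact: biphi|].
  rewrite mul0r; apply: iterQ_ge0 => // l _.
  by rewrite (le_trans _ (fphi l)) // npow_ge0.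
have xy : (fun n => x n - y n) @ \oo --> (0 : R).
  (* Division by the total mass of [L] turns the uniform bound on [[i0, oo)] into the bound [e]
     after applying [L]. *)
  apply/cvgrPdist_le => e e0; have [|N HN] := phi_small (e / L (fun=> 1)).
    by rewrite divr_gt0.
  exists N => // n /= Nn; rewrite sub0r normrN ger0_norm ?subr_ge0 //.
  rewrite /x /y -mulrBr ler_pdivrMl ?exprn_gt0 //.
  have -> : L (iter n Q phi) - L (iter n Q (npow r)) =
      L (fun k => 1 * iter n Q phi k + (-1) * iter n Q (npow r) k).
    by rewrite L_lin // mul1r mulN1r.
  have -> : cc r ^+ n * e = L (fun k => e / L (fun=> 1) * cc r ^+ n * 1).
    by rewrite L_scale; [field; rewrite gt_eqF|exact: bounded_seq_cst].
  apply: L_le => [||k ik].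
  - by apply: bounded_seqD; exact: bounded_seqZ.
  - exact: bounded_seq_cst.
  - by rewrite mulr1 mul1r mulN1r; exact: HN.
have y_cvg : y @ \oo --> limn x.
  rewrite (_ : y = (fun n => x n - (x n - y n))); last first.
    by apply/funext => n; rewrite subKr.
  by rewrite -[X in _ --> X]subr0; exact: cvgB.
exists (limn x) => //; rewrite (lt_le_trans low0) //.
rewrite -(cvg_lim (@Rhausdorff R) y_cvg); apply: limr_ge; first by apply/cvg_ex; exists (limn x).
by exists m => // n /=; exact: y_ge.
Qed.

(** Here the positive functional [L] is evaluation at [i]. The generality of [env_regime] serves the
    boundary case, where [L] is one step conditioned to leave [i], up to normalisation. *)
Lemma iterQ_env_regime r i : 0 < r -> (0 < i)%N -> gam i < cc r ->
  exists2 C : R, 0 < C &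
    (fun n => cc r ^- n * iter n Q (npow r) i) @ \oo --> C.
Proof.
move=> r0 i0 gc; apply: (env_regime (fun f => f i) i) => //.
- by move=> f g _ _; exact.
- by move=> f _; exact.
Qed.

(** With equal rates, the increments of [a n = cc r ^- n * iter n Q (npow r) i] come only from moves
    above [i]. There the holding probabilities are below [cc r], so [env_regime] on [[i.+1, oo)]
    makes the increments converge to a positive limit, and [a n] grows linearly. *)
Lemma iterQ_boundary_regime r i : 0 < r -> (0 < i)%N -> gam i = cc r ->
  exists2 C : R, 0 < C &
    (fun n => iter n Q (npow r) i / (n%:R * gam i ^+ n)) @ \oo --> C.
Proof.
move=> r0 i0 gc; have c0 := cc_gt0 r r0.
have [|||||C C0 HC] := env_regime (fun f => Q (above i f) i) i.+1 r _ _ _ r0 _ _ => //.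
- move=> f g bf bg fg; apply: Q_le => [||k _]; [exact: bounded_above..|].
  by rewrite /above; case: ifP => // /fg.
- move=> a b f g bf bg; rewrite -Q_lin; [|exact: bounded_above..].
  by congr (Q _ i); apply/funext => k; rewrite /above; case: ifP; rewrite // !mulr0 addr0.
- move=> f bf f0; apply: Q_gt0 => // [|k _|k ik]; first exact: bounded_above.
    by rewrite /above; case: ifP => // /f0/ltW.
  by rewrite /above ik f0.
- by rewrite -gc gam_dec.
exists (C / cc r); first by rewrite divr_gt0.
pose a n := cc r ^- n * iter n Q (npow r) i.
have bi n : bounded_seq (iter n Q (npow r)) by apply: bounded_iterQ; exact: bounded_npow.
have aS n : a n.+1 - a n = cc r ^- n * Q (above i (iter n Q (npow r))) i / cc r.
  rewrite /a iterS Q_first // gc exprSr; field.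
  by rewrite expf_neq0 ?gt_eqF.
have da : telescope a @ \oo --> C / cc r.
  rewrite (_ : telescope a = fun n => cc r ^- n * Q (above i (iter n Q (npow r))) i / cc r).
    exact: cvgMl.
  by apply/funext => n; exact: aS.
(* The mean of the increments telescopes to [(a n.+1 - a 0) / n.+1], and [a 0 * harmonic n] restores
   the initial term. The shift discards the index [0], at which the denominator vanishes. *)
have am := cesaro da; rewrite -cvg_shiftS.
rewrite (_ : (fun n => _) = (fun n => arithmetic_mean (telescope a) n + a 0%N * harmonic n)).
  have -> : C / cc r = C / cc r + a 0%N * 0 by rewrite mulr0 addr0.
  have h : a 0%N * harmonic n @[n --> \oo] --> a 0%N * (0 : R).
    by apply: cvgMr; exact: cvg_harmonic.
  exact: cvgD am h.
apply/funext => n; rewrite /arithmetic_mean telescopeK /= /harmonic /= /a gc.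
by rewrite expr0 invr1 mul1r mulrBr [npow r i / _]mulrC subrK /= invfM [RHS]mulrA [RHS]mulrC.
Qed.

(** The normalised sequence is nondecreasing, since moves above [i] only add mass, and bounded,
    since what they add at time [n] is of order [rho ^+ n] with [rho < gam i]. Its first term,
    [npow r i], is already positive. *)
Lemma iterQ_small_regime r i : 0 < r -> (0 < i)%N -> cc r < gam i ->
  exists2 C : R, 0 < C &
    (fun n => gam i ^- n * iter n Q (npow r) i) @ \oo --> C.
Proof.
move=> r0 i0 cg; have c0 := cc_gt0 r r0; have c1 := cc_le1 r r0.
have g0 : 0 < gam i := lt_trans c0 cg.
have bf := bounded_npow r r0.
have bi n : bounded_seq (iter n Q (npow r)) by exact: bounded_iterQ.
have giS : gam i.+1 < gam i by exact: gam_dec.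
pose rho := (Num.max (cc r) (gam i.+1) + gam i) / 2.
have rhog : rho < gam i by rewrite /rho; case: (ltP (cc r) (gam i.+1)) => _; lra.
have [crho grho] : cc r < rho /\ gam i.+1 < rho.
  by rewrite /rho; case: (ltP (cc r) (gam i.+1)) => h; split; lra.
pose q := Num.min 1 ((rho - gam i.+1) / 2).
have q0 : 0 < q by rewrite lt_min ltr01 divr_gt0 // subr_gt0.
have q1 : q <= 1 by rewrite ge_min lexx.
have gq : gam i.+1 + 2 * q <= rho.
  have : q <= (rho - gam i.+1) / 2 by rewrite ge_min lexx orbT.
  by lra.
have rho0 : 0 < rho := lt_trans c0 crho.
have [C C0 QC] := Q_npow r r0.
(* At a rate [rho > cc r] there is room to spare: once [C * eps j <= rho - cc r], the uncorrected
   [npow r] is a supersolution. *)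
have [|J eJ] := eps_small ((rho - cc r) / (C + 1)).
  by rewrite divr_gt0 ?subr_gt0 // ltr_wpDl.
have [|B B0 HB] := supersolution_extend i.+1 (maxn 1 J) rho q _ isT q0 q1 gq bf (npow_ge0 r).
  move=> j; rewrite geq_max => /andP[j0 Jj].
  have := QC j j0; rewrite ler_norml => /andP[_].
  have := eJ j Jj; rewrite ler_pdivlMr ?ltr_wpDl // => eC.
  have : (C * eps j) * npow r j <= (rho - cc r) * npow r j.
    by rewrite ler_wpM2r ?npow_ge0 //; have := eps_ge0 j; lra.
  by lra.
have bphi : bounded_seq (fun k => npow r k + B * low_weight q (maxn 1 J) k).
  by apply: bounded_seqD => //; apply: bounded_seqZ; exact: bounded_low_weight.
have [S S0 phiS] := bounded_seqW _ bphi.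
have step n : Q (above i (iter n Q (npow r))) i <= S * rho ^+ n.
  rewrite -[leRHS](Q_cst _ i); apply: Q_le => [||k _].
  - exact: bounded_above.
  - exact: bounded_seq_cst.
  rewrite /above; case: ifP => [ik|_]; last by rewrite mulr_ge0 ?exprn_ge0 ?ltW.
  rewrite (@le_trans _ _ (iter n Q (fun k => npow r k + B * low_weight q (maxn 1 J) k) k)) //.
    by apply: iterQ_le => // l _; rewrite lerDl mulr_ge0 // low_weight_ge0.
  rewrite (@le_trans _ _ (rho ^+ n * (npow r k + B * low_weight q (maxn 1 J) k))) //.
    apply: iterQ_super => //; first exact: ltW.
    by move=> l kl; apply: HB; exact: leq_trans kl.
  by rewrite mulrC ler_wpM2r // exprn_ge0 // ltW.
pose a n := gam i ^- n * iter n Q (npow r) i.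
have gn n : 0 < gam i ^+ n by rewrite exprn_gt0.
have a_nd : nondecreasing_seq a.
  apply/nondecreasing_seqP => n; rewrite /a iterS Q_first //.
  rewrite exprSr mulrDr invfM -[X in _ <= X + _]mulrA mulKf ?gt_eqF //.
  rewrite lerDl mulr_ge0 //; first by rewrite mulr_ge0 // invr_ge0 ltW.
  apply: Q_ge0 => [|k _]; first exact: bounded_above.
  rewrite /above; case: ifP => // _.
  by apply: iterQ_ge0 => // l _; exact: npow_ge0.
pose D := S / (gam i - rho).
have D0 : 0 <= D by rewrite divr_ge0 ?subr_ge0 ?ltW.
(* The right side is the solution of [x n.+1 = gam i * x n + S * rho ^+ n] with [x 0 = 1]. *)
have a_bound n : iter n Q (npow r) i <= (1 + D) * gam i ^+ n - D * rho ^+ n.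
  elim: n => [|n ih]; first by rewrite /= !expr0 !mulr1 addrK npow_le1.
  rewrite iterS Q_first // (le_trans (lerD (ler_wpM2l (ltW g0) ih) (step n))) //.
  have -> : S = D * (gam i - rho) by rewrite divfK // gt_eqF // subr_gt0.
  by rewrite !exprSr; lra.
have a_cvg : a @ \oo --> limn a.
  apply: nondecreasing_is_cvgn => //; exists (1 + D) => _ [n _ <-].
  rewrite /a ler_pdivrMl // mulrC (le_trans (a_bound n)) // gerBl.
  by rewrite mulr_ge0 // exprn_ge0 // ltW.
exists (limn a) => //; rewrite (@lt_le_trans _ _ (a 0%N)) //.
  by rewrite /a /= expr0 invr1 mul1r npow_gt0.
apply: nondecreasing_cvgn_le => //; apply/cvg_ex; exists (limn a); exact: a_cvg.
Qed.

End upward_markov.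

(** * Integration along the environment *)

Section integral_extension.
Local Open Scope ereal_scope.
Context d d' (T : measurableType d) (S : measurableType d') {R : realType}
  (mu : {measure set T -> \bar R}).
Import HBNNSimple.

Lemma integral_comp_indic (V : T -> \bar R) (Y : T -> S) (B : set S) :
  \int[mu]_(w in Y @^-1` B) V w = \int[mu]_w (V w * (\1_B (Y w))%:E).
Proof.
rewrite integral_mkcond; apply: eq_integral => w _; rewrite /patch indicE.
have -> : (w \in Y @^-1` B) = (Y w \in B) by apply/idP/idP; rewrite !inE.
by case: ifP => _; rewrite ?mule1 ?mule0.
Qed.

(* Agreement on the sigma-algebra of [Y] extends from indicators to
   nonnegative functions of [Y]. *)
Lemma eq_integral_comp (V1 V2 : T -> \bar R) (Y : T -> S) (F : S -> \bar R) :
  measurable_fun setT V1 -> measurable_fun setT V2 ->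
  (forall w, 0 <= V1 w) -> (forall w, 0 <= V2 w) ->
  measurable_fun setT Y -> measurable_fun setT F -> (forall y, 0 <= F y) ->
  (forall B, measurable B ->
    \int[mu]_(w in Y @^-1` B) V1 w = \int[mu]_(w in Y @^-1` B) V2 w) ->
  \int[mu]_w (V1 w * F (Y w)) = \int[mu]_w (V2 w * F (Y w)).
Proof.
move=> mV1 mV2 V10 V20 mY mF F0 V12.
pose g := nnsfun_approx measurableT mF.
have gcvg y : (g n y)%:E @[n --> \oo] --> F y by exact: cvg_nnsfun_approx.
have gnd y m n : (m <= n)%N -> (g m y <= g n y)%R.
  by move=> mn; exact/lefP/nd_nnsfun_approx.
have lim V : measurable_fun setT V -> (forall w, 0 <= V w) ->
    \int[mu]_w (V w * (g n (Y w))%:E) @[n --> \oo] --> \int[mu]_w (V w * F (Y w)).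
  move=> mV V0.
  rewrite [X in _ --> X](_ : _ =
      \int[mu]_w limn (fun n => V w * (g n (Y w))%:E)); last first.
    apply: eq_integral => w _; apply/esym/cvg_lim => //.
    (* The two zero cases are separated because the limit of a product is not defined for [0] times
       infinity. *)
    have [->|Vn0] := eqVneq (V w) 0.
      by rewrite mul0e; under eq_fun do rewrite mul0e; exact: cvg_cst.
    have [Fw0|Fn0] := eqVneq (F (Y w)) 0.
      have g0 n : (g n (Y w))%:E = 0.
        apply/eqP; rewrite eq_le; apply/andP; split; last by rewrite lee_fin.
        rewrite -[leRHS]Fw0 /g nnsfun_approxE.
        by apply: le_approx => //.
      by rewrite Fw0 mule0; under eq_fun do rewrite g0 mule0; exact: cvg_cst.
    apply: cvgeM; [|exact: cvg_cst|exact: gcvg].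
    by rewrite neq0_mule_def // mule_eq0 negb_or Vn0.
  apply: cvg_monotone_convergence => //.
  - move=> n; apply: emeasurable_funM => //.
    by apply/measurable_EFinP; apply: measurableT_comp.
  - by move=> n w _; rewrite mule_ge0 // lee_fin.
  - by move=> w _ m n mn; rewrite lee_wpmul2l // lee_fin gnd.
suff E n : \int[mu]_w (V1 w * (g n (Y w))%:E) = \int[mu]_w (V2 w * (g n (Y w))%:E).
  have := lim V1 mV1 V10; under eq_fun do rewrite E; move=> l1.
  exact: (cvg_unique _ l1 (lim V2 mV2 V20)).
(* A simple function of [Y] is a finite combination of indicators of its level sets, and these are
   the sets on which agreement is assumed. *)
have dec V : measurable_fun setT V -> (forall w, 0 <= V w) ->
    \int[mu]_w (V w * (g n (Y w))%:E) =
    \sum_(y \in range (g n)) (y%:E * \int[mu]_(w in Y @^-1` (g n @^-1` [set y])) V w).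
  move=> mV V0.
  have mi y : measurable_fun setT (fun w => V w * (\1_(g n @^-1` [set y]) (Y w))%:E).
    apply: emeasurable_funM => //; apply/measurable_EFinP.
    by apply: measurableT_comp => //; exact: measurable_indic.
  transitivity (\int[mu]_w \sum_(y \in range (g n))
      (y%:E * (V w * (\1_(g n @^-1` [set y]) (Y w))%:E)) ).
    apply: eq_integral => w _; rewrite [in LHS]fimfunE.
    rewrite -fsumEFin // ge0_mule_fsumr.
      by apply: eq_fsbigr => y _; rewrite EFinM muleCA.
    move=> y; case: (pselect (exists z, g n z = y)) => [[z <-]|h].
      by rewrite lee_fin mulr_ge0.
    rewrite lee_fin indicE memNset ?mulr0 // => gy; apply: h; by exists (Y w).
  rewrite ge0_integral_fsum //.
  - apply: eq_fsbigr => y; rewrite inE => -[z _ <-].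
    rewrite integral_comp_indic ge0_integralZl_EFin //.
    by move=> w _; rewrite mule_ge0 // lee_fin.
  - move=> y; exact: measurable_funeM.
  - move=> y w _; case: (pselect (exists z, g n z = y)) => [[z <-]|h].
      by rewrite mule_ge0 ?lee_fin // mule_ge0 // lee_fin.
    rewrite indicE memNset ?mule0 // => gy; apply: h; by exists (Y w).
rewrite (dec V1) // (dec V2) //; apply: eq_fsbigr => y _; rewrite V12 //.
Qed.

End integral_extension.

Lemma measurable_prode d (T : measurableType d) (R : realType) (I : Type)
    (s : seq I) (p : pred I) (F : I -> T -> \bar R) :
  (forall i, measurable_fun setT (F i)) ->
  measurable_fun setT (fun w => (\prod_(i <- s | p i) F i w)%E).
Proof.
move=> mF; elim: s => [|i s ih].
  by under eq_fun do rewrite big_nil; exact: measurable_cst.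
under eq_fun do rewrite big_cons.
by case: (p i) => //; exact: emeasurable_funM.
Qed.

(** * Integrals of functions of an integer-valued variable *)

Section nat_valued.
Local Open Scope ereal_scope.
Context d (T : measurableType d) {R : realType} (mu : {measure set T -> \bar R}).

Lemma nneseries_single (a : nat -> \bar R) k : (forall j, 0 <= a j) ->
  (forall j, j != k -> a j = 0) -> \sum_(j <oo) a j = a k.
Proof.
move=> a0 ak; rewrite (nneseriesD1 (n := k)) //= eseries0 ?adde0 // => j _ /=.
exact: ak.
Qed.

(** Integration against the counting measure allows [y] to be infinite. *)
Lemma ge0_nneseriesZl (y : \bar R) (f : nat -> \bar R) : 0 <= y ->
  (forall k, 0 <= f k) -> \sum_(k <oo) (y * f k) = y * \sum_(k <oo) f k.
Proof.
move=> y0 f0; rewrite -!ge0_integral_count //; last by move=> k; rewrite mule_ge0.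
by rewrite ge0_integralZl.
Qed.

Lemma integral_nat_valued (V : T -> \bar R) (N : T -> nat) (f : nat -> \bar R) :
  measurable_fun setT V -> (forall w, 0 <= V w) -> measurable_fun setT N ->
  (forall k, 0 <= f k) ->
  \int[mu]_w (V w * f (N w)) =
  \sum_(k <oo) (f k * \int[mu]_(w in N @^-1` [set k]) V w).
Proof.
move=> mV V0 mN f0.
have mi k : measurable_fun setT (fun w => V w * (\1_[set k] (N w))%:E).
  apply: emeasurable_funM => //; apply/measurable_EFinP.
  by apply: measurableT_comp.
have i0 k w : 0 <= V w * (\1_[set k] (N w))%:E by rewrite mule_ge0 // lee_fin.
transitivity (\int[mu]_w \sum_(k <oo) (f k * (V w * (\1_[set k] (N w))%:E))).
  apply: eq_integral => w _; rewrite (@nneseries_single _ (N w)).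
  - by rewrite indicE mem_set //= mule1 muleC.
  - by move=> j; rewrite mule_ge0.
  - by move=> j /eqP jN; rewrite indicE memNset ?mule0 // => /= Nj; apply: jN.
rewrite integral_nneseries //; last first.
- by move=> k w _; rewrite mule_ge0.
- move=> k; apply: emeasurable_funM => //; exact: measurable_cst.
apply: eq_eseriesr => k _; rewrite ge0_integralZl // integral_comp_indic //.
Qed.

Lemma integral_nat_valuedT (N : T -> nat) (f : nat -> \bar R) :
  measurable_fun setT N -> (forall k, 0 <= f k) ->
  \int[mu]_w f (N w) = \sum_(k <oo) (f k * mu (N @^-1` [set k])).
Proof.
move=> mN f0; have := @integral_nat_valued (fun=> 1) N f _ _ mN f0.
under eq_integral do rewrite mul1e; move=> -> //.
apply: eq_eseriesr => k _; rewrite integral_cst ?mul1e //.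
by rewrite -[X in measurable X]setTI; exact: mN.
Qed.

End nat_valued.

(** * Measurability of functionals of the mark *)

Section mark_measurability.
Context {R : realType}.

(** The sigma-algebra on laws is generated by the sets [mset U r] with [0 <= r <= 1]; any other
    threshold gives the empty set or everything. *)
Lemma measurable_pprobability_ev (U : set nat) :
  measurable_fun setT (fun mu : pprobability nat R => mu U).
Proof.
apply: (measurability _ (ErealGenInftyO.measurableE R)) => _ /= -[_ [r ->] <-].
rewrite setTI preimage_itvNyo -/(mset U r).
have [r0|r0] := leP 0%R r; last by rewrite lt0_mset.
have [r1|r1] := leP r 1%R; last by rewrite gt1_mset.
by apply: sub_sigma_algebra; exists r => /=; [rewrite in_itv/= r0|exists U].
Qed.

Lemma measurable_repro U : measurable_fun setT (fun e : mark R => repro e U).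
Proof.
by apply: (measurableT_comp (measurable_pprobability_ev U)); exact: measurable_fst.
Qed.

Lemma measurable_immig U : measurable_fun setT (fun e : mark R => immig e U).
Proof.
by apply: (measurableT_comp (measurable_pprobability_ev U)); exact: measurable_snd.
Qed.

Lemma repro_p_ (e : mark R) j : repro e [set j] = (p_ e j)%:E.
Proof. by rewrite fineK // fin_num_measure. Qed.

Lemma immig_h_ (e : mark R) j : immig e [set j] = (h_ e j)%:E.
Proof. by rewrite fineK // fin_num_measure. Qed.

Lemma p_ge0 (e : mark R) j : (0 <= p_ e j)%R.
Proof. by rewrite fine_ge0. Qed.

Lemma h_ge0 (e : mark R) j : (0 <= h_ e j)%R.
Proof. by rewrite fine_ge0. Qed.

Lemma p_le1 (e : mark R) j : (p_ e j <= 1)%R.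
Proof. by rewrite -lee_fin -repro_p_ probability_le1. Qed.

Lemma h_le1 (e : mark R) j : (h_ e j <= 1)%R.
Proof. by rewrite -lee_fin -immig_h_ probability_le1. Qed.

Lemma measurable_p_ j : measurable_fun setT (fun e : mark R => p_ e j).
Proof.
apply: (@measurableT_comp _ _ _ _ _ _ fine _ (fun e => repro e [set j])).
  exact: fine_measurable.
exact: measurable_repro.
Qed.

Lemma measurable_h_ j : measurable_fun setT (fun e : mark R => h_ e j).
Proof.
apply: (@measurableT_comp _ _ _ _ _ _ fine _ (fun e => immig e [set j])).
  exact: fine_measurable.
exact: measurable_immig.
Qed.

Definition repro_mean (phi : nat -> R) (e : mark R) : \bar R :=
  (\sum_(j <oo) (phi j * p_ e j)%:E)%E.

Lemma measurable_repro_mean phi : (forall j, 0 <= phi j) ->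
  measurable_fun setT (repro_mean phi).
Proof.
move=> phi0; apply: ge0_emeasurable_sum => [j e _ _|j _].
  by rewrite lee_fin mulr_ge0 // p_ge0.
apply/measurable_EFinP; apply: measurable_funM => //; exact: measurable_p_.
Qed.

Lemma repro_mean_ge0 phi e : (forall j, 0 <= phi j) -> (0 <= repro_mean phi e)%E.
Proof. by move=> phi0; apply: nneseries_ge0 => j _ _; rewrite lee_fin mulr_ge0 // p_ge0. Qed.

Lemma repro_mean1 e : repro_mean (fun=> 1) e = 1%E.
Proof.
rewrite -(@probability_setT _ _ _ (repro e)).
rewrite (_ : setT = \bigcup_k [set k]); last first.
  by apply/seteqP; split => // k _; exists k.
rewrite measure_semi_bigcup //.
  by apply: eq_eseriesr => j _; rewrite mul1r -repro_p_.
by move=> i j _ _ [k [/= <- <-]].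
Qed.

End mark_measurability.

(** * The Markov property *)

Section noise.
Context {d : measure_display} {T : measurableType d} {R : realType}
  {P : probability T R} (X : bprei P).
Local Open Scope ereal_scope.

Lemma env_law (F : mark R -> \bar R) k : measurable_fun setT F ->
  (forall e, 0 <= F e) ->
  \int[P]_w F (env X k w) = \int[P]_w F (env X 0%N w).
Proof.
move=> mF F0.
rewrite -[LHS](ge0_integral_distribution (env X k)) //.
rewrite -[RHS](ge0_integral_distribution (env X 0%N)) //.
apply: eq_measure_integral => B mB _.
by have [+ _] := env_iid X => /(_ k B mB).
Qed.

Lemma prod_indic N (A : nat -> set T) w :
  \prod_(n < N) (\1_(A n) w)%:E = (\1_(\bigcap_(n < N) A n) w)%:E :> \bar R.
Proof.
case: (pselect ((\bigcap_(n < N) A n) w)) => h; rewrite [in RHS]indicE.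
  rewrite mem_set //; apply: big1 => n _; rewrite indicE mem_set //.
  by apply: h => /=; exact: ltn_ord.
have [n nN nA] : exists2 n, (n < N)%N & ~ A n w.
  by apply: contrapT => g; apply: h => n nN; apply: contrapT => h2; apply: g; exists n.
by rewrite memNset // (bigD1 (Ordinal nN)) //= indicE memNset ?mul0e.
Qed.

(** Independence is given for sets. Indicators are replaced by general functions one factor at a
    time, by induction on the number [k] of leading factors that are already general. *)
Lemma env_product N (F : nat -> mark R -> \bar R) :
  (forall n, measurable_fun setT (F n)) -> (forall n e, 0 <= F n e) ->
  \int[P]_w \prod_(n < N) F n (env X n w) =
  \prod_(n < N) \int[P]_w F n (env X 0%N w).
Proof.
suff H k : forall F, (forall n, measurable_fun setT (F n)) -> (forall n e, 0 <= F n e) ->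
    (forall n, (k <= n < N)%N -> exists2 B, measurable B & F n = EFin \o \1_B) ->
    \int[P]_w \prod_(n < N) F n (env X n w) =
    \prod_(n < N) \int[P]_w F n (env X 0%N w).
  move=> mF F0; apply: (H N) => // n /andP[Nn]; by rewrite ltnNge Nn.
elim: k => [|k ih] {}F mF F0 HF.
  have /choice[B HB] : forall n, exists B, (n < N)%N -> measurable B /\ F n = EFin \o \1_B.
    move=> n; case: (ltnP n N) => nN; last by exists setT.
    by have [B mB ->] := HF n nN; exists B.
  pose B' n := if (n < N)%N then B n else setT.
  have mB' n : measurable (B' n).
    by rewrite /B'; case: ifPn => // nN; have [] := HB n nN.
  have FB' (n : 'I_N) e : F n e = (\1_(B' n) e)%:E.
    by rewrite /B' ltn_ord; have [_ ->] := HB n (ltn_ord n).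
  have [lawE ind] := env_iid X; have := ind N B' mB'.
  have mpre n : measurable (env X n @^-1` B' n).
    by rewrite -[X in measurable X]setTI; exact: measurable_funPT.
  have mpre0 n : measurable (env X 0%N @^-1` B' n).
    by rewrite -[X in measurable X]setTI; exact: measurable_funPT.
  have -> : \prod_(n < N) P (env X n @^-1` B' n) =
      \prod_(n < N) \int[P]_w F n (env X 0%N w).
    apply: eq_bigr => n _; rewrite lawE // -[in LHS](setIT (_ @^-1` _)) -integral_indic //.
    by apply: eq_integral => w _; rewrite FB'.
  move=> <-; rewrite (_ : [set w | _] = \bigcap_(n < N) (env X n @^-1` B' n)); last by [].
  rewrite -[in RHS](setIT (\bigcap_(n < N) _)) -integral_indic //; last first.
    rewrite bigcap_mkcond; apply: bigcapT_measurable => n.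
    by case: ifP => // _.
  apply: eq_integral => w _; under eq_bigr do rewrite FB'.
  exact: (prod_indic N (fun n => env X n @^-1` B' n)).
have [Nk|kN] := leqP N k.
  by apply: ih => // n /andP[kn nN]; move: (leq_ltn_trans kn nN); rewrite ltnNge Nk.
pose kO := Ordinal kN.
pose V1 w := \prod_(n < N | n != kO) F n (env X n w).
pose c := \prod_(n < N | n != kO) \int[P]_w F n (env X 0%N w).
have c0 : 0 <= c by apply: prode_ge0 => n _; exact: integral_ge0.
have mFe n m : measurable_fun setT (fun w => F n (env X m w)).
  by apply: measurableT_comp => //; exact: measurable_funPT.
under eq_integral do rewrite (bigD1 kO) //= muleC.
(* The product of the other factors may be replaced by the constant [c], because the induction
   hypothesis, with factor [k] an indicator, says that both have the same integral over every event
   of [env X k]. *)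
rewrite (@eq_integral_comp _ _ _ _ _ P V1 (fun=> c) (env X k) (F k)) //; last first.
- move=> B mB; rewrite integral_cst; last first.
    by rewrite -[X in measurable X]setTI; exact: measurable_funPT.
  rewrite integral_comp_indic.
  pose F' n := if n == k then EFin \o \1_B else F n.
  have mF' n : measurable_fun setT (F' n).
    by rewrite /F'; case: eqP => // _; apply/measurable_EFinP; exact: measurable_indic.
  have F'0 n e : 0 <= F' n e by rewrite /F'; case: eqP => //= _; rewrite lee_fin.
  have := ih F' mF' F'0; rewrite (bigD1 kO) //=.
  have -> : \int[P]_w \prod_(n < N) F' n (env X n w) =
      \int[P]_w (V1 w * (\1_B (env X k w))%:E).
    apply: eq_integral => w _; rewrite (bigD1 kO) //= muleC; congr (_ * _).
      by apply: eq_bigr => n /eqP nk; rewrite /F'; case: eqP => // nk'; case: nk; exact: val_inj.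
    by rewrite /F' eqxx.
  move=> ->; last first.
    move=> n /andP[kn nN]; rewrite /F'; case: eqP => [_|/eqP nk]; first by exists B.
    by apply: HF; rewrite nN andbT ltn_neqAle eq_sym nk kn.
  rewrite muleC; congr (_ * _).
    by apply: eq_bigr => n /eqP nk; rewrite /F'; case: eqP => // nk'; case: nk; exact: val_inj.
  rewrite /F' eqxx /=; have [lawE _] := env_iid X; rewrite lawE //.
  rewrite -[X in _ = P X]setIT -integral_indic //.
  by rewrite -[X in measurable X]setTI; exact: measurable_funPT.
- by move=> w; apply: prode_ge0.
- exact: measurable_prode.
rewrite ge0_integralZl // [RHS](bigD1 kO) //= muleC; congr (_ * _).
exact: env_law.
Qed.

(** All offspring indices are constrained, so that boxes built for different population sizes are
    events of the same form; [box_finite] returns to finitely many. *)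
Definition box (n : nat) (D : set nat) (B : nat -> set nat) : set T :=
  [set w | D (immigrants X n.+1 w) /\ forall i, B i (offspring X n i w)].

Lemma box_finite n D B K : (forall i, (K <= i)%N -> B i = setT) ->
  box n D B = [set w | D (immigrants X n.+1 w) /\
    forall i, (i < K)%N -> B i (offspring X n i w)].
Proof.
move=> BK; apply/seteqP; split => w /= [Dw Bw]; split => // i.
have [/Bw//|Ki] := ltnP i K; by rewrite BK.
Qed.

Lemma measurable_box n D B : measurable (box n D B).
Proof.
apply: measurableI.
  by rewrite -[X in measurable X]setTI; exact: (@measurable_funPT _ _ _ _ (immigrants X n.+1)).
rewrite (_ : (fun _ => _) = \bigcap_i (offspring X n i @^-1` B i)); last first.
  by apply/seteqP; split => w /= h i; [move=> _; exact: h|exact: h i Logic.I].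
apply: bigcapT_measurable => i.
by rewrite -[X in measurable X]setTI; exact: (@measurable_funPT _ _ _ _ (offspring X n i)).
Qed.

Lemma env_sigma_preimage n (B : set (mark R)) : measurable B ->
  env_sigma (env X) (env X n @^-1` B).
Proof. by move=> mB; apply: sub_sigma_algebra; exists n, B. Qed.

(** Given the environment, the probability of each box is a function of the mark of its generation
    alone, and the marks are i.i.d.; so under the annealed law the generations are i.i.d. as
    well. *)
Lemma noise_iid K N D B : (forall n i, (K <= i)%N -> B n i = setT) ->
  P [set w | forall n, (n < N)%N -> box n (D n) (B n) w] =
  \prod_(n < N) P (box 0%N (D n) (B n)).
Proof.
move=> BK.
pose F n (e : mark R) := immig e (D n) * \prod_(i < K) repro e (B n i).
have mF n : measurable_fun setT (F n).
  apply: emeasurable_funM; first exact: measurable_immig.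
  by apply: measurable_prode => i; exact: measurable_repro.
have F0 n e : 0 <= F n e by rewrite mule_ge0 // prode_ge0.
have boxE M (D' : nat -> set nat) (B' : nat -> nat -> set nat) :
    (forall n i, (K <= i)%N -> B' n i = setT) ->
    P [set w | forall n, (n < M)%N -> box n (D' n) (B' n) w] =
    \int[P]_w \prod_(n < M) (immig (env X n w) (D' n) *
      \prod_(i < K) repro (env X n w) (B' n i)).
  move=> B'K; have := @noise_law _ _ _ _ X _ (env_sigma_preimage 0%N setT measurableT) M K B' D'.
  rewrite preimage_setT setTI => <-; congr (P _); apply/seteqP; split => w /= h n nM.
    by have := h n nM; rewrite (box_finite _ _ _ K) // => i; exact: B'K.
  by rewrite (box_finite _ _ _ K); [exact: h|exact: B'K].
rewrite boxE // (env_product N F) //; apply: eq_bigr => n _.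
have := boxE 1%N (fun=> D n) (fun=> B n) (fun _ => BK n).
rewrite (_ : [set w | _] = box 0%N (D n) (B n)); last first.
  by apply/seteqP; split => w /= h; [exact: h|case].
move=> ->; apply: eq_integral => w _; by rewrite big_ord1.
Qed.

Definition step (j n : nat) (w : T) : nat :=
  (\sum_(l < j) offspring X n l w + immigrants X n.+1 w)%N.

Lemma measurable_step j n : measurable_fun setT (step j n).
Proof.
apply: measurable_fun_addn; last exact: measurable_funPT.
elim: j => [|j ih].
  by under eq_fun do rewrite big_ord0; exact: measurable_cst.
under eq_fun do rewrite big_ord_recr /=.
by apply: measurable_fun_addn => //; exact: measurable_funPT.
Qed.

Lemma Z_1 i w : Z_ X i 1 w = step i 0 w. Proof. by []. Qed.

Lemma measurable_preim (N : T -> nat) (B : set nat) :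
  measurable_fun setT N -> measurable (N @^-1` B).
Proof. by move=> mN; rewrite -[X in measurable X]setTI; exact: mN. Qed.

Lemma measurable_Z i n : measurable_fun setT (Z_ X i n).
Proof.
elim: n => [|n ih]; first exact: measurable_cst.
move=> _ B _; rewrite setTI (_ : _ @^-1` _ =
    \bigcup_j ((Z_ X i n @^-1` [set j]) `&` (step j n @^-1` B))); last first.
  apply/seteqP; split => w /=; first by exists (Z_ X i n w).
  by move=> [j _ [/= <-]].
apply: bigcupT_measurable => j; apply: measurableI; first exact: measurable_preim.
by apply: measurable_preim; exact: measurable_step.
Qed.

Definition step_box (j k : nat) (t : {ffun 'I_j -> 'I_k.+1} * 'I_k.+1) (i : nat) : set nat :=
  if insub i is Some i' then [set (t.1 i' : nat)] else setT.

(** If the total is [k], every summand is at most [k]; the event is therefore a finite disjoint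
    union of boxes, indexed by the exact values of the summands. *)
Lemma step_split j k n (E : set T) : measurable E ->
  P (E `&` step j n @^-1` [set k]) =
  \sum_(t \in [set t : {ffun 'I_j -> 'I_k.+1} * 'I_k.+1 |
                (\sum_(l < j) t.1 l + t.2)%N = k])
    P (E `&` box n [set (t.2 : nat)] (step_box j k t)).
Proof.
move=> mE; rewrite -measure_fin_bigcup.
- congr (P _); apply/seteqP; split => w /=.
    move=> [Ew sw].
    have le (l : 'I_j) : (offspring X n l w < k.+1)%N.
      by rewrite ltnS -sw /step (bigD1 l) //= -!addnA leq_addr.
    have le2 : (immigrants X n.+1 w < k.+1)%N by rewrite ltnS -sw /step leq_addl.
    exists ([ffun l => Ordinal (le l)], Ordinal le2) => /=.
      by rewrite -[RHS]sw /step; congr addn; apply: eq_bigr => l _; rewrite ffunE.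
    split => //; split => //= i; rewrite /step_box.
    by case: insubP => // i' _ <- /=; rewrite ffunE.
  move=> [t /= tk [Ew [/= w2 w1]]]; split => //; rewrite -[RHS]tk /step w2; congr addn.
  apply: eq_bigr => l _; have := w1 l; by rewrite /step_box (valK l).
- exact: finite_finset.
- move=> s t _ _ [w [[_ [/= s2 s1]] [_ [/= t2 t1]]]].
  rewrite (surjective_pairing s) (surjective_pairing t); congr pair; last first.
    by apply: val_inj; rewrite /= -s2 -t2.
  apply/ffunP => l; apply: val_inj => /=.
  have := s1 l; have := t1 l; by rewrite /step_box (valK l) => /= -> ->.
- by move=> t _; apply: measurableI => //; exact: measurable_box.
Qed.

Definition later (n L : nat) (D : nat -> set nat) (B : nat -> nat -> set nat) : set T :=
  [set w | forall m, (m < L)%N -> box (n + m) (D m) (B m) w].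

Lemma measurable_later n L D B : measurable (later n L D B).
Proof.
rewrite (_ : later _ _ _ _ = \bigcap_(m < L) box (n + m) (D m) (B m)); last by [].
rewrite bigcap_mkcond; apply: bigcapT_measurable => m.
by case: ifP => // _; exact: measurable_box.
Qed.

Definition cons_fam {A : Type} (a : A) (f : nat -> A) (m : nat) : A :=
  if m is m'.+1 then f m' else a.

Lemma laterS n L D B D0 B0 : later n L.+1 (cons_fam D0 D) (cons_fam B0 B) =
  box n D0 B0 `&` later n.+1 L D B.
Proof.
apply/seteqP; split => w /=.
  move=> h; split; first by have := h 0%N isT; rewrite addn0.
  by move=> m mL; have := h m.+1 mL; rewrite addnS.
move=> [h0 h] [|m] mL; first by rewrite addn0.
by rewrite /= addnS; exact: h.
Qed.

(** Induction on [n] for all future events at once: the last past generation is split into boxes,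
    and each of them is prepended to the future by [cons_fam], which lowers [n] and raises [L]. *)
Lemma past_future i n : forall L D B K j,
  (forall m l, (K <= l)%N -> B m l = setT) ->
  P (Z_ X i n @^-1` [set j] `&` later n L D B) =
  P (Z_ X i n @^-1` [set j]) * \prod_(m < L) P (box 0%N (D m) (B m)).
Proof.
elim: n => [|n ih] L D B K k BK.
  have -> : later 0 L D B = [set w | forall n, (n < L)%N -> box n (D n) (B n) w] by [].
  rewrite -(noise_iid K) //; have [<-|ik] := eqVneq i k.
    rewrite (_ : _ @^-1` _ = setT) ?setTI ?probability_setT ?mul1e //.
    by apply/seteqP; split.
  rewrite (_ : _ @^-1` _ = set0) ?set0I ?measure0 ?mul0e //.
  by apply/seteqP; split => // w /= /eqP; rewrite (negbTE ik).
have mZ j : measurable (Z_ X i n @^-1` [set j]) by apply: measurable_preim; exact: measurable_Z.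
have stepE L' D' B' K' : (forall m l, (K' <= l)%N -> B' m l = setT) ->
    P (Z_ X i n.+1 @^-1` [set k] `&` later n.+1 L' D' B') =
    \sum_(j <oo) (P (Z_ X i n @^-1` [set j]) * P (step j 0%N @^-1` [set k]) *
      \prod_(m < L') P (box 0%N (D' m) (B' m))).
  move=> B'K'.
  pose E j := Z_ X i n @^-1` [set j] `&` later n.+1 L' D' B'.
  have mE j : measurable (E j) by apply: measurableI => //; exact: measurable_later.
  have mS j : measurable (step j n @^-1` [set k]) by apply: measurable_preim; exact: measurable_step.
  rewrite (_ : _ `&` _ = \bigcup_j (E j `&` step j n @^-1` [set k])); last first.
    apply/seteqP; split => w /=.
      by move=> [Zk lw]; exists (Z_ X i n w).
    by move=> [j _ [[/= <- lw] sk]].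
  rewrite measure_semi_bigcup; last 3 first.
  - by move=> j; exact: measurableI.
  - by move=> j1 j2 _ _ [w [[[/= <- _] _] [[/= <- _] _]]].
  - by apply: bigcupT_measurable => j; exact: measurableI.
  apply: eq_eseriesr => j _; rewrite [LHS]step_split //.
  have -> : P (step j 0%N @^-1` [set k]) =
      \sum_(t \in [set t : {ffun 'I_j -> 'I_k.+1} * 'I_k.+1 |
                (\sum_(l < j) t.1 l + t.2)%N = k])
      P (box 0%N [set (t.2 : nat)] (step_box j k t)).
    rewrite -[step j 0%N @^-1` _]setTI step_split //.
    by apply: eq_fsbigr => t _; rewrite setTI.
  rewrite -muleA ge0_mule_fsuml // ge0_mule_fsumr //; last by move=> t; rewrite mule_ge0 // prode_ge0.
  apply: eq_fsbigr => t _.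
  rewrite (_ : E j `&` _ = Z_ X i n @^-1` [set j] `&`
      later n L'.+1 (cons_fam [set (t.2 : nat)] D') (cons_fam (step_box j k t) B')); last first.
    by rewrite laterS /E -setIA (setIC (later _ _ _ _)).
  rewrite (ih _ _ _ (maxn j K')) ?big_ord_recl //.
  move=> [|m] l; rewrite geq_max => /andP[jl Kl] /=; last exact: B'K'.
  by rewrite /step_box insubF // ltnNge jl.
(* The same expansion with an empty future identifies the remaining series as the law of the next
   population size, and the product factors out. *)
rewrite (stepE L D B K) //; have := stepE 0%N D B K BK.
rewrite (_ : later n.+1 0 D B = setT); last by apply/seteqP; split.
rewrite setIT big_ord0 => ->.
have pf : \prod_(m < L) P (box 0%N (D m) (B m)) \is a fin_num.
  by apply: prode_fin_num => m _; exact: fin_num_measure (measurable_box _ _ _).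
rewrite [in RHS]muleC -(fineK pf) -nneseriesZl; last first.
  by move=> j _; rewrite mule1 mule_ge0.
by apply: eq_eseriesr => j _; rewrite mule1 muleC.
Qed.

Lemma Z_chapman i n k : P (Z_ X i n.+1 @^-1` [set k]) =
  \sum_(j <oo) (P (Z_ X i n @^-1` [set j]) * P (Z_ X j 1 @^-1` [set k])).
Proof.
have mZ j : measurable (Z_ X i n @^-1` [set j]) by apply: measurable_preim; exact: measurable_Z.
have mS j : measurable (step j n @^-1` [set k]) by apply: measurable_preim; exact: measurable_step.
rewrite (_ : _ @^-1` _ = \bigcup_j (Z_ X i n @^-1` [set j] `&` step j n @^-1` [set k])); last first.
  apply/seteqP; split => w /=; first by move=> Zk; exists (Z_ X i n w).
  by move=> [j _ [/= <- sk]].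
rewrite measure_semi_bigcup; last 3 first.
- by move=> j; exact: measurableI.
- by move=> j1 j2 _ _ [w [[/= <- _] [/= <- _]]].
- by apply: bigcupT_measurable => j; exact: measurableI.
apply: eq_eseriesr => j _; rewrite [LHS]step_split //.
rewrite (_ : Z_ X j 1 @^-1` [set k] = [set: T] `&` step j 0%N @^-1` [set k]); last by rewrite setTI.
rewrite step_split // ge0_mule_fsumr //; apply: eq_fsbigr => t _; rewrite setTI.
rewrite (_ : box n [set (t.2 : nat)] (step_box j k t) =
    later n 1 (fun=> [set (t.2 : nat)]) (fun=> step_box j k t)); last first.
  apply/seteqP; split => w /=.
    by move=> h [|//] _; rewrite addn0.
  by move=> /(_ 0%N isT); rewrite addn0.
rewrite (past_future i n _ _ _ j) ?big_ord1 // => _ l jl.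
by rewrite /step_box insubF // ltnNge jl.
Qed.

(** The Markov property at time [n]: both sides expand, by [Z_chapman], into the same nonnegative
    double series over the values at times [n] and [n.+1]. *)
Lemma integral_Z i n (f : nat -> R) : (forall k, (0 <= f k)%R) ->
  \int[P]_w (f (Z_ X i n.+1 w))%:E =
  \int[P]_w (\int[P]_w' (f (Z_ X (Z_ X i n w) 1 w'))%:E).
Proof.
move=> f0; have f0' k : 0 <= (f k)%:E by rewrite lee_fin.
pose g j := \int[P]_w' (f (Z_ X j 1 w'))%:E.
have g0 j : 0 <= g j by exact: integral_ge0.
have gE j : g j = \sum_(k <oo) ((f k)%:E * P (Z_ X j 1 @^-1` [set k])).
  by apply: (@integral_nat_valuedT _ _ _ P _ (EFin \o f)) => //; exact: measurable_Z.
have -> : \int[P]_w g (Z_ X i n w) = \sum_(j <oo) (g j * P (Z_ X i n @^-1` [set j])).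
  by apply: integral_nat_valuedT => //; exact: measurable_Z.
have mZ m j k : measurable (Z_ X m j @^-1` [set k]).
  by apply: measurable_preim; exact: measurable_Z.
transitivity (\sum_(k <oo) \sum_(j <oo) ((f k)%:E *
    (P (Z_ X i n @^-1` [set j]) * P (Z_ X j 1 @^-1` [set k])))).
  transitivity (\sum_(k <oo) ((f k)%:E * P (Z_ X i n.+1 @^-1` [set k]))).
    by apply: (@integral_nat_valuedT _ _ _ P _ (EFin \o f)) => //; exact: measurable_Z.
  by apply: eq_eseriesr => k _; rewrite Z_chapman nneseriesZl // => j _; rewrite mule_ge0.
rewrite nneseries_interchange; last by move=> k j; rewrite !mule_ge0.
apply: eq_eseriesr => j _; rewrite gE.
have pf : P (Z_ X i n @^-1` [set j]) \is a fin_num by exact: fin_num_measure.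
rewrite muleC -(fineK pf) -nneseriesZl; last by move=> k _; rewrite mule_ge0.
by apply: eq_eseriesr => k _; rewrite muleCA.
Qed.

End noise.

(** * Moments of offspring numbers given the mark *)

Section conditional_moments.
Context {d : measure_display} {T : measurableType d} {R : realType}
  {P : probability T R} (X : bprei P).
Local Open Scope ereal_scope.
Local Notation e0 := (env X 0%N).
Local Notation xi := (offspring X 0%N).

(** In [noise_law], every index other than [l] and [m] receives the full set and contributes a
    factor [1]. *)
Lemma pair_law l m a b (C : set (mark R)) : l != m -> measurable C ->
  P (e0 @^-1` C `&` (xi l @^-1` [set a] `&` xi m @^-1` [set b])) =
  \int[P]_(w in e0 @^-1` C) (repro (e0 w) [set a] * repro (e0 w) [set b]).
Proof.
move=> lm mC; pose K := (maxn l m).+1.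
have lK : (l < K)%N by rewrite ltnS leq_maxl.
have mK : (m < K)%N by rewrite ltnS leq_maxr.
pose B (n i : nat) : set nat :=
  if i == l then [set a] else if i == m then [set b] else setT.
have := @noise_law _ _ _ _ X _ (env_sigma_preimage X 0%N C mC) 1%N K B (fun=> setT).
rewrite (_ : [set w | _] = xi l @^-1` [set a] `&` xi m @^-1` [set b]); last first.
  apply/seteqP; split => w /=.
    move=> /(_ 0%N isT)[_ h]; split.
      by have := h l lK; rewrite /B eqxx.
    by have := h m mK; rewrite /B eq_sym (negbTE lm) eqxx.
  move=> [xa xb] [|//] _; split => // i _; rewrite /B.
  by case: eqP => [->//|_]; case: eqP => [->|].
move=> ->; apply: eq_integral => w _; rewrite big_ord1 probability_setT mul1e.
rewrite (bigD1 (Ordinal lK)) //= (bigD1 (Ordinal mK)) /=; last first.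
  by rewrite -val_eqE /= eq_sym.
rewrite {1 2}/B eqxx [m == l]eq_sym (negbTE lm) eqxx big1 ?mule1 // => i /andP[il im].
move: il im; rewrite -!val_eqE /= /B => /negbTE -> /negbTE ->.
by rewrite probability_setT.
Qed.

(** Used for [pair_moment] twice, with [A], [B] the indicators of offspring values and with [A], [B]
    their conditional probabilities, so that only point masses need to be compared. *)
Lemma integral_series_mul (al be : nat -> R) (A B : nat -> T -> R) (V : T -> \bar R) :
  (forall k, (0 <= al k)%R) -> (forall k, (0 <= be k)%R) ->
  (forall k w, (0 <= A k w)%R) -> (forall k w, (0 <= B k w)%R) -> (forall w, 0 <= V w) ->
  (forall k, measurable_fun setT (A k)) -> (forall k, measurable_fun setT (B k)) ->
  measurable_fun setT V ->
  \int[P]_w (V w * ((\sum_(a <oo) ((al a)%:E * (A a w)%:E)) *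
                    (\sum_(b <oo) ((be b)%:E * (B b w)%:E)))) =
  \sum_(a <oo) \sum_(b <oo) ((al a * be b)%:E *
    \int[P]_w (V w * ((A a w)%:E * (B b w)%:E))).
Proof.
move=> al0 be0 A0 B0 V0 mA mB mV.
have mVAB a b : measurable_fun setT (fun w => V w * ((A a w)%:E * (B b w)%:E)).
  by apply: emeasurable_funM => //; apply: emeasurable_funM; exact/measurable_EFinP.
have mVAB' a b : measurable_fun setT
    (fun w => (al a * be b)%:E * (V w * ((A a w)%:E * (B b w)%:E))).
  exact: measurable_funeM.
have p0 a b w : 0 <= (al a * be b)%:E * (V w * ((A a w)%:E * (B b w)%:E)).
  by rewrite !mule_ge0 // lee_fin // mulr_ge0.
transitivity (\int[P]_w \sum_(a <oo) \sum_(b <oo)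
    ((al a * be b)%:E * (V w * ((A a w)%:E * (B b w)%:E)))).
  apply: eq_integral => w _; rewrite muleCA muleC -ge0_nneseriesZl; last 2 first.
  - by rewrite mule_ge0 // nneseries_ge0 // => b _ _; rewrite mule_ge0 // lee_fin.
  - by move=> a; rewrite mule_ge0 // lee_fin.
  apply: eq_eseriesr => a _; rewrite muleAC -ge0_nneseriesZl; last 2 first.
  - by rewrite mule_ge0 // mule_ge0 // lee_fin.
  - by move=> b; rewrite mule_ge0 // lee_fin.
  by apply: eq_eseriesr => b _; rewrite -muleA muleACA muleCA EFinM.
rewrite integral_nneseries //; last first.
- by move=> a w _; apply: nneseries_ge0.
- by move=> a; apply: ge0_emeasurable_sum.
apply: eq_eseriesr => a _; rewrite integral_nneseries //.
apply: eq_eseriesr => b _; rewrite ge0_integralZl_EFin ?mulr_ge0 //.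
by move=> w _; rewrite !mule_ge0 // lee_fin.
Qed.

Lemma pair_moment l m (phi1 phi2 : nat -> R) (psi : mark R -> \bar R) : l != m ->
  (forall k, (0 <= phi1 k)%R) -> (forall k, (0 <= phi2 k)%R) ->
  measurable_fun setT psi -> (forall e, 0 <= psi e) ->
  \int[P]_w (psi (e0 w) * ((phi1 (xi l w))%:E * (phi2 (xi m w))%:E)) =
  \int[P]_w (psi (e0 w) * (repro_mean phi1 (e0 w) * repro_mean phi2 (e0 w))).
Proof.
move=> lm p10 p20 mpsi psi0.
have p10' k : 0 <= (phi1 k)%:E by rewrite lee_fin.
have p20' k : 0 <= (phi2 k)%:E by rewrite lee_fin.
have mxi i : measurable_fun setT (xi i) by exact: measurable_funPT.
have me0 : measurable_fun setT e0 by exact: measurable_funPT.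
have mpe : measurable_fun setT (psi \o e0) by exact: measurableT_comp.
have mi i a : measurable_fun setT (fun w => (\1_(xi i @^-1` [set a]) w)%:E : \bar R).
  apply/measurable_EFinP; apply: measurable_indic.
  by rewrite -[X in measurable X]setTI; exact: mxi.
have mp a : measurable_fun setT (fun w => (p_ (e0 w) a)%:E).
  by apply/measurable_EFinP; exact: (measurableT_comp (measurable_p_ a) me0).
have pair a b : \int[P]_w (psi (e0 w) * ((\1_(xi l @^-1` [set a]) w)%:E * (\1_(xi m @^-1` [set b]) w)%:E)) =
   \int[P]_w (psi (e0 w) * ((p_ (e0 w) a)%:E * (p_ (e0 w) b)%:E)).
  under eq_integral do rewrite muleC.
  rewrite (@eq_integral_comp _ _ _ _ _ P _ (fun w => (p_ (e0 w) a)%:E * (p_ (e0 w) b)%:E) e0 psi) //.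
  - by under eq_integral do rewrite muleC.
  - exact: emeasurable_funM.
  - exact: emeasurable_funM.
  - by move=> w; rewrite mule_ge0 // lee_fin p_ge0.
  move=> C mC; have mC' : measurable (e0 @^-1` C).
    by rewrite -[X in measurable X]setTI; exact: me0.
  transitivity (P (e0 @^-1` C `&` (xi l @^-1` [set a] `&` xi m @^-1` [set b]))).
    rewrite [in RHS]setIC -integral_indic //.
      by apply: eq_integral => w _; rewrite -EFinM indicI.
    by apply: measurableI; rewrite -[X in measurable X]setTI; exact: mxi.
  rewrite pair_law //; apply: eq_integral => w _; congr (_ * _); exact: repro_p_.
have xiE i (phi : nat -> R) w : (forall k, (0 <= phi k)%R) ->
    (phi (xi i w))%:E = \sum_(a <oo) ((phi a)%:E * (\1_(xi i @^-1` [set a]) w)%:E).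
  move=> phi0; rewrite (@nneseries_single _ _ (xi i w)).
  - by rewrite indicE mem_set //= mule1.
  - by move=> a; rewrite mule_ge0 // lee_fin.
  - by move=> a /eqP an; rewrite indicE memNset ?mule0 // => /= h; apply: an.
transitivity (\sum_(a <oo) \sum_(b <oo) ((phi1 a * phi2 b)%:E *
      \int[P]_w (psi (e0 w) * ((\1_(xi l @^-1` [set a]) w)%:E * (\1_(xi m @^-1` [set b]) w)%:E)))).
  rewrite -(integral_series_mul phi1 phi2 (fun a => \1_(xi l @^-1` [set a]))
    (fun b => \1_(xi m @^-1` [set b]))) //.
  - by apply: eq_integral => w _; rewrite (xiE l) // (xiE m).
  - by move=> a; exact/measurable_EFinP/mi.
  - by move=> b; exact/measurable_EFinP/mi.
under eq_eseriesr => a _ do under eq_eseriesr => b _ do rewrite pair.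
rewrite -(integral_series_mul phi1 phi2 (fun a w => p_ (e0 w) a) (fun b w => p_ (e0 w) b)) //.
- by move=> a w; exact: p_ge0.
- by move=> a w; exact: p_ge0.
- by move=> a; exact/measurable_EFinP/mp.
- by move=> a; exact/measurable_EFinP/mp.
Qed.

Lemma single_moment l (phi : nat -> R) (psi : mark R -> \bar R) :
  (forall k, (0 <= phi k)%R) -> measurable_fun setT psi -> (forall e, 0 <= psi e) ->
  \int[P]_w (psi (e0 w) * (phi (xi l w))%:E) =
  \int[P]_w (psi (e0 w) * repro_mean phi (e0 w)).
Proof.
move=> phi0 mpsi psi0; have ll : l != l.+1 by rewrite neq_ltn ltnSn.
have := pair_moment l l.+1 phi (fun=> 1%R) psi ll phi0 (fun=> ler01) mpsi psi0.
under eq_integral do rewrite mule1; move=> ->.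
by apply: eq_integral => w _; rewrite repro_mean1 mule1.
Qed.

End conditional_moments.

(** * The one-step expansion of negative powers *)

Section power_inequalities.
Context {R : realType}.
Implicit Types t x y m r : R.

Lemma ln_le_subr1 t : 0 < t -> ln t <= t - 1.
Proof.
by move=> t0; have := @le_ln1Dx R (t - 1); rewrite addrCA subrr addr0; apply; lra.
Qed.

Lemma ln_ge_sub1V t : 0 < t -> 1 - t^-1 <= ln t.
Proof.
move=> t0; have := ln_le_subr1 t^-1; rewrite invr_gt0 lnV ?posrE // => /(_ t0).
by lra.
Qed.

Lemma powRN_ge_affine r t : 0 <= r -> 0 < t -> 1 - r * (t - 1) <= t `^ (- r).
Proof.
move=> r0 t0; rewrite /powR gt_eqF // (le_trans _ (expR_ge1Dx _)) //.
by rewrite lerD2l mulNr lerN2 ler_wpM2l // ln_le_subr1.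
Qed.

(** With [s = t - 1] and [D = 1 + (1 + r) * s], the bound [ln t >= 1 - 1 / t] gives [t]^ r >= D /
    t[, hence]t [^ (- r) <= t / D]. The condition on [t] keeps [D] above [1 / 2], and the quadratic
    then dominates [t / D]. *)
Lemma powRN_le_taylor2 r t : 0 <= r -> `|t - 1| <= (4 * (1 + r))^-1 ->
  t `^ (- r) <= 1 - r * (t - 1) + 2 * r * (1 + r) * (t - 1) ^+ 2.
Proof.
move=> r0 ht; have r10 : 0 < 1 + r by lra.
set s := t - 1 in ht *; have ts : t = 1 + s by rewrite /s; lra.
have hs : (1 + r) * `|s| <= 4^-1.
  have := ler_wpM2l (ltW r10) ht; rewrite invfM mulrCA mulfV ?mulr1 // gt_eqF //.
have s1 : - 4^-1 <= (1 + r) * s.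
  rewrite -[leRHS]opprK lerN2 -mulrN (le_trans _ hs) // ler_pM2l //.
  by rewrite -normrN ler_norm.
have s2 : - 4^-1 <= s.
  have : `|s| <= 4^-1.
    by rewrite (le_trans _ hs) // ler_peMl // lerDl.
  by have := ler_norm (- s); rewrite normrN; lra.
have t0 : 0 < t by lra.
set D := 1 + (1 + r) * s; have D0 : 2^-1 <= D by rewrite /D; lra.
have Dpos : 0 < D by lra.
have Dt : D / t <= t `^ r.
  rewrite [leRHS]/powR gt_eqF // (le_trans _ (expR_ge1Dx _)) //.
  have -> : D / t = 1 + r * (1 - t^-1) by rewrite /D ts; field; rewrite -ts gt_eqF.
  by rewrite lerD2l ler_wpM2l // ln_ge_sub1V.
have : t `^ (- r) <= t / D.
  rewrite powRN -[leRHS]invrK lef_pV2 ?posrE ?powR_gt0 //.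
    by rewrite invf_div.
  by rewrite invr_gt0 divr_gt0.
move=> /le_trans; apply; rewrite ler_pdivrMr //.
have q0 : 0 <= r * (1 + r) * s ^+ 2 by rewrite mulr_ge0 ?sqr_ge0 // mulr_ge0 // ltW.
have : 2^-1 * (2 * (r * (1 + r) * s ^+ 2)) <= D * (2 * (r * (1 + r) * s ^+ 2)).
  by rewrite ler_wpM2r // mulr_ge0.
by rewrite ts /D; lra.
Qed.

Lemma powRN_le1 r x : 0 <= r -> 1 <= x -> x `^ (- r) <= 1.
Proof.
by move=> r0 x1; rewrite -[leRHS](powRr0 x) ler_powR // oppr_le0.
Qed.

(** Meant for [x] the population ratio, [y] its truncated version and [m] the mean. The difference
    [x - y] enters to first order only, as it will have just a first moment, while [y - m] is
    expanded to second order. *)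
Lemma powRN_taylor r : 0 <= r -> exists2 C : R, 0 <= C & forall x y m,
  1 <= y -> y <= x -> 1 <= m ->
  `|x `^ (- r) - m `^ (- r) + r * m `^ (- r) * ((y - m) / m)| <=
  C * ((x - y) / m + ((y - m) / m) ^+ 2).
Proof.
move=> r0; pose dl := (4 * (1 + r))^-1.
have r10 : 0 < 1 + r by lra.
have dl0 : 0 < dl by rewrite invr_gt0 mulr_gt0.
have dl4 : dl <= 4^-1 by rewrite /dl lef_pV2 ?posrE ?mulr_gt0 // ler_peMr // lerDl.
(* The summands pay, in order, for replacing [x] by [y], for the quadratic remainder when [y] is
   near [m], and for the trivial bound when [y] is far from [m]. *)
pose C := 2 * r + 2 * r * (1 + r) + (dl^-1 ^+ 2 + r * dl^-1).
have C1 : 0 <= 2 * r by lra.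
have C2 : 0 <= 2 * r * (1 + r) by rewrite mulr_ge0 // ltW.
have C3 : 0 <= dl^-1 ^+ 2 + r * dl^-1 by rewrite addr_ge0 // ?sqr_ge0 // mulr_ge0 // invr_ge0 ltW.
have C0 : 0 <= C := addr_ge0 (addr_ge0 C1 C2) C3.
exists C => // x y m y1 yx m1.
have m0 : 0 < m by lra.
have y0 : 0 < y by lra.
have x0 : 0 < x by lra.
set s := (y - m) / m; set a := (x - y) / m.
have a0 : 0 <= a by rewrite divr_ge0 ?subr_ge0 // ltW.
have mr0 : 0 < m `^ (- r) by rewrite powR_gt0.
have mr1 := powRN_le1 r m r0 m1; have xr1 := powRN_le1 r x r0 (le_trans y1 yx).
have xr0 : 0 < x `^ (- r) by rewrite powR_gt0.
have yr0 : 0 < y `^ (- r) by rewrite powR_gt0.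
have yr1 := powRN_le1 r y r0 y1.
have ys : y / m = 1 + s by rewrite /s; field; rewrite gt_eqF.
have [sd|sd] := leP `|s| dl.
  have yE : y `^ (- r) = m `^ (- r) * (y / m) `^ (- r).
    by rewrite -powRM ?divr_ge0 ?ltW // mulrC divfK // gt_eqF.
  have lo := powRN_ge_affine r (y / m) r0 (divr_gt0 y0 m0).
  have hi : (y / m) `^ (- r) <= 1 - r * s + 2 * r * (1 + r) * s ^+ 2.
    have := powRN_le_taylor2 r (y / m) r0; rewrite ys (addrC 1 s) addrK; exact.
  have A1 : 0 <= m `^ (- r) * ((y / m) `^ (- r) - 1 + r * s).
    by rewrite mulr_ge0 // ?(ltW mr0) //; move: lo; rewrite ys; lra.
  have A2 : m `^ (- r) * ((y / m) `^ (- r) - 1 + r * s) <= 2 * r * (1 + r) * s ^+ 2.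
    rewrite -[leRHS]mul1r ler_pM ?(ltW mr0) //; first by move: lo; rewrite ys; lra.
    by lra.
  have xE : x `^ (- r) = y `^ (- r) * (x / y) `^ (- r).
    by rewrite -powRM ?divr_ge0 ?ltW // mulrC divfK // gt_eqF.
  have lo2 := powRN_ge_affine r (x / y) r0 (divr_gt0 x0 y0).
  have B1 : x `^ (- r) <= y `^ (- r).
    rewrite xE ler_piMr ?(ltW yr0) // powRN_le1 // ler_pdivlMr // mul1r //.
  have B2 : y `^ (- r) - x `^ (- r) <= 2 * r * a.
    have -> : y `^ (- r) - x `^ (- r) = y `^ (- r) * (1 - (x / y) `^ (- r)).
      by rewrite xE; ring.
    have xy0 : 0 <= r * (x / y - 1) by rewrite mulr_ge0 // subr_ge0 ler_pdivlMr // mul1r.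
    rewrite (@le_trans _ _ (1 * (r * (x / y - 1)))) //.
      have : y `^ (- r) * (1 - (x / y) `^ (- r)) <= y `^ (- r) * (r * (x / y - 1)).
        by rewrite ler_pM2l //; lra.
      by move/le_trans; apply; rewrite ler_wpM2r.
    have sd' : - s <= 4^-1 by rewrite (le_trans (ler_norm _)) // normrN (le_trans sd).
    have my2 : m / y <= 2.
      rewrite -[m / y]invf_div -[leRHS]invrK lef_pV2 ?posrE ?divr_gt0 ?invr_gt0 //.
      by rewrite ys; lra.
    rewrite (_ : x / y - 1 = a * (m / y)); last by rewrite /a; field; rewrite !gt_eqF.
    have : r * (a * (m / y)) <= r * (a * 2) by rewrite ler_wpM2l // ler_wpM2l.
    by lra.
  have E : x `^ (- r) - m `^ (- r) + r * m `^ (- r) * s =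
      m `^ (- r) * ((y / m) `^ (- r) - 1 + r * s) - (y `^ (- r) - x `^ (- r)).
    by rewrite yE; ring.
  rewrite E ler_norml.
  have s20 : 0 <= s ^+ 2 := sqr_ge0 s.
  have P1 : 0 <= 2 * r * s ^+ 2 by rewrite mulr_ge0.
  have P2 : 0 <= 2 * r * (1 + r) * a by rewrite mulr_ge0.
  have P3 : 0 <= (dl^-1 ^+ 2 + r * dl^-1) * (a + s ^+ 2) by rewrite mulr_ge0 // addr_ge0.
  have P4 : 0 <= 2 * r * a by rewrite mulr_ge0.
  have P5 : 0 <= 2 * r * (1 + r) * s ^+ 2 by rewrite mulr_ge0.
  by apply/andP; split; rewrite /C; lra.
have s0 : 0 < `|s| by rewrite (lt_trans dl0).
have ds : 1 <= dl^-1 * `|s| by rewrite ler_pdivlMl // mulr1 ltW.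
have s2E : `|s| ^+ 2 = s ^+ 2 by rewrite -normrX ger0_norm // sqr_ge0.
have B1 : 1 <= dl^-1 ^+ 2 * s ^+ 2 by rewrite -s2E -exprMn exprn_ege1.
have B2 : `|s| <= dl^-1 * s ^+ 2.
  by rewrite -s2E expr2 mulrA ler_peMl // ltW.
have G : `|x `^ (- r) - m `^ (- r) + r * m `^ (- r) * s| <= 1 + r * `|s|.
  rewrite (le_trans (ler_normD _ _)) // lerD //; first by rewrite ler_norml; lra.
  rewrite normrM ler_wpM2r // ger0_norm ?mulr_ge0 ?(ltW mr0) // ler_piMr //.
apply: (le_trans G).
have s20 : 0 <= s ^+ 2 := sqr_ge0 s.
have rB2 : r * `|s| <= r * (dl^-1 * s ^+ 2) by rewrite ler_wpM2l.
have P1 : 0 <= (2 * r + 2 * r * (1 + r)) * s ^+ 2 by rewrite mulr_ge0 // addr_ge0.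
have P2 : 0 <= C * a by rewrite mulr_ge0.
by move: P2; rewrite /C mulrDr; lra.
Qed.

(* [k (ln (1 + k / j))] decreases along the logarithmic scale at the rate
   [k ^+ 2 / (j + k)]. *)
Lemma ln_ratio_drop (k j l : nat) : (0 < j)%N -> (j <= l)%N ->
  (1 - j%:R / l%:R) * (k%:R * k%:R / (j%:R + k%:R)) <=
  k%:R * ln (1 + k%:R / j%:R) - k%:R * ln (1 + k%:R / l%:R) :> R.
Proof.
move=> j0 jl; have l0 : (0 < l)%N := leq_trans j0 jl.
have J0 : 0 < j%:R :> R by rewrite ltr0n.
have L0 : 0 < l%:R :> R by rewrite ltr0n.
have K0 : 0 <= k%:R :> R by rewrite ler0n.
have p1 : 0 < 1 + k%:R / j%:R :> R by rewrite ltr_wpDr // divr_ge0 // ltW.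
have p2 : 0 < 1 + k%:R / l%:R :> R by rewrite ltr_wpDr // divr_ge0 // ltW.
rewrite -mulrBr -ln_div ?posrE // mulrCA -mulrA ler_wpM2l //.
apply: le_trans (ln_ge_sub1V _ (divr_gt0 p1 p2)).
rewrite le_eqVlt; apply/orP; left; apply/eqP; field.
by rewrite !gt_eqF // ltr_wpDr.
Qed.

End power_inequalities.

(** * Expectations of bounded random variables *)

Section bounded_rv.
Context {d : measure_display} {T : measurableType d} {R : realType}
  (P : probability T R).
Implicit Types f g : T -> R.

Definition bounded_rv f := measurable_fun setT f /\ exists C : R, forall w, `|f w| <= C.

Lemma bounded_rv_cst (a : R) : bounded_rv (fun=> a).
Proof. by split; [exact: measurable_cst|exists `|a|]. Qed.

Lemma bounded_rvD f g : bounded_rv f -> bounded_rv g -> bounded_rv (fun w => f w + g w).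
Proof.
move=> [mf [A fA]] [mg [B gB]]; split; first exact: measurable_funD.
by exists (A + B) => w; rewrite (le_trans (ler_normD _ _)) // lerD.
Qed.

Lemma bounded_rvM f g : bounded_rv f -> bounded_rv g -> bounded_rv (fun w => f w * g w).
Proof.
move=> [mf [A fA]] [mg [B gB]]; split; first exact: measurable_funM.
by exists (A * B) => w; rewrite normrM ler_pM.
Qed.

Lemma bounded_rvN f : bounded_rv f -> bounded_rv (fun w => - f w).
Proof.
move=> [mf [A fA]]; split; first exact: measurableT_comp.
by exists A => w; rewrite normrN.
Qed.

Lemma bounded_rvB f g : bounded_rv f -> bounded_rv g -> bounded_rv (fun w => f w - g w).
Proof. by move=> bf bg; apply: bounded_rvD => //; exact: bounded_rvN. Qed.

Lemma bounded_rv_sum (n : nat) (F : nat -> T -> R) : (forall l, bounded_rv (F l)) ->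
  bounded_rv (fun w => \sum_(l < n) F l w).
Proof.
move=> bF; elim: n => [|n ih].
  by under eq_fun do rewrite big_ord0; exact: bounded_rv_cst.
by under eq_fun do rewrite big_ord_recr; exact: bounded_rvD.
Qed.

Lemma bounded_rv_integrable f : bounded_rv f -> P.-integrable setT (EFin \o f).
Proof.
move=> [mf [C fC]]; apply: (@measurable_bounded_integrable _ _ _ P f setT) => //.
  exact: fin_num_fun_lty.
exists C; split; first exact: num_real.
by move=> x Cx w /= _; exact: le_trans (fC w) (ltW Cx).
Qed.

Lemma bounded_rv_fin_num f : bounded_rv f -> (\int[P]_w (f w)%:E)%E \is a fin_num.
Proof. by move=> bf; apply: integrable_fin_num => //; exact: bounded_rv_integrable. Qed.

Lemma EFin_Rintegral f : bounded_rv f -> ((\int[P]_w f w)%R)%:E = (\int[P]_w (f w)%:E)%E.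
Proof. by move=> bf; rewrite /Rintegral fineK //; exact: bounded_rv_fin_num. Qed.

Lemma RintD f g : bounded_rv f -> bounded_rv g ->
  \int[P]_w (f w + g w) = \int[P]_w f w + \int[P]_w g w.
Proof. by move=> bf bg; rewrite RintegralD //; exact: bounded_rv_integrable. Qed.

Lemma RintB f g : bounded_rv f -> bounded_rv g ->
  \int[P]_w (f w - g w) = \int[P]_w f w - \int[P]_w g w.
Proof. by move=> bf bg; rewrite RintegralB //; exact: bounded_rv_integrable. Qed.

Lemma RintZ (a : R) f : bounded_rv f -> \int[P]_w (a * f w) = a * \int[P]_w f w.
Proof. by move=> bf; rewrite RintegralZl //; exact: bounded_rv_integrable. Qed.

Lemma Rint_cst (a : R) : \int[P]_w a = a.
Proof.
transitivity (a * fine (P setT)); first exact: Rintegral_cst.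
by rewrite probability_setT mulr1.
Qed.

Lemma Rint_le f g : bounded_rv f -> bounded_rv g ->
  {ae P, forall w, f w <= g w} -> \int[P]_w f w <= \int[P]_w g w.
Proof.
move=> bf bg fg.
have bgf : bounded_rv (fun w => g w - f w) by exact: bounded_rvB.
rewrite -subr_ge0 -RintB // /Rintegral fine_ge0 //.
(* The positive part agrees almost surely with the difference and is nonnegative everywhere. *)
rewrite (ae_eq_integral (fun w => (Num.max 0 (g w - f w))%:E)) //.
- by apply: integral_ge0 => w _; rewrite lee_fin le_max lexx.
- by apply/measurable_EFinP; case: bgf.
- apply/measurable_EFinP; apply: measurable_maxr; [exact: measurable_cst|by case: bgf].
- by apply: filterS fg => w fgw _; rewrite max_r // subr_ge0.
Qed.

Lemma Rint_eq f g : bounded_rv f -> bounded_rv g ->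
  {ae P, forall w, f w = g w} -> \int[P]_w f w = \int[P]_w g w.
Proof.
move=> bf bg fg; apply/eqP; rewrite eq_le !Rint_le //.
  by apply: filterS fg => w ->.
by apply: filterS fg => w ->.
Qed.

Lemma Rint_gt0 f : bounded_rv f -> {ae P, forall w, 0 <= f w} ->
  (0 < P [set w | 0 < f w]%R)%E -> 0 < \int[P]_w f w.
Proof.
move=> bf f0 Pf; have mf : measurable_fun setT f by case: bf.
rewrite lt_neqAle; apply/andP; split; last first.
  by rewrite -(Rint_cst 0) Rint_le //; exact: bounded_rv_cst.
apply/negP => /eqP E; move: Pf; rewrite lt0e => /andP[/eqP Pf _]; apply: Pf.
have I0 : (\int[P]_w `|(f w)%:E| = 0)%E.
  rewrite (ae_eq_integral (fun w => (f w)%:E)) //.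
  - by rewrite -EFin_Rintegral // -E.
  - by apply: measurableT_comp => //; exact/measurable_EFinP.
  - exact/measurable_EFinP.
  - by apply: filterS f0 => w fw _; rewrite gee0_abs.
have mEf : measurable_fun setT (EFin \o f) by exact/measurable_EFinP.
have [N [mN N0 sN]] := (ae_eq_integral_abs P measurableT mEf).1 I0.
apply: (subset_measure0 _ mN _ N0).
  rewrite (_ : [set w | _] = f @^-1` `]0, +oo[%classic); last first.
    by apply/seteqP; split => w /=; rewrite in_itv /= andbT.
  by rewrite -[X in measurable X]setTI; exact: mf.
by move=> w /= fw; apply: sN => /= /(_ Logic.I) [fw0]; rewrite fw0 ltxx in fw.
Qed.

End bounded_rv.

(** * Moments of the first generation *)

Section generation_moments.
Context {d : measure_display} {T : measurableType d} {R : realType}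
  {P : probability T R} (X : bprei P).
Hypothesis M_fin : {ae P, forall w, (0 < M_ext (env X 0%N w) < +oo)%E}.
Hypothesis p0_eq0 : {ae P, forall w, p_ (env X 0%N w) 0%N = 0}.
Local Notation e0 := (env X 0%N).
Local Notation xi := (offspring X 0%N).
Local Notation eta := (immigrants X 1%N).

(* Equal to [M_] almost surely, but everywhere at least [1]. *)
Definition M1 (e : mark R) : R := Num.max 1 (M_ e).

Lemma M1_ge1 e : 1 <= M1 e. Proof. by rewrite le_max lexx. Qed.

Lemma M1_gt0 e : 0 < M1 e. Proof. exact: lt_le_trans (M1_ge1 e). Qed.

Lemma M_ext_mean (e : mark R) : M_ext e = repro_mean (fun k => k%:R) e. Proof. by []. Qed.

Lemma measurable_M_ : measurable_fun setT (@M_ R).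
Proof.
apply: (@measurableT_comp _ _ _ _ _ _ fine _ (@M_ext R)); first exact: fine_measurable.
by apply: measurable_repro_mean.
Qed.

Lemma measurable_M1 : measurable_fun setT M1.
Proof. by apply: measurable_maxr; [exact: measurable_cst|exact: measurable_M_]. Qed.

Lemma measurable_M1_powR s : measurable_fun setT (fun e => M1 e `^ s).
Proof.
apply: (@measurableT_comp _ _ _ _ _ _ (@powR R ^~ s) _ M1).
  exact: measurable_powR.
exact: measurable_M1.
Qed.

Lemma measurable_M1V : measurable_fun setT (fun e => (M1 e)^-1).
Proof.
rewrite (_ : (fun e => (M1 e)^-1) = (fun e => M1 e `^ (-1))).
  exact: measurable_M1_powR.
by apply/funext => e; rewrite powR_inv1 // ltW // M1_gt0.
Qed.

Lemma repro_mean_le (phi psi : nat -> R) e : (forall k, 0 <= phi k) ->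
  (forall k, phi k <= psi k) -> (repro_mean phi e <= repro_mean psi e)%E.
Proof.
move=> phi0 le; apply: lee_nneseries => k _; last by rewrite lee_fin ler_wpM2r // p_ge0.
by move=> _; rewrite lee_fin mulr_ge0 // p_ge0.
Qed.

Lemma repro_meanZ (a : R) phi e : 0 <= a -> (forall k, 0 <= phi k) ->
  (repro_mean (fun k => (a * phi k)%R) e = a%:E * repro_mean phi e)%E.
Proof.
move=> a0 phi0; rewrite /repro_mean -nneseriesZl; last first.
  by move=> k _; rewrite lee_fin mulr_ge0 // p_ge0.
by apply: eq_eseriesr => k _; rewrite -mulrA EFinM.
Qed.

Lemma repro_mean_bound (phi : nat -> R) (B : R) e : 0 <= B -> (forall k, 0 <= phi k <= B) ->
  (repro_mean phi e <= B%:E)%E.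
Proof.
move=> B0 phiB; have phi0 k : 0 <= phi k by case/andP: (phiB k).
rewrite (@le_trans _ _ (repro_mean (fun=> B * 1) e)) //.
  by apply: repro_mean_le => // k; rewrite mulr1; case/andP: (phiB k).
by rewrite (repro_meanZ B (fun=> 1)) // repro_mean1 mule1.
Qed.

Lemma M_ext_ge1 (e : mark R) : p_ e 0%N = 0 -> (1 <= M_ext e)%E.
Proof.
move=> p0; rewrite M_ext_mean -(repro_mean1 e); apply: lee_nneseries => k _.
  by move=> _; rewrite lee_fin mul1r p_ge0.
rewrite lee_fin; case: k => [|k]; first by rewrite p0 !mulr0.
by rewrite ler_wpM2r ?p_ge0 // ler1n.
Qed.

Lemma ae_M1 : {ae P, forall w, M_ext (e0 w) = (M1 (e0 w))%:E}.
Proof.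
apply: filterS2 M_fin p0_eq0 => w /andP[_ Mlt] p0.
have M1le := M_ext_ge1 _ p0.
have Mf : M_ext (e0 w) \is a fin_num by rewrite ge0_fin_numE // (le_trans _ M1le).
by rewrite /M1 max_r /M_ ?fineK // -lee_fin fineK.
Qed.

Lemma ae_M_eq : {ae P, forall w, M_ (e0 w) = M1 (e0 w)}.
Proof. by apply: filterS ae_M1 => w h; rewrite /M_ h. Qed.

Lemma mxi l : measurable_fun setT (xi l). Proof. exact: measurable_funPT. Qed.
Lemma meta : measurable_fun setT eta. Proof. exact: measurable_funPT. Qed.
Lemma me0 : measurable_fun setT e0. Proof. exact: measurable_funPT. Qed.

(** The probability that [xi l] vanishes is the expectation of [p_0]. *)
Lemma ae_xi_ge1 : {ae P, forall w, forall l, (1 <= xi l w)%N}.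
Proof.
apply/ae_foralln => l; exists (xi l @^-1` [set 0%N]); split.
- by apply: measurable_preim; exact: mxi.
- have := single_moment X l (fun k => (k == 0%N)%:R) (fun=> 1%E) (fun k => ler0n _ _)
    (measurable_cst _) (fun=> lee01).
  under eq_integral do rewrite mul1e; under [in RHS]eq_integral do rewrite mul1e.
  rewrite [X in _ = X -> _](ae_eq_integral (fun=> 0%E)) ?integral0 //; first last.
  + apply: filterS p0_eq0 => w p0 _; rewrite /repro_mean (@nneseries_single _ _ 0%N).
    * by rewrite p0 mulr0.
    * by move=> j; rewrite lee_fin mulr_ge0 // p_ge0.
    * by move=> j /negbTE ->; rewrite mul0r.
  + by apply: measurableT_comp me0; apply: measurable_repro_mean => k; exact: ler0n.
  move=> E; rewrite -E -[in LHS](setIT (xi l @^-1` _)) -integral_indic //; last first.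
    by apply: measurable_preim; exact: mxi.
  apply: eq_integral => w _; congr (_%:E); rewrite indicE; congr (nat_of_bool _)%:R.
  by apply/idP/eqP; rewrite inE.
- by move=> w /= /negP; rewrite -ltnNge ltnS leqn0 => /eqP.
Qed.

Lemma ae_Z1_ge i : {ae P, forall w, (i <= Z_ X i 1 w)%N}.
Proof.
apply: filterS ae_xi_ge1 => w xi1; rewrite Z_1 /step (leq_trans _ (leq_addr _ _)) //.
by rewrite -{1}(card_ord i) -sum1_card leq_sum.
Qed.

Definition fmean (phi : nat -> R) (e : mark R) : R := fine (repro_mean phi e).

Lemma fmean_bound phi B e : 0 <= B -> (forall k, 0 <= phi k <= B) -> 0 <= fmean phi e <= B.
Proof.
move=> B0 phiB; have phi0 k : 0 <= phi k by case/andP: (phiB k).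
have r0 := repro_mean_ge0 phi e phi0; have rB := repro_mean_bound phi B e B0 phiB.
have rf : repro_mean phi e \is a fin_num by rewrite ge0_fin_numE // (le_lt_trans rB) // ltry.
by rewrite -!lee_fin fineK // r0.
Qed.

Lemma EFin_fmean phi B e : 0 <= B -> (forall k, 0 <= phi k <= B) ->
  (fmean phi e)%:E = repro_mean phi e.
Proof.
move=> B0 phiB; have phi0 k : 0 <= phi k by case/andP: (phiB k).
have rB := repro_mean_bound phi B e B0 phiB.
by rewrite fineK // ge0_fin_numE ?repro_mean_ge0 // (le_lt_trans rB) // ltry.
Qed.

Lemma measurable_fmean phi : (forall k, 0 <= phi k) -> measurable_fun setT (fmean phi).
Proof.
move=> phi0; apply: (@measurableT_comp _ _ _ _ _ _ fine _ (repro_mean phi)).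
  exact: fine_measurable.
exact: measurable_repro_mean.
Qed.

Lemma bounded_rv_mark (psi : mark R -> R) C : measurable_fun setT psi ->
  (forall e, 0 <= psi e <= C) -> bounded_rv (fun w => psi (e0 w)).
Proof.
move=> mpsi psiC; split; first exact: (measurableT_comp mpsi me0).
by exists C => w; case/andP: (psiC (e0 w)) => p0 pC; rewrite ger0_norm.
Qed.

Lemma bounded_rv_nat (N : T -> nat) (phi : nat -> R) B : measurable_fun setT N ->
  (forall k, 0 <= phi k <= B) -> bounded_rv (fun w => phi (N w)).
Proof.
move=> mN phiB; split; first exact: (@measurableT_comp _ _ _ _ _ _ phi).
by exists B => w; case/andP: (phiB (N w)) => p0 pC; rewrite ger0_norm.
Qed.

Lemma Rint_pair l m (phi1 phi2 : nat -> R) (B : R) (psi : mark R -> R) (C : R) : l != m -> 0 <= B ->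
  (forall k, 0 <= phi1 k <= B) -> (forall k, 0 <= phi2 k <= B) ->
  measurable_fun setT psi -> (forall e, 0 <= psi e <= C) ->
  \int[P]_w (psi (e0 w) * (phi1 (xi l w) * phi2 (xi m w))) =
  \int[P]_w (psi (e0 w) * (fmean phi1 (e0 w) * fmean phi2 (e0 w))).
Proof.
move=> lm B0 p1 p2 mpsi psiC; rewrite /Rintegral; congr fine.
under eq_integral do rewrite 2!EFinM.
under [RHS]eq_integral => w _.
  rewrite 2!EFinM (EFin_fmean phi1 B) // (EFin_fmean phi2 B) //; over.
apply: (pair_moment X l m phi1 phi2 (EFin \o psi)) => //.
- by move=> k; case/andP: (p1 k).
- by move=> k; case/andP: (p2 k).
- exact/measurable_EFinP.
- by move=> e; rewrite lee_fin; case/andP: (psiC e).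
Qed.

Lemma Rint_single l (phi : nat -> R) (B : R) (psi : mark R -> R) (C : R) : 0 <= B -> (forall k, 0 <= phi k <= B) ->
  measurable_fun setT psi -> (forall e, 0 <= psi e <= C) ->
  \int[P]_w (psi (e0 w) * phi (xi l w)) = \int[P]_w (psi (e0 w) * fmean phi (e0 w)).
Proof.
move=> B0 p1 mpsi psiC; rewrite /Rintegral; congr fine.
under eq_integral do rewrite EFinM.
under [RHS]eq_integral => w _ do rewrite EFinM (EFin_fmean phi B) //.
apply: (single_moment X l phi (EFin \o psi)) => //.
- by move=> k; case/andP: (p1 k).
- exact/measurable_EFinP.
- by move=> e; rewrite lee_fin; case/andP: (psiC e).
Qed.

Section truncation.
Variable j : nat.

(** The level is the current population size [j], which balances the bias of the truncated mean
    against the variance of the average of [j] terms. *)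
Definition trunc (k : nat) : R := (minn k j)%:R.
Definition tmean (e : mark R) : R := fmean trunc e.
Definition dev (l : nat) (w : T) : R := (trunc (xi l w) - tmean (e0 w)) / M1 (e0 w).

Let tr_bound k : 0 <= trunc k <= j%:R.
Proof. by rewrite ler0n ler_nat geq_minr. Qed.

Let tm_bound e : 0 <= tmean e <= j%:R.
Proof. by apply: fmean_bound => //; exact: ler0n. Qed.

Let mtm : measurable_fun setT tmean.
Proof. by apply: measurable_fmean => k; exact: ler0n. Qed.

Let VM_bound e : 0 <= (M1 e)^-1 <= 1.
Proof. by rewrite invr_ge0 (ltW (M1_gt0 e)) invf_le1 ?M1_gt0 // M1_ge1. Qed.

Let mVM : measurable_fun setT (fun e : mark R => (M1 e)^-1) := measurable_M1V.

Let btr l : bounded_rv (fun w => trunc (xi l w)).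
Proof. by apply: (bounded_rv_nat _ _ j%:R) => //; exact: mxi. Qed.

Let btm : bounded_rv (fun w => tmean (e0 w)).
Proof. exact: (bounded_rv_mark _ j%:R). Qed.

Let bVM : bounded_rv (fun w => (M1 (e0 w))^-1).
Proof. exact: (bounded_rv_mark (fun e => (M1 e)^-1) 1). Qed.

Lemma bounded_dev l : bounded_rv (dev l).
Proof. by apply: bounded_rvM => //; exact: bounded_rvB. Qed.

(** Given the mark, [tmean] is the mean of the truncated offspring number, so [dev] is conditionally
    centred. *)
Lemma Rint_dev l (psi : mark R -> R) (C : R) : measurable_fun setT psi -> (forall e, 0 <= psi e <= C) ->
  \int[P]_w (psi (e0 w) * dev l w) = 0.
Proof.
move=> mpsi psiC; have bpsi := bounded_rv_mark psi C mpsi psiC.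
pose psi' e := psi e * (M1 e)^-1.
have mpsi' : measurable_fun setT psi' by exact: measurable_funM.
have psi'C e : 0 <= psi' e <= C.
  case/andP: (psiC e) => p0 pC; case/andP: (VM_bound e) => v0 v1.
  by rewrite mulr_ge0 //= (le_trans _ pC) // ler_piMr.
have bpsi' := bounded_rv_mark psi' C mpsi' psi'C.
rewrite (_ : (fun w => _) = (fun w => psi' (e0 w) * trunc (xi l w) -
    psi' (e0 w) * tmean (e0 w))); last first.
  by apply/funext => w; rewrite /dev /psi'; ring.
rewrite RintB; [|exact: bounded_rvM..].
by rewrite (Rint_single l trunc j%:R psi' C) // subrr.
Qed.

Lemma Rint_dev2 l m : l != m -> \int[P]_w (dev l w * dev m w) = 0.
Proof.
move=> lm.
pose V e : R := (M1 e)^-1 * (M1 e)^-1.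
have mV : measurable_fun setT V by exact: measurable_funM.
have VC e : 0 <= V e <= 1.
  by case/andP: (VM_bound e) => v0 v1; rewrite mulr_ge0 //= -[leRHS]mulr1 ler_pM.
pose W e := V e * tmean e.
have mW : measurable_fun setT W by exact: measurable_funM.
have WC e : 0 <= W e <= j%:R.
  case/andP: (VC e) => v0 v1; case/andP: (tm_bound e) => t0 t1.
  by rewrite mulr_ge0 //= -[leRHS]mul1r ler_pM.
have bV := bounded_rv_mark V 1 mV VC; have bW := bounded_rv_mark W _ mW WC.
rewrite (_ : (fun w => _) = (fun w =>
    (V (e0 w) * (trunc (xi l w) * trunc (xi m w)) - W (e0 w) * trunc (xi l w)) -
    (W (e0 w) * trunc (xi m w) - V (e0 w) * (tmean (e0 w) * tmean (e0 w))))); last first.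
  by apply/funext => w; rewrite /dev /W /V; ring.
have b1 : bounded_rv (fun w => V (e0 w) * (trunc (xi l w) * trunc (xi m w))).
  by apply: bounded_rvM => //; exact: bounded_rvM.
have b2 i : bounded_rv (fun w => W (e0 w) * trunc (xi i w)) by exact: bounded_rvM.
have b3 : bounded_rv (fun w => V (e0 w) * (tmean (e0 w) * tmean (e0 w))).
  by apply: bounded_rvM => //; exact: bounded_rvM.
rewrite RintB; [|exact: bounded_rvB..]; rewrite !RintB //.
rewrite (Rint_pair l m trunc trunc j%:R V 1) //.
have E i : \int[P]_w (W (e0 w) * trunc (xi i w)) =
    \int[P]_w (V (e0 w) * (tmean (e0 w) * tmean (e0 w))).
  rewrite (Rint_single i trunc j%:R W j%:R) //.
  by apply: eq_Rintegral => w _; rewrite /W mulrA.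
by rewrite !E /tmean !subrr.
Qed.

(** A conditional variance is at most the second moment, and [M1 >= 1] lets one of the two factors
    [1 / M1] be dropped; the remaining one is the weight of (H3). *)
Lemma Rint_dev_sqr l :
  \int[P]_w (dev l w ^+ 2) <= \int[P]_w ((M1 (e0 w))^-1 * trunc (xi 0%N w) ^+ 2).
Proof.
pose V e : R := (M1 e)^-1 * (M1 e)^-1.
have mV : measurable_fun setT V by exact: measurable_funM.
have VC e : 0 <= V e <= 1.
  by case/andP: (VM_bound e) => v0 v1; rewrite mulr_ge0 //= -[leRHS]mulr1 ler_pM.
pose W e := V e * tmean e.
have mW : measurable_fun setT W by exact: measurable_funM.
have WC e : 0 <= W e <= j%:R.
  case/andP: (VC e) => v0 v1; case/andP: (tm_bound e) => t0 t1.
  by rewrite mulr_ge0 //= -[leRHS]mul1r ler_pM.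
have bV := bounded_rv_mark V 1 mV VC; have bW := bounded_rv_mark W _ mW WC.
have b1 i : bounded_rv (fun w => V (e0 w) * trunc (xi i w) ^+ 2).
  by apply: bounded_rvM => //; under eq_fun do rewrite expr2; exact: bounded_rvM.
have b1' : bounded_rv (fun w => (M1 (e0 w))^-1 * trunc (xi 0%N w) ^+ 2).
  by apply: bounded_rvM => //; under eq_fun do rewrite expr2; exact: bounded_rvM.
have b2 : bounded_rv (fun w => W (e0 w) * trunc (xi l w)) by exact: bounded_rvM.
have b3 : bounded_rv (fun w => W (e0 w) * tmean (e0 w)) by exact: bounded_rvM.
rewrite (_ : (fun w => dev l w ^+ 2) = (fun w =>
    V (e0 w) * trunc (xi l w) ^+ 2 - (2 * (W (e0 w) * trunc (xi l w)) -
    W (e0 w) * tmean (e0 w)))); last first.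
  by apply/funext => w; rewrite /dev /W /V; ring.
have b4 : bounded_rv (fun w => 2 * (W (e0 w) * trunc (xi l w))).
  by apply: bounded_rvM => //; exact: bounded_rv_cst.
rewrite RintB //; last exact: bounded_rvB.
rewrite RintB // RintZ // (Rint_single l trunc j%:R W j%:R) //.
have W0 : 0 <= \int[P]_w (W (e0 w) * tmean (e0 w)).
  apply: Rintegral_ge0 => w _; rewrite mulr_ge0 //.
    by case/andP: (WC (e0 w)).
  by case/andP: (tm_bound (e0 w)).
have E : \int[P]_w (V (e0 w) * trunc (xi l w) ^+ 2) =
    \int[P]_w (V (e0 w) * trunc (xi 0%N w) ^+ 2).
  have tb k : 0 <= trunc k ^+ 2 <= j%:R ^+ 2.
    by case/andP: (tr_bound k) => t0 t1; rewrite sqr_ge0 lerXn2r ?nnegrE ?ler0n.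
  have J2 : 0 <= j%:R ^+ 2 :> R by exact: sqr_ge0.
  rewrite (Rint_single l (fun k => trunc k ^+ 2) (j%:R ^+ 2) V 1) //.
  by rewrite (Rint_single 0%N (fun k => trunc k ^+ 2) (j%:R ^+ 2) V 1).
have : \int[P]_w (V (e0 w) * trunc (xi 0%N w) ^+ 2) <=
    \int[P]_w ((M1 (e0 w))^-1 * trunc (xi 0%N w) ^+ 2).
  apply: Rint_le => //; apply: aeW => w; rewrite ler_wpM2r ?sqr_ge0 //.
  by case/andP: (VM_bound (e0 w)) => v0 v1; rewrite /V ler_piMr.
by rewrite E; move: W0; rewrite /tmean; lra.
Qed.

(** The deviations are orthogonal by [Rint_dev2], so their second moments add up. *)
Lemma Rint_sum_dev_sqr n : \int[P]_w ((\sum_(l < n) dev l w) ^+ 2) <=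
  n%:R * \int[P]_w ((M1 (e0 w))^-1 * trunc (xi 0%N w) ^+ 2).
Proof.
have bd l := bounded_dev l.
have bs k : bounded_rv (fun w => \sum_(l < k) dev l w) by exact: bounded_rv_sum.
elim: n => [|n ih].
  under eq_Rintegral do rewrite big_ord0 expr0n.
  by rewrite Rint_cst mul0r.
have cross k : (k <= n)%N -> \int[P]_w ((\sum_(l < k) dev l w) * dev n w) = 0.
  elim: k => [_|k ihk kn].
    by under eq_Rintegral do rewrite big_ord0 mul0r; rewrite Rint_cst.
  under eq_Rintegral do rewrite big_ord_recr mulrDl.
  rewrite RintD; [|exact: bounded_rvM..].
  by rewrite ihk ?(ltnW kn) //= Rint_dev2 ?addr0 // ltn_eqF.
under eq_Rintegral do rewrite big_ord_recr /= sqrrD.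
have b1 : bounded_rv (fun w => (\sum_(l < n) dev l w) ^+ 2).
  by under eq_fun do rewrite expr2; exact: bounded_rvM.
have b2 : bounded_rv (fun w => (\sum_(l < n) dev l w) * dev n w *+ 2).
  by under eq_fun do rewrite mulr2n; apply: bounded_rvD; exact: bounded_rvM.
have b3 : bounded_rv (fun w => dev n w ^+ 2).
  by under eq_fun do rewrite expr2; exact: bounded_rvM.
rewrite RintD //; last exact: bounded_rvD.
rewrite RintD //.
have -> : \int[P]_w ((\sum_(l < n) dev l w) * dev n w *+ 2) = 0.
  under eq_Rintegral do rewrite -mulr_natl.
  by rewrite RintZ ?cross ?mulr0 //; exact: bounded_rvM.
by rewrite addr0 -natr1 mulrDl mul1r lerD // Rint_dev_sqr.
Qed.

End truncation.

Hypothesis eta_mean : (\int[P]_w ((eta w)%:R : R)%:E < +oo)%E.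

Lemma integral_xi_exch l (phi : nat -> R) : (forall k, 0 <= phi k) ->
  (\int[P]_w ((M1 (e0 w))^-1 * phi (xi l w))%:E =
   \int[P]_w ((M1 (e0 w))^-1 * phi (xi 0%N w))%:E)%E.
Proof.
move=> phi0.
have mV : measurable_fun setT (fun e : mark R => ((M1 e)^-1)%:E).
  by apply/measurable_EFinP; exact: measurable_M1V.
have V0 (e : mark R) : (0 <= ((M1 e)^-1)%:E)%E by rewrite lee_fin invr_ge0 ltW // M1_gt0.
under eq_integral do rewrite EFinM; under [RHS]eq_integral do rewrite EFinM.
rewrite (single_moment X l phi (fun e => ((M1 e)^-1)%:E)) //.
by rewrite (single_moment X 0%N phi (fun e => ((M1 e)^-1)%:E)).
Qed.

(** This is the normalisation of the size-biased offspring law; it makes every function bounded by a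
    multiple of [k] integrable against the weight [1 / M1]. *)
Lemma integral_xi_M1 : (\int[P]_w ((M1 (e0 w))^-1 * (xi 0%N w)%:R)%:E = 1)%E.
Proof.
have mV : measurable_fun setT (fun e : mark R => ((M1 e)^-1)%:E).
  by apply/measurable_EFinP; exact: measurable_M1V.
have V0 (e : mark R) : (0 <= ((M1 e)^-1)%:E)%E by rewrite lee_fin invr_ge0 ltW // M1_gt0.
under eq_integral do rewrite EFinM.
rewrite (single_moment X 0%N (fun k => k%:R) (fun e => ((M1 e)^-1)%:E)) //.
transitivity (\int[P]_w (1 : \bar R))%E; last first.
  transitivity (1 * P setT)%E; first exact: integral_cst.
  by rewrite probability_setT mul1e.
apply: ae_eq_integral => //.
  apply: emeasurable_funM; first exact: (measurableT_comp mV me0).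
  by apply: measurableT_comp me0; apply: measurable_repro_mean => k; exact: ler0n.
apply: filterS ae_M1 => w Mw _; rewrite -M_ext_mean Mw -EFinM mulVf //.
by rewrite gt_eqF // M1_gt0.
Qed.

(** Within a factor [2] of the minimum of [k] and [k ^+ 2 / j] for [j > 0]. It bounds both the part
    of [k] lost by truncation at [j] and, up to a constant, the truncated square divided by [j]. *)
Definition kap (j k : nat) : R := k%:R * k%:R / (j%:R + k%:R).

Lemma kap_ge0 j k : 0 <= kap j k.
Proof. by rewrite /kap divr_ge0 ?mulr_ge0 ?addr_ge0 ?ler0n. Qed.

Lemma kap_le j k : kap j k <= k%:R.
Proof.
rewrite /kap; case: k => [|k]; first by rewrite mul0r mul0r.
rewrite ler_pdivrMr; last by rewrite ltr_wpDl ?ler0n // ltr0n.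
by rewrite ler_wpM2l // lerDr.
Qed.

Definition kapE (j : nat) : R := \int[P]_w ((M1 (e0 w))^-1 * kap j (xi 0%N w)).

Lemma measurable_M1V_xi l (phi : nat -> R) :
  measurable_fun setT (fun w => (M1 (e0 w))^-1 * phi (xi l w)).
Proof.
apply: measurable_funM; first exact: (measurableT_comp measurable_M1V me0).
by apply: (@measurableT_comp _ _ _ _ _ _ phi) => //; exact: mxi.
Qed.

Lemma M1V_ge0 w : 0 <= (M1 (e0 w))^-1.
Proof. by rewrite invr_ge0 ltW // M1_gt0. Qed.

Lemma M1V_le1 w : (M1 (e0 w))^-1 <= 1.
Proof. by rewrite invf_le1 ?M1_gt0 // M1_ge1. Qed.

Lemma integrable_xi_le (phi : nat -> R) (c : R) : 0 <= c -> (forall k, 0 <= phi k <= c * k%:R) ->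
  (\int[P]_w ((M1 (e0 w))^-1 * phi (xi 0%N w))%:E <= c%:E)%E.
Proof.
move=> c0 phic; have phi0 k : 0 <= phi k by case/andP: (phic k).
have p0 w : (0 <= ((M1 (e0 w))^-1 * phi (xi 0%N w))%:E)%E by rewrite lee_fin mulr_ge0 // M1V_ge0.
rewrite -[leRHS]mule1 -integral_xi_M1 -ge0_integralZl_EFin //; last 2 first.
- by move=> w _; rewrite lee_fin mulr_ge0 ?M1V_ge0.
- by apply/measurable_EFinP; exact: measurable_M1V_xi.
apply: ge0_le_integral => //.
- by apply/measurable_EFinP; exact: measurable_M1V_xi.
- by apply: measurable_funeM; apply/measurable_EFinP; exact: measurable_M1V_xi.
- move=> w _; rewrite -EFinM lee_fin mulrCA ler_wpM2l ?M1V_ge0 //.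
  by case/andP: (phic (xi 0%N w)).
Qed.

Lemma kapE_EFin j : (kapE j)%:E = (\int[P]_w ((M1 (e0 w))^-1 * kap j (xi 0%N w))%:E)%E.
Proof.
rewrite /kapE /Rintegral fineK // ge0_fin_numE; last first.
  by apply: integral_ge0 => w _; rewrite lee_fin mulr_ge0 ?M1V_ge0 ?kap_ge0.
rewrite (le_lt_trans (integrable_xi_le (kap j) 1 ler01 _)) ?ltry // => k.
by rewrite kap_ge0 mul1r kap_le.
Qed.

Lemma kapE_ge0 j : 0 <= kapE j.
Proof. by apply: Rintegral_ge0 => w _; rewrite mulr_ge0 ?M1V_ge0 ?kap_ge0. Qed.

Lemma integral_xi_kap j l (phi : nat -> R) (c : R) : 0 <= c ->
  (forall k, 0 <= phi k <= c * kap j k) ->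
  (\int[P]_w ((M1 (e0 w))^-1 * phi (xi l w))%:E <= (c * kapE j)%:E)%E.
Proof.
move=> c0 phic; have phi0 k : 0 <= phi k by case/andP: (phic k).
rewrite integral_xi_exch // EFinM kapE_EFin -ge0_integralZl_EFin //; last 2 first.
- by move=> w _; rewrite lee_fin mulr_ge0 ?M1V_ge0 ?kap_ge0.
- by apply/measurable_EFinP; exact: measurable_M1V_xi.
apply: ge0_le_integral => //.
- by move=> w _; rewrite lee_fin mulr_ge0 ?M1V_ge0.
- by apply/measurable_EFinP; exact: measurable_M1V_xi.
- by apply: measurable_funeM; apply/measurable_EFinP; exact: measurable_M1V_xi.
- move=> w _; rewrite -EFinM lee_fin mulrCA ler_wpM2l ?M1V_ge0 //.
  by case/andP: (phic (xi 0%N w)).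
Qed.

Definition etaE : R := \int[P]_w ((eta w)%:R : R).

Lemma etaE_EFin : (etaE)%:E = (\int[P]_w ((eta w)%:R : R)%:E)%E.
Proof.
rewrite /etaE /Rintegral fineK // ge0_fin_numE //.
by apply: integral_ge0 => w _; rewrite lee_fin.
Qed.

Lemma etaE_ge0 : 0 <= etaE. Proof. by apply: Rintegral_ge0 => w _. Qed.

Definition defect (j : nat) : R := kapE j + etaE / j%:R.

Lemma defect_ge0 j : 0 <= defect j.
Proof. by rewrite addr_ge0 ?kapE_ge0 // divr_ge0 ?etaE_ge0. Qed.

Definition Mmom (r : R) : R := \int[P]_w (M1 (e0 w) `^ (- r)).

Lemma trunc_le j k : trunc j k <= k%:R.
Proof. by rewrite ler_nat geq_minl. Qed.

Lemma trunc_sqr_kap j k : (0 < j)%N -> trunc j k ^+ 2 <= (2 * j%:R) * kap j k.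
Proof.
move=> j0; have J0 : 0 < j%:R :> R by rewrite ltr0n.
have K0 : 0 <= k%:R :> R by rewrite ler0n.
rewrite /kap mulrA ler_pdivlMr; last by rewrite ltr_wpDr.
rewrite /trunc; have [kj|jk] := leqP k j.
  have : k%:R <= j%:R :> R by rewrite ler_nat.
  move=> kj'; have : k%:R ^+ 2 * (j%:R + k%:R) <= k%:R ^+ 2 * (2 * j%:R) :> R.
    by rewrite ler_wpM2l ?sqr_ge0 //; lra.
  by lra.
have jk' : j%:R <= k%:R :> R by rewrite ler_nat ltnW.
have : j%:R * (j%:R * (j%:R + k%:R)) <= j%:R * (2 * k%:R * k%:R) :> R.
  rewrite ler_wpM2l ?(ltW J0) // mulrC -mulrA [leRHS]mulrCA.
  have h1 : j%:R * j%:R <= k%:R * k%:R :> R by rewrite ler_pM // ltW.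
  have h2 : k%:R * j%:R <= k%:R * k%:R :> R by rewrite ler_wpM2l.
  by lra.
by lra.
Qed.

Lemma trunc_diff_kap j k : (0 < j)%N -> 0 <= k%:R - trunc j k <= 1 * kap j k.
Proof.
move=> j0; have J0 : 0 < j%:R :> R by rewrite ltr0n.
have K0 : 0 <= k%:R :> R by rewrite ler0n.
rewrite subr_ge0 trunc_le mul1r /= /kap ler_pdivlMr; last by rewrite ltr_wpDr.
rewrite /trunc; have [kj|jk] := leqP k j.
  by rewrite subrr mul0r mulr_ge0.
by have := mulr_ge0 (ltW J0) (ltW J0); lra.
Qed.

Lemma bounded_M1_powR r : 0 <= r -> bounded_rv (fun w => M1 (e0 w) `^ (- r)).
Proof.
move=> r0; apply: (bounded_rv_mark (fun e => M1 e `^ (- r)) 1).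
  exact: measurable_M1_powR.
by move=> e; rewrite powR_ge0 powRN_le1 // M1_ge1.
Qed.

Lemma bounded_M1V : bounded_rv (fun w => (M1 (e0 w))^-1).
Proof.
apply: (bounded_rv_mark (fun e => (M1 e)^-1) 1); first exact: measurable_M1V.
by move=> e; rewrite invr_ge0 (ltW (M1_gt0 e)) invf_le1 ?M1_gt0 // M1_ge1.
Qed.

Lemma tmean_bound j e : 0 <= tmean j e <= j%:R.
Proof. by apply: fmean_bound => // k; rewrite ler0n ler_nat geq_minr. Qed.

Lemma bounded_tmean j : bounded_rv (fun w => tmean j (e0 w)).
Proof.
apply: (bounded_rv_mark (tmean j) j%:R); last exact: tmean_bound.
by apply: measurable_fmean => k; exact: ler0n.
Qed.

Lemma ae_tmean_le j : {ae P, forall w, tmean j (e0 w) <= M1 (e0 w)}.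
Proof.
apply: filterS ae_M1 => w Mw.
rewrite -lee_fin -Mw M_ext_mean (EFin_fmean (trunc j) j%:R) //; last first.
  by move=> k; rewrite ler0n ler_nat geq_minr.
by apply: repro_mean_le => k; [exact: ler0n|exact: trunc_le].
Qed.

(** The gap is the conditional mean of [(xi - trunc j xi) / M1], and [k - trunc j k <= kap j k]. *)
Lemma Rint_trunc_gap j : (0 < j)%N ->
  \int[P]_w `|1 - (M1 (e0 w))^-1 * tmean j (e0 w)| <= kapE j.
Proof.
move=> j0.
have b1 : bounded_rv (fun w => (M1 (e0 w))^-1 * tmean j (e0 w)).
  by apply: bounded_rvM; [exact: bounded_M1V|exact: bounded_tmean].
have b2 : bounded_rv (fun w => 1 - (M1 (e0 w))^-1 * tmean j (e0 w)).
  by apply: bounded_rvB => //; exact: bounded_rv_cst.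
have b2' : bounded_rv (fun w => `|1 - (M1 (e0 w))^-1 * tmean j (e0 w)|).
  case: b2 => mb [C bC]; split; first exact: measurableT_comp.
  by exists C => w; rewrite normr_id.
rewrite (@Rint_eq _ _ _ P _ (fun w => 1 - (M1 (e0 w))^-1 * tmean j (e0 w))) //; last first.
  apply: filterS (ae_tmean_le j) => w tM.
  by rewrite ger0_norm // subr_ge0 ler_pdivrMl ?M1_gt0 // mulr1.
rewrite RintB //; last exact: bounded_rv_cst.
rewrite Rint_cst -(Rint_single 0%N (trunc j) j%:R (fun e => (M1 e)^-1) 1) //; last 3 first.
- by move=> k; rewrite ler0n ler_nat geq_minr.
- exact: measurable_M1V.
- by move=> e; rewrite invr_ge0 (ltW (M1_gt0 e)) invf_le1 ?M1_gt0 // M1_ge1.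
have b3 : bounded_rv (fun w => (M1 (e0 w))^-1 * trunc j (xi 0%N w)).
  apply: bounded_rvM; first exact: bounded_M1V.
  apply: (bounded_rv_nat _ _ j%:R); first exact: mxi.
  by move=> k; rewrite ler0n ler_nat geq_minr.
rewrite lerBlDl -lee_fin EFinD EFin_Rintegral // -integral_xi_M1.
have h := integral_xi_kap j 0%N (fun k => k%:R - trunc j k) 1 ler01
  (fun k => trunc_diff_kap j k j0).
rewrite mul1r in h; apply: (le_trans _ (leeD2l _ h)).
- rewrite -ge0_integralD //.
  + rewrite le_eqVlt; apply/orP; left; apply/eqP; apply: eq_integral => w _.
    by rewrite -EFinD; congr (_%:E); ring.
  + by move=> w _; rewrite lee_fin mulr_ge0 ?M1V_ge0 ?ler0n.
  + by apply/measurable_EFinP; case: b3.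
  + by move=> w _; rewrite lee_fin mulr_ge0 ?M1V_ge0 // subr_ge0 trunc_le.
  + apply/measurable_EFinP.
    exact: (measurable_M1V_xi 0%N (fun k => k%:R - trunc j k)).
Qed.

(** The truncated square costs [2 * j * kap], the sum of [j] orthogonal terms another factor [j],
    and both factors [j] are removed by the squared average. *)
Lemma Rint_mean_dev j : (0 < j)%N ->
  \int[P]_w ((j%:R^-1 * \sum_(l < j) dev j l w) ^+ 2) <= 2 * kapE j.
Proof.
move=> j0; have J0 : 0 < j%:R :> R by rewrite ltr0n.
have bs : bounded_rv (fun w => \sum_(l < j) dev j l w).
  by apply: bounded_rv_sum => l; exact: bounded_dev.
under eq_Rintegral do rewrite exprMn.
rewrite RintZ; last by under eq_fun do rewrite expr2; exact: bounded_rvM.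
rewrite exprVn ler_pdivrMl ?exprn_gt0 // (le_trans (Rint_sum_dev_sqr j j)) //.
have b3 : bounded_rv (fun w => (M1 (e0 w))^-1 * trunc j (xi 0%N w) ^+ 2).
  apply: bounded_rvM; first exact: bounded_M1V.
  apply: (bounded_rv_nat _ (fun k => trunc j k ^+ 2) (j%:R ^+ 2)); first exact: mxi.
  by move=> k; rewrite sqr_ge0 lerXn2r ?nnegrE ?ler0n // ler_nat geq_minr.
have : \int[P]_w ((M1 (e0 w))^-1 * trunc j (xi 0%N w) ^+ 2) <= (2 * j%:R) * kapE j.
  rewrite -lee_fin EFin_Rintegral //.
  apply: (integral_xi_kap j 0%N (fun k => trunc j k ^+ 2)); first by rewrite mulr_ge0.
  by move=> k; rewrite sqr_ge0 trunc_sqr_kap.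
move=> /(ler_wpM2l (ltW J0)) /le_trans; apply.
by rewrite le_eqVlt; apply/orP; left; apply/eqP; ring.
Qed.

(** [powRN_taylor] is applied to [Z_1 / j], its truncated version and [M1]. The relative deviation
    of the truncated ratio from [M1] is [ybar - dlt]: a conditionally centred fluctuation minus a
    truncation bias, while [A] is the mass cut off plus immigration. *)
Lemma npow_defect r : 0 < r -> exists2 C : R, 0 <= C & forall j, (0 < j)%N ->
  `|\int[P]_w (npow r (Z_ X j 1 w)) - Mmom r * npow r j| <= C * defect j * npow r j.
Proof.
move=> r0; have [C C0 HC] := powRN_taylor r (ltW r0).
(* [2 * C] comes from squaring [ybar - dlt], and [r] from the bias in the linear term. The later
   factor [4] comes from [defect j + 3 * kapE j <= 4 * defect j]. *)
pose C1 := 2 * C + r; have C10 : 0 <= C1 by rewrite /C1; lra.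
exists (C1 * 4) => [|j j0]; first by rewrite mulr_ge0.
have J0 : 0 < j%:R :> R by rewrite ltr0n.
have nj0 : 0 < npow r j := @npow_gt0 R r j j0.
pose ybar w := j%:R^-1 * \sum_(l < j) dev j l w.
pose dlt w := 1 - (M1 (e0 w))^-1 * tmean j (e0 w).
pose A w := j%:R^-1 * (\sum_(l < j) (M1 (e0 w))^-1 * ((xi l w)%:R - trunc j (xi l w)) +
  (M1 (e0 w))^-1 * (eta w)%:R).
pose F w := npow r (Z_ X j 1 w).
pose m w := M1 (e0 w) `^ (- r).
(* The added linear term has mean [0], so [G] has the expectation sought, but its absolute value is
   of second order up to truncation and immigration. *)
pose G w := F w / npow r j - m w + r * (m w * ybar w).
have bF : bounded_rv F.
  apply: (bounded_rv_nat _ _ 1); first exact: measurable_Z.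
  by move=> k; rewrite npow_ge0 npow_le1.
have bm : bounded_rv m by exact: bounded_M1_powR (ltW r0).
have bybar : bounded_rv ybar.
  apply: bounded_rvM; first exact: bounded_rv_cst.
  by apply: bounded_rv_sum => l; exact: bounded_dev.
have bmy : bounded_rv (fun w => m w * ybar w) by exact: bounded_rvM.
have brmy : bounded_rv (fun w => r * (m w * ybar w)).
  by apply: bounded_rvM => //; exact: bounded_rv_cst.
have bFn : bounded_rv (fun w => F w / npow r j).
  by apply: bounded_rvM => //; exact: bounded_rv_cst.
have bFm : bounded_rv (fun w => F w / npow r j - m w) by exact: bounded_rvB.
have bG : bounded_rv G by exact: bounded_rvD.
have bdlt : bounded_rv dlt.
  apply: bounded_rvB; first exact: bounded_rv_cst.
  by apply: bounded_rvM; [exact: bounded_M1V|exact: bounded_tmean].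
have Emy : \int[P]_w (m w * ybar w) = 0.
  have bd l : bounded_rv (fun w => m w * dev j l w).
    by apply: bounded_rvM => //; exact: bounded_dev.
  have S n : \int[P]_w (\sum_(l < n) (m w * dev j l w)) = 0.
    elim: n => [|n ih].
      by under eq_Rintegral do rewrite big_ord0; rewrite Rint_cst.
    under eq_Rintegral do rewrite big_ord_recr /=.
    rewrite RintD //; last exact: (bounded_rv_sum _ (fun l w => m w * dev j l w)).
    rewrite ih add0r (Rint_dev j n (fun e => M1 e `^ (- r)) 1) //.
      exact: measurable_M1_powR.
    by move=> e; rewrite powR_ge0 powRN_le1 ?M1_ge1 // ltW.
  rewrite (_ : (fun w => _) = (fun w => j%:R^-1 * \sum_(l < j) (m w * dev j l w))).
    by rewrite RintZ ?S ?mulr0 //; exact: (bounded_rv_sum _ (fun l w => m w * dev j l w)).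
  by apply/funext => w; rewrite /ybar mulrCA big_distrr.
have EG : \int[P]_w G w = (\int[P]_w F w) / npow r j - Mmom r.
  rewrite RintD // RintB // RintZ // Emy mulr0 addr0; congr (_ - _).
  under eq_Rintegral do rewrite mulrC.
  by rewrite RintZ // mulrC.
suff main : `|\int[P]_w G w| <= C1 * 4 * defect j.
  rewrite (_ : _ - _ = (\int[P]_w G w) * npow r j); last first.
    by rewrite EG; field; rewrite gt_eqF.
  by rewrite normrM (ger0_norm (ltW nj0)) ler_wpM2r // ltW.
have A0 w : 0 <= A w.
  rewrite mulr_ge0 ?invr_ge0 ?ler0n // addr_ge0 // ?mulr_ge0 ?M1V_ge0 //.
  by apply: sumr_ge0 => l _; rewrite mulr_ge0 ?M1V_ge0 // subr_ge0 trunc_le.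
have GA : {ae P, forall w, `|G w| <= C1 * (A w + (ybar w ^+ 2 + `|dlt w|))}.
  apply: filterS2 ae_xi_ge1 (ae_tmean_le j) => w xi1 tM.
  have Mp := M1_gt0 (e0 w); have Mge := M1_ge1 (e0 w).
  pose x : R := (Z_ X j 1 w)%:R / j%:R.
  pose y : R := (\sum_(l < j) trunc j (xi l w)) / j%:R.
  have ZE : (Z_ X j 1 w)%:R = \sum_(l < j) (xi l w)%:R + (eta w)%:R :> R.
    by rewrite Z_1 /step natrD natr_sum.
  have y1 : 1 <= y.
    rewrite ler_pdivlMr // mul1r -[X in X%:R](card_ord j) -sum1_card natr_sum.
    by apply: ler_sum => l _; rewrite ler_nat leq_min xi1 j0.
  have yx : y <= x.
    rewrite ler_wpM2r ?invr_ge0 ?ler0n // ZE -[leLHS]addr0 lerD ?ler0n //.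
    by apply: ler_sum => l _; exact: trunc_le.
  have dev_sum : \sum_(l < j) dev j l w =
      (\sum_(l < j) trunc j (xi l w) - j%:R * tmean j (e0 w)) / M1 (e0 w).
    rewrite -mulr_suml; congr (_ / _).
    by rewrite sumrB sumr_const card_ord mulr_natl.
  have AE : (x - y) / M1 (e0 w) = A w.
    rewrite /x /y /A ZE -mulr_sumr sumrB; field.
    by rewrite !gt_eqF.
  have YE : (y - M1 (e0 w)) / M1 (e0 w) = ybar w - dlt w.
    rewrite /ybar /dlt dev_sum /y; field.
    by rewrite !gt_eqF.
  have xE : x `^ (- r) = F w / npow r j.
    have E : (Z_ X j 1 w)%:R `^ (- r) = x `^ (- r) * j%:R `^ (- r).
      by rewrite -powRM ?ler0n ?divr_ge0 // /x divfK ?gt_eqF.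
    by rewrite /F /npow E mulfK // gt_eqF // powR_gt0.
  have d0 : 0 <= dlt w by rewrite subr_ge0 ler_pdivrMl // mulr1.
  have d1 : dlt w <= 1.
    rewrite /dlt gerBl mulr_ge0 ?M1V_ge0 //.
    by case/andP: (tmean_bound j (e0 w)).
  have := HC x y (M1 (e0 w)) y1 yx Mge; rewrite AE YE xE -/(m w) => h.
  have m0 : 0 <= m w by exact: powR_ge0.
  have m1 : m w <= 1 by rewrite powRN_le1 // ltW.
  have -> : G w = (F w / npow r j - m w + r * m w * (ybar w - dlt w)) + r * (m w * dlt w).
    by rewrite /G; ring.
  rewrite (le_trans (ler_normD _ _)) //.
  have h2 : `|r * (m w * dlt w)| <= r * dlt w.
    by rewrite ger0_norm ?mulr_ge0 ?(ltW r0) // ler_pM2l // ler_piMl.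
  rewrite (ger0_norm d0).
  have q0 : 0 <= (ybar w + dlt w) ^+ 2 := sqr_ge0 _.
  have dd : dlt w ^+ 2 <= dlt w by rewrite expr2 ler_piMl.
  have k1 : C * (A w + (ybar w - dlt w) ^+ 2) <= C * (A w + (2 * ybar w ^+ 2 + 2 * dlt w)).
    by rewrite ler_wpM2l //; lra.
  have k2 : 0 <= C * A w by rewrite mulr_ge0.
  have k3 : 0 <= r * A w by rewrite mulr_ge0 // ltW.
  have k4 : 0 <= r * ybar w ^+ 2 by rewrite mulr_ge0 ?sqr_ge0 // ltW.
  by rewrite /C1; lra.
clearbody C1.
have mA : measurable_fun setT A.
  apply: measurable_funM; first exact: measurable_cst.
  apply: measurable_funD.
    apply: measurable_sum => l.
    exact: (measurable_M1V_xi l (fun k => k%:R - trunc j k)).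
  apply: measurable_funM; first exact: (measurableT_comp measurable_M1V me0).
  by apply: (@measurableT_comp _ _ _ _ _ _ (fun k : nat => k%:R : R)) => //; exact: meta.
(* [A] need not be bounded, so its integral is estimated in the extended reals. *)
have intA : (\int[P]_w (A w)%:E <= (defect j)%:E)%E.
  have mB l : measurable_fun setT
      (fun w => ((M1 (e0 w))^-1 * ((xi l w)%:R - trunc j (xi l w)))%:E).
    apply/measurable_EFinP.
    exact: (measurable_M1V_xi l (fun k => k%:R - trunc j k)).
  have B0 l w : (0 <= ((M1 (e0 w))^-1 * ((xi l w)%:R - trunc j (xi l w)))%:E)%E.
    by rewrite lee_fin mulr_ge0 ?M1V_ge0 // subr_ge0 trunc_le.
  have mE : measurable_fun setT (fun w => ((eta w)%:R : R)%:E).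
    apply/measurable_EFinP.
    by apply: (@measurableT_comp _ _ _ _ _ _ (fun k : nat => k%:R : R)) => //; exact: meta.
  have mVE : measurable_fun setT (fun w => ((M1 (e0 w))^-1 * (eta w)%:R)%:E).
    apply/measurable_EFinP; apply: measurable_funM.
      exact: (measurableT_comp measurable_M1V me0).
    exact/measurable_EFinP.
  under eq_integral do rewrite EFinM EFinD -sumEFin.
  rewrite ge0_integralZl_EFin ?invr_ge0 ?ler0n //; last 2 first.
  - by move=> w _; rewrite adde_ge0 // ?sume_ge0 // lee_fin mulr_ge0 ?M1V_ge0.
  - by apply: emeasurable_funD => //; exact: emeasurable_sum.
  rewrite ge0_integralD //; last 3 first.
  - by move=> w _; exact: sume_ge0.
  - exact: emeasurable_sum.
  - by move=> w _; rewrite lee_fin mulr_ge0 ?M1V_ge0.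
  rewrite (@ge0_integral_sum _ _ _ _ _ _ _ (fun (l : 'I_j) w => _)) //.
  have -> : (defect j)%:E = ((j%:R^-1)%:E * ((\sum_(l < j) kapE j)%:E + etaE%:E))%E.
    rewrite -EFinD -EFinM sumr_const card_ord -mulr_natl /defect; congr (_%:E).
    by field; rewrite gt_eqF.
  rewrite lee_wpmul2l ?lee_fin ?invr_ge0 ?ler0n // -sumEFin leeD //.
    apply: lee_sum => l _.
    have := integral_xi_kap j l (fun k => k%:R - trunc j k) 1 ler01
      (fun k => trunc_diff_kap j k j0).
    by rewrite mul1r.
  rewrite etaE_EFin; apply: ge0_le_integral => //.
  - by move=> w _; rewrite lee_fin mulr_ge0 ?M1V_ge0.
  - by move=> w _; rewrite lee_fin ler_piMl ?M1V_le1.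
have bY2 : bounded_rv (fun w => ybar w ^+ 2).
  by under eq_fun do rewrite expr2; exact: bounded_rvM.
have bad : bounded_rv (fun w => `|dlt w|).
  case: bdlt => md [D dD]; split; first exact: measurableT_comp.
  by exists D => w; rewrite normr_id.
have bYd : bounded_rv (fun w => ybar w ^+ 2 + `|dlt w|) by exact: bounded_rvD.
have intYd : (\int[P]_w (ybar w ^+ 2 + `|dlt w|)%:E <= (3 * kapE j)%:E)%E.
  rewrite -EFin_Rintegral // lee_fin RintD //.
  have := Rint_mean_dev j j0; have := Rint_trunc_gap j j0.
  by rewrite -/dlt; lra.
have mG : measurable_fun setT G by case: bG.
have : (`|\int[P]_w G w|%:E <= (C1 * (defect j + 3 * kapE j))%:E)%E.
  rewrite EFin_normr_Rintegral //; last exact: bounded_rv_integrable.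
  apply: (le_trans (le_abse_integral _ _ _)) => //; first exact/measurable_EFinP.
  apply: (@le_trans _ _ (\int[P]_w (C1 * (A w + (ybar w ^+ 2 + `|dlt w|)))%:E)%E).
    apply: ae_ge0_le_integral => //.
    - by apply: measurableT_comp => //; exact/measurable_EFinP.
    - by move=> w _; rewrite lee_fin mulr_ge0 // addr_ge0 // addr_ge0 ?sqr_ge0.
    - apply/measurable_EFinP; apply: measurable_funM; first exact: measurable_cst.
      by apply: measurable_funD => //; case: bYd.
    - by apply: filterS GA => w h _.
  under eq_integral do rewrite EFinM EFinD.
  rewrite ge0_integralZl_EFin //; last 2 first.
  - by move=> w _; rewrite -EFinD lee_fin addr_ge0 // addr_ge0 ?sqr_ge0.
  - by apply: emeasurable_funD; apply/measurable_EFinP => //; case: bYd.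
  rewrite EFinM lee_wpmul2l ?lee_fin // ge0_integralD //.
  - by rewrite EFinD leeD.
  - by move=> w _; rewrite lee_fin.
  - exact/measurable_EFinP.
  - by move=> w _; rewrite lee_fin addr_ge0 ?sqr_ge0.
  - by apply/measurable_EFinP; case: bYd.
rewrite lee_fin => /le_trans; apply; rewrite -mulrA ler_wpM2l //.
have : 0 <= etaE / j%:R by rewrite divr_ge0 ?etaE_ge0.
by rewrite /defect; lra.
Qed.

End generation_moments.

(** * Logarithmic moments and the drift *)

Section log_moment.
Context {d : measure_display} {T : measurableType d} {R : realType}
  {P : probability T R} (X : bprei P).
Hypothesis M_fin : {ae P, forall w, (0 < M_ext (env X 0%N w) < +oo)%E}.
Hypothesis p0_eq0 : {ae P, forall w, p_ (env X 0%N w) 0%N = 0}.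
Hypothesis xlogx_fin : (\int[P]_w ((M_ (env X 0%N w))^-1%:E * xlogx_moment (env X 0%N w))
           < +oo)%E.
Local Notation e0 := (env X 0%N).
Local Notation xi := (offspring X 0%N).

(** For [j > 0] this is the integral of [kap s k / s] over real [s >= j]. *)
Definition lnk (j k : nat) : R := k%:R * ln (1 + k%:R / j%:R).

Lemma lnk_ge0 j k : 0 <= lnk j k.
Proof. by rewrite mulr_ge0 ?ler0n // ln_ge0 // lerDl divr_ge0 ?ler0n. Qed.

Lemma lnk_le1 j k : lnk j k <= lnk 1 k.
Proof.
rewrite ler_wpM2l ?ler0n // ler_ln ?posrE; last 2 first.
- by rewrite ltr_wpDr // divr_ge0 ?ler0n.
- by rewrite ltr_wpDr // divr_ge0 ?ler0n.
(* At [j = 0] the inverse is [0] by convention, so [lnk 0 k = 0]. *)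
rewrite lerD2l ler_wpM2l ?ler0n //; case: j => [|j]; first by rewrite invr0 invr1.
by rewrite lef_pV2 ?posrE ?ltr0n // ler1n.
Qed.

Lemma log_plus_ge0 (x : R) : 0 <= log_plus x. Proof. by rewrite /log_plus le_max lexx. Qed.

(** From [1 + k <= 2 * k] and [ln 2 <= 1]; this is where the form of (H3) meets the potential. *)
Lemma lnk1_le k : lnk 1 k <= k%:R + k%:R * log_plus (k%:R : R).
Proof.
rewrite /lnk; case: k => [|k]; first by rewrite !mul0r addr0.
have -> : k.+1%:R + k.+1%:R * log_plus (k.+1%:R : R) = k.+1%:R * (1 + log_plus (k.+1%:R : R)).
  by rewrite mulrDr mulr1.
rewrite ler_wpM2l ?ler0n // divr1.
have K1 : 1 <= k.+1%:R :> R by rewrite ler1n.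
have l2 : ln (2 : R) <= 1 by rewrite (le_trans (ln_le_subr1 2 _)) //; lra.
have h1 : ln (1 + k.+1%:R : R) <= ln 2 + ln k.+1%:R.
  by rewrite -lnM ?posrE ?ltr0n // ler_ln ?posrE ?mulr_gt0 ?ltr0n //; lra.
have h2 : ln k.+1%:R <= log_plus (k.+1%:R : R) by rewrite /log_plus le_max lexx orbT.
by move: l2 h1 h2; lra.
Qed.

Lemma xlogx_mean (e : mark R) : xlogx_moment e = repro_mean (fun k => k%:R * log_plus k%:R) e.
Proof.
rewrite /xlogx_moment /repro_mean ereal_series [LHS]eseries_mkcond.
by apply: eq_eseriesr => k _; case: k => [|k] //=; rewrite !mul0r.
Qed.

Lemma integral_xlogx :
  (\int[P]_w ((M1 (e0 w))^-1 * ((xi 0%N w)%:R * log_plus (xi 0%N w)%:R))%:E < +oo)%E.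
Proof.
pose phi k : R := k%:R * log_plus k%:R.
have phi0 k : 0 <= phi k by rewrite mulr_ge0 ?ler0n ?log_plus_ge0.
have mV : measurable_fun setT (fun e : mark R => ((M1 e)^-1)%:E).
  by apply/measurable_EFinP; exact: measurable_M1V.
have V0 (e : mark R) : (0 <= ((M1 e)^-1)%:E)%E by rewrite lee_fin invr_ge0 ltW // M1_gt0.
under eq_integral do rewrite EFinM.
rewrite (single_moment X 0%N phi (fun e => ((M1 e)^-1)%:E)) //.
rewrite (le_lt_trans _ xlogx_fin) // le_eqVlt; apply/orP; left; apply/eqP.
have mr : measurable_fun setT (fun w => repro_mean phi (e0 w)).
  by apply: measurableT_comp (me0 X); apply: measurable_repro_mean.
apply: ae_eq_integral => //.
- by apply: emeasurable_funM => //; exact: (measurableT_comp mV (me0 X)).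
- apply: emeasurable_funM.
    apply/measurable_EFinP.
    rewrite (_ : (fun w => _) = (fun w => (M_ (e0 w))^-1)) //.
    have mM : measurable_fun setT (fun w => M_ (e0 w)).
      exact: (measurableT_comp measurable_M_ (me0 X)).
    have -> : (fun w => (M_ (e0 w))^-1) = (fun w => M_ (e0 w) `^ (-1)).
      apply/funext => w; rewrite powR_inv1 //.
      by apply: fine_ge0; rewrite M_ext_mean repro_mean_ge0 // => k; exact: ler0n.
    by apply: (@measurableT_comp _ _ _ _ _ _ (@powR R ^~ (-1))) => //; exact: measurable_powR.
  rewrite (_ : (fun w => _) = (fun w => repro_mean phi (e0 w))) //.
  by apply/funext => w; rewrite xlogx_mean.
- by apply: filterS (ae_M_eq X M_fin p0_eq0) => w Mw _; rewrite Mw xlogx_mean.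
Qed.

Lemma integrable_lnk j :
  P.-integrable setT (fun w => ((M1 (e0 w))^-1 * lnk j (xi 0%N w))%:E).
Proof.
apply/integrableP; split.
  by apply/measurable_EFinP; exact: (measurable_M1V_xi X 0%N (lnk j)).
under eq_integral => w _.
  rewrite gee0_abs; last by rewrite lee_fin mulr_ge0 ?M1V_ge0 ?lnk_ge0.
  over.
apply: (@le_lt_trans _ _ (\int[P]_w (((M1 (e0 w))^-1 * (xi 0%N w)%:R)%:E +
   ((M1 (e0 w))^-1 * ((xi 0%N w)%:R * log_plus (xi 0%N w)%:R))%:E))%E).
  apply: ge0_le_integral => //.
  - by move=> w _; rewrite lee_fin mulr_ge0 ?M1V_ge0 ?lnk_ge0.
  - by apply/measurable_EFinP; exact: (measurable_M1V_xi X 0%N (lnk j)).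
  - apply: emeasurable_funD; apply/measurable_EFinP.
      exact: (measurable_M1V_xi X 0%N (fun k => k%:R)).
    exact: (measurable_M1V_xi X 0%N (fun k => k%:R * log_plus k%:R)).
  - move=> w _; rewrite -EFinD lee_fin -mulrDr ler_wpM2l ?M1V_ge0 //.
    exact: le_trans (lnk_le1 _ _) (lnk1_le _).
rewrite ge0_integralD //.
- by rewrite (integral_xi_M1 X M_fin p0_eq0) lte_add_pinfty ?ltry // integral_xlogx.
- by move=> w _; rewrite lee_fin mulr_ge0 ?M1V_ge0.
- by apply/measurable_EFinP; exact: (measurable_M1V_xi X 0%N (fun k => k%:R)).
- by move=> w _; rewrite lee_fin mulr_ge0 ?M1V_ge0 // mulr_ge0 ?log_plus_ge0.
- apply/measurable_EFinP.
  exact: (measurable_M1V_xi X 0%N (fun k => k%:R * log_plus k%:R)).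
Qed.

Lemma integrable_kap j :
  P.-integrable setT (fun w => ((M1 (e0 w))^-1 * kap j (xi 0%N w))%:E).
Proof.
apply/integrableP; split.
  by apply/measurable_EFinP; exact: (measurable_M1V_xi X 0%N (kap j)).
under eq_integral => w _.
  rewrite gee0_abs; last by rewrite lee_fin mulr_ge0 ?M1V_ge0 ?kap_ge0.
  over.
by rewrite -(kapE_EFin X M_fin p0_eq0) ltry.
Qed.

Definition log_tail (j : nat) : R :=
  \int[P]_w ((M1 (e0 w))^-1 * lnk j (xi 0%N w)) + etaE X / j%:R.

Lemma log_tail_ge0 j : 0 <= log_tail j.
Proof.
rewrite addr_ge0 // ?divr_ge0 ?etaE_ge0 //.
by apply: Rintegral_ge0 => w _; rewrite mulr_ge0 ?M1V_ge0 ?lnk_ge0.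
Qed.

(** The offspring part integrates [ln_ratio_drop]; the immigration part is an equality. *)
Lemma log_tail_drop j l : (0 < j)%N -> (j <= l)%N ->
  (1 - j%:R / l%:R) * defect X j <= log_tail j - log_tail l.
Proof.
move=> j0 jl; have l0 : (0 < l)%N := leq_trans j0 jl.
have J0 : 0 < j%:R :> R by rewrite ltr0n.
have L0 : 0 < l%:R :> R by rewrite ltr0n.
have k1 : (1 - j%:R / l%:R) * kapE X j <=
    \int[P]_w ((M1 (e0 w))^-1 * lnk j (xi 0%N w)) -
    \int[P]_w ((M1 (e0 w))^-1 * lnk l (xi 0%N w)).
  rewrite -RintegralB //; [|exact: integrable_lnk..].
  rewrite -RintegralZl //; last exact: integrable_kap.
  apply: le_Rintegral => //.
  - have := integrable_kap j => /(integrableZl measurableT (1 - j%:R / l%:R)).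
    by apply: eq_integrable => // w _; rewrite EFinM.
  - apply: (@eq_integrable _ _ _ _ _ _ (fun w => ((M1 (e0 w))^-1 * lnk j (xi 0%N w))%:E -
        ((M1 (e0 w))^-1 * lnk l (xi 0%N w))%:E)%E) => //; last first.
    by apply: integrableB => //; exact: integrable_lnk.
  - move=> w _; rewrite -mulrBr mulrCA ler_wpM2l ?M1V_ge0 //.
    exact: ln_ratio_drop.
have e1 : etaE X / j%:R - etaE X / l%:R = (1 - j%:R / l%:R) * (etaE X / j%:R).
  by field; rewrite !gt_eqF.
rewrite /defect /log_tail mulrDr; move: e1 k1; lra.
Qed.

Lemma bounded_log_tail : bounded_seq log_tail.
Proof.
(* [log_tail] is maximal at [1] among positive indices, by [log_tail_drop]; the conventional value
   at [0] is added separately. *)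
exists (log_tail 0%N + log_tail 1%N) => j; rewrite ger0_norm ?log_tail_ge0 //.
case: j => [|j]; first by rewrite lerDl log_tail_ge0.
have h1 := log_tail_drop 1 j.+1 isT isT.
have h2 : 0 <= (1 - 1%:R / j.+1%:R) * defect X 1.
  rewrite mulr_ge0 ?defect_ge0 // subr_ge0 ler_pdivrMr ?ltr0n // mul1r ler_nat.
  by [].
have h3 := le_trans h2 h1; rewrite subr_ge0 in h3.
by rewrite (le_trans h3) // lerDr log_tail_ge0.
Qed.

(** Dominated convergence with dominating function [lnk 1]; pointwise,
    [lnk n.+1 k <= k ^+ 2 / n.+1]. *)
Lemma log_tail_small (e : R) : 0 < e -> exists J, forall j, (J <= j)%N -> log_tail j <= e.
Proof.
move=> e0'.
have c1 : \int[P]_w ((M1 (e0 w))^-1 * lnk n (xi 0%N w)) @[n --> \oo] --> (0 : R).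
  have [] := @dominated_convergence _ _ _ P setT measurableT
    (fun n w => ((M1 (e0 w))^-1 * lnk n (xi 0%N w))%:E) (fun=> 0%E)
    (fun w => ((M1 (e0 w))^-1 * lnk 1 (xi 0%N w))%:E).
  - by move=> n; apply/measurable_EFinP; exact: (measurable_M1V_xi X 0%N (lnk n)).
  - exact: measurable_cst.
  - apply/aeW => w _; apply: cvg_EFin; first by apply: nearW.
    rewrite -cvg_shiftS.
    apply: (@squeeze_cvgr _ _ _ _ (fun=> 0) (fun n => (xi 0%N w)%:R * (xi 0%N w)%:R * harmonic n)).
    + apply: nearW => n; rewrite mulr_ge0 ?M1V_ge0 ?lnk_ge0 //=.
      rewrite (@le_trans _ _ (lnk n.+1 (xi 0%N w))) ?ler_piMl ?lnk_ge0 ?M1V_le1 //.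
      rewrite /lnk -mulrA ler_wpM2l ?ler0n // (le_trans (ln_le_subr1 _ _)) //.
      by rewrite addrAC subrr add0r.
    + exact: cvg_cst.
    + rewrite -[X in _ --> X](mulr0 ((xi 0%N w)%:R * (xi 0%N w)%:R)).
      exact: (cvgM (cvg_cst _) cvg_harmonic).
  - exact: integrable_lnk.
  - apply: aeW => w n _; rewrite gee0_abs; last by rewrite lee_fin mulr_ge0 ?M1V_ge0 ?lnk_ge0.
    by rewrite lee_fin ler_wpM2l ?M1V_ge0 ?lnk_le1.
  move=> _ _; rewrite integral0 => h.
  by have /fine_cvgP[_] := h.
have c2 : etaE X / n%:R @[n --> \oo] --> (0 : R).
  rewrite -cvg_shiftS.
  have := cvgM (cvg_cst (etaE X)) (@cvg_harmonic R); rewrite mulr0; exact.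
have c3 : log_tail n @[n --> \oo] --> (0 : R) by rewrite -(addr0 0); exact: cvgD c1 c2.
have /cvgrPdist_le/(_ e e0')[J _ HJ] := c3.
exists J => j Jj; have /= := HJ j Jj.
by rewrite sub0r normrN ger0_norm ?log_tail_ge0.
Qed.

End log_moment.

(** * Negative moments of the reproduction mean *)

Section mean_powers.
Context {d : measure_display} {T : measurableType d} {R : realType}
  {P : probability T R} (X : bprei P).
Hypothesis M_fin : {ae P, forall w, (0 < M_ext (env X 0%N w) < +oo)%E}.
Hypothesis p0_eq0 : {ae P, forall w, p_ (env X 0%N w) 0%N = 0}.
Hypothesis logM : (0 < 'E_P[(fun w => ln (M_ (env X 0%N w)))%R] < +oo)%E.
Local Notation e0 := (env X 0%N).

Lemma c_Mmom r : c_ X r = Mmom X r.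
Proof.
rewrite /c_ /Mmom /Rintegral unlock; congr fine; apply: ae_eq_integral => //.
- apply/measurable_EFinP.
  apply: (@measurableT_comp _ _ _ _ _ _ (@powR R ^~ (- r)) _ (fun w => M_ (e0 w))).
    exact: measurable_powR.
  exact: (measurableT_comp measurable_M_ (me0 X)).
- apply/measurable_EFinP; exact: (measurableT_comp (measurable_M1_powR (- r)) (me0 X)).
- by apply: filterS (ae_M_eq X M_fin p0_eq0) => w Mw _; rewrite Mw.
Qed.

Lemma lnM1_ge0 w : 0 <= ln (M1 (e0 w)).
Proof. by rewrite ln_ge0 // M1_ge1. Qed.

Lemma measurable_lnM1 : measurable_fun setT (fun w => ln (M1 (e0 w))).
Proof.
apply: (measurableT_comp (@measurable_ln R)).
exact: (measurableT_comp measurable_M1 (me0 X)).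
Qed.

Lemma integral_lnM1 : (0 < \int[P]_w (ln (M1 (e0 w)))%:E < +oo)%E.
Proof.
move: logM; rewrite unlock => h.
rewrite (ae_eq_integral (fun w => (ln (M_ (e0 w)))%:E)) //.
- exact/measurable_EFinP/measurable_lnM1.
- apply/measurable_EFinP; apply: (measurableT_comp (@measurable_ln R)).
  exact: (measurableT_comp measurable_M_ (me0 X)).
- by apply: filterS (ae_M_eq X M_fin p0_eq0) => w Mw _; rewrite Mw.
Qed.

Lemma integrable_lnM1 : P.-integrable setT (fun w => (ln (M1 (e0 w)))%:E).
Proof.
apply/integrableP; split; first exact/measurable_EFinP/measurable_lnM1.
under eq_integral => w _ do rewrite gee0_abs ?lee_fin ?lnM1_ge0 //.
by case/andP: integral_lnM1.
Qed.

Definition log_mean : R := \int[P]_w (ln (M1 (e0 w))).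

Lemma log_mean_ge0 : 0 <= log_mean.
Proof. by apply: Rintegral_ge0 => w _; exact: lnM1_ge0. Qed.

Lemma Mmom_gt0 r : 0 <= r -> 0 < Mmom X r.
Proof.
move=> r0; apply: Rint_gt0; first exact: bounded_M1_powR.
  by apply: aeW => w; exact: powR_ge0.
rewrite (_ : [set w | _] = setT) ?probability_setT //.
by apply/seteqP; split => // w _ /=; rewrite powR_gt0 // M1_gt0.
Qed.

Lemma Mmom_le1 r : 0 <= r -> Mmom X r <= 1.
Proof.
move=> r0; rewrite -(Rint_cst P 1); apply: Rint_le; [exact: bounded_M1_powR|exact: bounded_rv_cst|].
by apply: aeW => w; rewrite powRN_le1 // M1_ge1.
Qed.

Lemma Mmom0 : Mmom X 0 = 1.
Proof.
rewrite -[RHS](Rint_cst P 1); apply: eq_Rintegral => w _.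
by rewrite oppr0 powRr0.
Qed.

Lemma Mmom_lip r s : 0 <= r -> r <= s -> Mmom X r - Mmom X s <= (s - r) * log_mean.
Proof.
move=> r0 rs; have s0 := le_trans r0 rs.
rewrite -RintB; [|exact: bounded_M1_powR..].
rewrite -RintegralZl //; last exact: integrable_lnM1.
apply: le_Rintegral => //.
- apply: bounded_rv_integrable; apply: bounded_rvB; exact: bounded_M1_powR.
- have := integrable_lnM1 => /(integrableZl measurableT (s - r)).
  by apply: eq_integrable => // w _; rewrite EFinM.
move=> w _; have M1w := M1_ge1 (e0 w); have M0 := M1_gt0 (e0 w).
have E : M1 (e0 w) `^ (- s) = M1 (e0 w) `^ (- r) * M1 (e0 w) `^ (- (s - r)).
  by rewrite -powRD ?(gt_eqF M0) ?implybT //; congr (_ `^ _); ring.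
have h1 : 1 - (s - r) * ln (M1 (e0 w)) <= M1 (e0 w) `^ (- (s - r)).
  by rewrite /powR gt_eqF // (le_trans _ (expR_ge1Dx _)) // mulNr.
have h2 := powRN_le1 r _ r0 M1w; have h3 : 0 <= M1 (e0 w) `^ (- r) := powR_ge0 _ _.
have h4 : M1 (e0 w) `^ (- (s - r)) <= 1 by apply: powRN_le1 => //; rewrite subr_ge0.
have h5 : 0 <= (s - r) * ln (M1 (e0 w)) by rewrite mulr_ge0 ?lnM1_ge0 // subr_ge0.
rewrite E -[X in X - _]mulr1 -mulrBr.
rewrite (@le_trans _ _ (1 - M1 (e0 w) `^ (- (s - r)))) //; last by lra.
by rewrite ler_piMl // subr_ge0.
Qed.

(** Equality would force [M1 = 1] almost surely, against the positivity of the mean of [ln M]. *)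
Lemma Mmom_dec r s : 0 <= r -> r < s -> Mmom X s < Mmom X r.
Proof.
move=> r0 rs; have s0 := le_trans r0 (ltW rs).
rewrite -subr_gt0 -RintB; [|exact: bounded_M1_powR..].
apply: Rint_gt0.
- by apply: bounded_rvB; exact: bounded_M1_powR.
- apply: aeW => w; rewrite subr_ge0 ler_powR ?M1_ge1 // lerN2 ltW //.
rewrite lt0e; apply/andP; split; last exact: measure_ge0.
apply/negP => /eqP P0; have /andP[+ _] := integral_lnM1.
rewrite (ae_eq_integral (fun=> 0%E)) ?integral0 ?ltxx //.
  exact/measurable_EFinP/measurable_lnM1.
exists [set w | 0 < M1 (e0 w) `^ (- r) - M1 (e0 w) `^ (- s)]; split => //.
  rewrite (_ : [set w | _] = (fun w => M1 (e0 w) `^ (- r) - M1 (e0 w) `^ (- s)) @^-1` `]0, +oo[%classic).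
    rewrite -[X in measurable X]setTI.
    have [+ _] : bounded_rv (fun w => M1 (e0 w) `^ (- r) - M1 (e0 w) `^ (- s)).
      by apply: bounded_rvB; exact: bounded_M1_powR.
    by apply.
  by apply/seteqP; split => w /=; rewrite in_itv /= andbT.
move=> w /= /not_implyP[_ ne]; rewrite subr_gt0.
have M1w := M1_ge1 (e0 w).
have M1lt : 1 < M1 (e0 w).
  rewrite lt_neqAle M1w andbT; apply/negP => /eqP E; apply: ne.
  by rewrite -E ln1.
rewrite /powR !gt_eqF ?M1_gt0 // ltr_expR ltr_pM2r ?ln_gt0 // ltrN2.
exact: rs.
Qed.

End mean_powers.

(** * Position of a decreasing Lipschitz function relative to a level *)

Section critical_exponent.
Context {R : realType} (c : R -> R) (L g : R).
Hypothesis L_ge0 : 0 <= L.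
Hypothesis c_lip : forall r s : R, 0 <= r -> r <= s -> c r - c s <= (s - r) * L.
Hypothesis c_dec : forall r s : R, 0 <= r -> r < s -> c s < c r.
Hypothesis g_lt : g < c 0.

Local Notation rc := (ereal_sup [set r%:E | r in [set r : R | 0 < r /\ g < c r]]).

Let modulus (del : R) : 0 < del -> exists2 t : R, 0 < t & t * L <= del / 2.
Proof.
move=> del0; have L1 : 0 < 2 * (L + 1) by have := L_ge0; lra.
exists (del / (2 * (L + 1))); first by rewrite divr_gt0.
have E : del / (2 * (L + 1)) * (L + 1) = del / 2 by field; rewrite gt_eqF //; have := L_ge0; lra.
have : 0 < del / (2 * (L + 1)) by rewrite divr_gt0.
rewrite mulrDr mulr1 in E; move: E; lra.
Qed.

Lemma critical_exponent_gt0 : (0 < rc)%E.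
Proof.
have [|t t0 tL] := modulus (c 0 - g); first by rewrite subr_gt0.
apply: (@lt_le_trans _ _ t%:E); first by rewrite lte_fin.
apply: ereal_sup_ubound; exists t => //; split => //.
have := c_lip 0 t (lexx 0) (ltW t0); rewrite subr0; move: g_lt tL; lra.
Qed.

Lemma lt_critical_exponent (r : R) : 0 < r -> (r%:E < rc)%E -> g < c r.
Proof.
move=> r0 /ereal_sup_gt[_ [s [s0 gs] <-]]; rewrite lte_fin => rs.
exact: lt_trans gs (c_dec r s (ltW r0) rs).
Qed.

Lemma gt_critical_exponent (r : R) : 0 < r -> (rc < r%:E)%E -> c r < g.
Proof.
move=> r0; have := critical_exponent_gt0; case E : rc => [a| |] //.
rewrite !lte_fin => a0 ar.
(* An intermediate point is needed for strictness: beyond the supremum only [c b <= g] is known, and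
   strict monotonicity from [b] to [r] improves it. *)
pose b := (a + r) / 2; have ab : a < b by rewrite /b; lra.
have br : b < r by rewrite /b; lra.
apply: (lt_le_trans (c_dec b r _ br)); first by rewrite (ltW (lt_trans a0 ab)).
rewrite leNgt; apply/negP => gb.
have : (b%:E <= rc)%E by apply: ereal_sup_ubound; exists b => //; split => //; exact: lt_trans ab.
by rewrite E lee_fin leNgt ab.
Qed.

(** A strict inequality in either direction would persist, by the Lipschitz bound, at a nearby point
    on the other side of the supremum. *)
Lemma at_critical_exponent (r : R) : r%:E = rc -> c r = g.
Proof.
move=> rE; have r0 : 0 < r by rewrite -lte_fin rE critical_exponent_gt0.
apply/eqP; rewrite eq_le; apply/andP; split; rewrite leNgt; apply/negP => h.
- have [|t t0 tL] := modulus (c r - g); first by rewrite subr_gt0.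
  have : c (r + t) < g.
    by apply: gt_critical_exponent; rewrite ?addr_gt0 // -rE lte_fin ltrDl.
  have := c_lip r (r + t) (ltW r0); rewrite lerDl => /(_ (ltW t0)).
  rewrite addrAC subrr add0r; move: tL h; lra.
- have [|t t0 tL] := modulus (g - c r); first by rewrite subr_gt0.
  (* The maximum with [r / 2] keeps [s] positive. *)
  pose s := Num.max (r / 2) (r - t).
  have s0 : 0 < s by rewrite /s lt_max divr_gt0.
  have sr : s < r by rewrite /s gt_max; apply/andP; split; lra.
  have rst : r - s <= t by have : r - t <= s := ltac:(by rewrite /s le_max lexx orbT); lra.
  have : g < c s by apply: lt_critical_exponent => //; rewrite -rE lte_fin.
  have := c_lip s r (ltW s0) (ltW sr).
  have : (r - s) * L <= t * L by rewrite ler_wpM2r.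
  move: tL h; lra.
Qed.

End critical_exponent.

(** * The one-step operator *)

Section generation_operator.
Context {d : measure_display} {T : measurableType d} {R : realType}
  {P : probability T R} (X : bprei P).
Hypothesis p0_eq0 : {ae P, forall w, p_ (env X 0%N w) 0%N = 0}.
Local Notation e0 := (env X 0%N).
Local Notation xi := (offspring X 0%N).
Local Notation eta := (immigrants X 1%N).

Lemma bounded_rv_seq (N : T -> nat) (f : nat -> R) :
  measurable_fun setT N -> bounded_seq f -> bounded_rv (fun w => f (N w)).
Proof.
move=> mN [B fB]; split; first exact: (measurableT_comp _ mN).
by exists B.
Qed.

Definition gen (f : nat -> R) (j : nat) : R := \int[P]_w f (Z_ X j 1 w).

Lemma bounded_rv_gen (f : nat -> R) j : bounded_seq f -> bounded_rv (fun w => f (Z_ X j 1 w)).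
Proof. by apply: bounded_rv_seq; exact: measurable_Z. Qed.

Lemma gen_le f g j : bounded_seq f -> bounded_seq g ->
  (forall k, (j <= k)%N -> f k <= g k) -> gen f j <= gen g j.
Proof.
move=> bf bg fg; apply: Rint_le; [exact: bounded_rv_gen..|].
by apply: filterS (ae_Z1_ge X p0_eq0 j) => w; exact: fg.
Qed.

Lemma gen_lin a b f g j : bounded_seq f -> bounded_seq g ->
  gen (fun k => a * f k + b * g k) j = a * gen f j + b * gen g j.
Proof.
move=> bf bg; rewrite /gen RintD ?RintZ //; try exact: bounded_rv_gen.
- by apply: (bounded_rvM (fun=> a)); [exact: bounded_rv_cst|exact: bounded_rv_gen].
- by apply: (bounded_rvM (fun=> b)); [exact: bounded_rv_cst|exact: bounded_rv_gen].
Qed.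

Lemma gen_cst1 j : gen (fun=> 1) j = 1.
Proof. exact: (Rint_cst P 1). Qed.

Lemma bounded_gen f : bounded_seq f -> bounded_seq (gen f).
Proof.
move=> bf; have [B fB] := bf; exists B => j.
have h (g : nat -> R) : (forall k, g k <= B) -> bounded_seq g -> gen g j <= B.
  move=> gB bg; rewrite -(Rint_cst P B); apply: Rint_le;
    [exact: bounded_rv_gen|exact: bounded_rv_cst|exact: aeW].
rewrite ler_norml lerNl; apply/andP; split; last first.
  by apply: h => // k; apply: le_trans (ler_norm _) (fB k).
rewrite -mulN1r -(addr0 (-1 * _)) -(mul0r (gen f j)) -gen_lin //.
apply: h => [k|]; first by rewrite mul0r addr0 mulN1r; apply: le_trans (ler_norm _) _; rewrite normrN.
by exists B => k; rewrite mul0r addr0 mulN1r normrN.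
Qed.

(** The induction peels off the last generation, so it runs over all bounded nonnegative [f], and
    [gen] preserves this class. *)
Lemma iter_gen i n f : bounded_seq f -> (forall k, 0 <= f k) ->
  \int[P]_w f (Z_ X i n w) = iter n gen f i.
Proof.
elim: n f => [|n ih] f bf f0; first exact: (Rint_cst P (f i)).
rewrite iterSr -ih; last 2 first.
- exact: bounded_gen.
- by move=> k; apply: Rintegral_ge0 => w _.
rewrite /Rintegral integral_Z //; congr fine; apply: eq_integral => w _.
by rewrite -EFin_Rintegral //; exact: bounded_rv_gen.
Qed.

Lemma bounded_rv_h_p i : bounded_rv (fun w => h_ (e0 w) 0%N * p_ (e0 w) 1%N ^+ i).
Proof.
apply: bounded_rvM.
  apply: (bounded_rv_mark X (fun e => h_ e 0%N) 1); first exact: measurable_h_.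
  by move=> e; rewrite h_ge0 h_le1.
apply: (bounded_rv_mark X (fun e => p_ e 1%N ^+ i) 1).
  by apply: measurable_funX; exact: measurable_p_.
by move=> e; rewrite exprn_ge0 ?p_ge0 // exprn_ile1 ?p_ge0 // p_le1.
Qed.

Lemma gammaE i : gamma_ X i = \int[P]_w (h_ (e0 w) 0%N * p_ (e0 w) 1%N ^+ i).
Proof. by rewrite /gamma_ unlock. Qed.

Lemma bounded_hit i : bounded_seq (fun k => (k == i)%:R : R).
Proof. by exists 1 => k; case: eqP; rewrite ?normr1 ?normr0. Qed.

(* As every individual has at least one child, the population keeps its size
   exactly when every offspring number is 1 and nobody immigrates. *)
Lemma gen_hit_gamma i : gen (fun k => (k == i)%:R) i = gamma_ X i.
Proof.
pose A := [set w | forall n, (n < 1)%N -> [set 0%N] (immigrants X n.+1 w) /\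
  forall l, (l < i)%N -> [set 1%N] (offspring X n l w)].
have PA : P A = (\int[P]_w (h_ (e0 w) 0%N * p_ (e0 w) 1%N ^+ i)%:E)%E.
  have := @noise_law _ _ _ _ X _ (env_sigma_preimage X 0%N setT measurableT) 1%N i
    (fun _ _ => [set 1%N]) (fun=> [set 0%N]).
  rewrite preimage_setT setTI => ->; apply: eq_integral => w _.
  rewrite big_ord1 immig_h_ EFinM; congr (_ * _)%E.
  by under eq_bigr do rewrite repro_p_; rewrite prodEFin prodr_const card_ord.
rewrite gammaE.
have mA : measurable A.
  rewrite (_ : A = box X 0%N [set 0%N] (fun l => if (l < i)%N then [set 1%N] else setT)).
    exact: measurable_box.
  rewrite (box_finite _ _ _ _ i) => [|l]; last by rewrite leqNgt => /negbTE ->.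
  apply/seteqP; split => w /=.
    by move=> /(_ 0%N isT)[-> h]; split => // l li; rewrite li; exact: h.
  move=> [et h] [|//] _; split => // l li; have := h l li; rewrite li; apply.
have bA : bounded_rv (fun w => \1_A w : R).
  split; first exact: measurable_indic.
  by exists 1 => w; rewrite indicE; case: (w \in A); rewrite ?normr1 ?normr0.
transitivity (\int[P]_w (\1_A w : R)); last first.
  by apply: EFin_inj; rewrite !EFin_Rintegral -?PA ?integral_indic ?setIT //; exact: bounded_rv_h_p.
apply: Rint_eq => //.
  exact: (bounded_rv_gen (fun k => (k == i)%:R) i (bounded_hit i)).
apply: filterS (ae_xi_ge1 X p0_eq0) => w xi1.
rewrite indicE (_ : (w \in A) = (Z_ X i 1 w == i)) //.
apply/idP/eqP => [/set_mem/(_ 0%N isT)[eta0 h]|].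
  rewrite Z_1 /step eta0 addn0.
  by rewrite (eq_bigr (fun=> 1%N)) ?sum1_card ?card_ord // => l _; exact: h.
rewrite Z_1 /step => Zi.
have s1 : (i <= \sum_(l < i) xi l w)%N.
  by rewrite -[leqLHS]card_ord -sum1_card; apply: leq_sum.
have sE : (\sum_(l < i) xi l w)%N = i by lia.
apply/mem_set => -[|//] _; split; first by rewrite /=; lia.
move=> l li; apply/eqP; rewrite eqn_leq xi1 andbT leqNgt; apply/negP => xl.
have := sE; rewrite (bigD1 (Ordinal li)) //= => s2.
have : (\sum_(k < i | k != Ordinal li) 1 <= \sum_(k < i | k != Ordinal li) xi k w)%N.
  by apply: leq_sum.
have : (\sum_(k < i) 1 = i)%N by rewrite sum1_card card_ord.
rewrite (bigD1 (Ordinal li)) //=; move: s2 xl.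
by set a := (\sum_(k < i | _) 1)%N; set b := (\sum_(k < i | _) _)%N; lia.
Qed.

Lemma gamma_hit i : (gamma_ X i)%:E = P [set w | Z_ X i 1 w = i].
Proof.
have mZ : measurable [set w | Z_ X i 1 w = i].
  exact: (measurable_preim _ [set i] (measurable_Z X i 1)).
rewrite -gen_hit_gamma EFin_Rintegral; last first.
  exact: (bounded_rv_gen (fun k => (k == i)%:R) i (bounded_hit i)).
transitivity (\int[P]_w (\1_[set w | Z_ X i 1 w = i] w)%:E)%E.
  apply: eq_integral => w _; rewrite indicE; congr ((nat_of_bool _)%:R%:E).
  apply/esym; apply/idP/eqP => [/set_mem|h] //; exact/mem_set.
transitivity (P ([set w | Z_ X i 1 w = i] `&` setT)); last by rewrite setIT.
exact: integral_indic.
Qed.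

Hypothesis H2 : (0 < P [set w | (0 < h_ (env X 0%N w) 0%N /\
                        0 < p_ (env X 0%N w) 1%N < 1)%R])%E.

(** The integrand of the difference is [h_0 * p_1 ^+ j * (1 - p_1 ^+ (k - j))], which is positive
    exactly on the event of (H2). *)
Lemma gamma_decreasing j k : (0 < j)%N -> (j < k)%N -> gamma_ X k < gamma_ X j.
Proof.
move=> j0 jk; rewrite -subr_gt0 !gammaE -RintB; [|exact: bounded_rv_h_p..].
have E w : h_ (e0 w) 0%N * p_ (e0 w) 1%N ^+ j - h_ (e0 w) 0%N * p_ (e0 w) 1%N ^+ k =
    h_ (e0 w) 0%N * p_ (e0 w) 1%N ^+ j * (1 - p_ (e0 w) 1%N ^+ (k - j)).
  by rewrite -{1}(subnKC (ltnW jk)) exprD mulrA -[X in X - _]mulr1 -mulrBr.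
apply: Rint_gt0; first by apply: bounded_rvB; exact: bounded_rv_h_p.
  apply: aeW => w; rewrite E mulr_ge0 ?mulr_ge0 ?h_ge0 ?exprn_ge0 ?p_ge0 //.
  by rewrite subr_ge0 exprn_ile1 ?p_ge0 ?p_le1.
rewrite (_ : [set w | _] = [set w | 0 < h_ (e0 w) 0%N /\ 0 < p_ (e0 w) 1%N < 1]) //.
apply/seteqP; split => w /=; rewrite E.
  move=> pos; have : h_ (e0 w) 0%N * p_ (e0 w) 1%N ^+ j * (1 - p_ (e0 w) 1%N ^+ (k - j)) != 0.
    by rewrite gt_eqF.
  rewrite !mulf_eq0 !negb_or expf_eq0 j0 /= => /andP[/andP[h0 p0] p1].
  rewrite !lt_neqAle h_ge0 p_ge0 p_le1 !(eq_sym 0) h0 p0 !andbT; split => //.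
  by apply: contra p1 => /eqP ->; rewrite expr1n subrr.
move=> [h0 /andP[p0 p1]]; rewrite !mulr_gt0 ?exprn_gt0 // subr_gt0 exprn_ilt1 ?p_ge0 //.
by rewrite -lt0n subn_gt0.
Qed.

(** Pointwise, [h * p ^+ i + h * p ^+ i * (1 - p) <= p + (1 - p) = 1], and the second term has
    positive expectation by [gamma_decreasing]. *)
Lemma gamma_lt1 i : (0 < i)%N -> gamma_ X i < 1.
Proof.
move=> i0; have := gamma_decreasing i i.+1 i0 (ltnSn i).
suff : gamma_ X i + (gamma_ X i - gamma_ X i.+1) <= 1 by lra.
rewrite !gammaE -RintB; [|exact: bounded_rv_h_p..].
rewrite -RintD; [|exact: bounded_rv_h_p|by apply: bounded_rvB; exact: bounded_rv_h_p].
rewrite -(Rint_cst P 1); apply: Rint_le; last 1 first.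
- apply: aeW => w; have h0 := h_ge0 (e0 w) 0; have h1 := h_le1 (e0 w) 0.
  have p0 := p_ge0 (e0 w) 1; have p1 := p_le1 (e0 w) 1; rewrite exprS.
  move: (h_ _ _) (p_ _ _) h0 h1 p0 p1 => h p h0 h1 p0 p1.
  have q0 : 0 <= p ^+ i by rewrite exprn_ge0.
  have q1 : p ^+ i <= p by rewrite -[leRHS]expr1 ler_wiXn2l.
  have a1 : h * p ^+ i <= p by rewrite (le_trans _ q1) // ler_piMl.
  have : h * p ^+ i * (1 - p) <= 1 * (1 - p).
    by rewrite ler_wpM2r ?subr_ge0 // (le_trans a1).
  by rewrite mulrA (mulrC h p) -mulrA; move: a1; nra.
- apply: bounded_rvD; first exact: bounded_rv_h_p.
  by apply: bounded_rvB; exact: bounded_rv_h_p.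
- exact: bounded_rv_cst.
Qed.

(** If [f] were almost surely nonpositive after one step, the population would almost surely stay at
    [j], which contradicts [gamma_lt1]. *)
Lemma gen_gt0 f j : bounded_seq f -> (0 < j)%N ->
  (forall k, (j <= k)%N -> 0 <= f k) -> (forall k, (j < k)%N -> 0 < f k) ->
  0 < gen f j.
Proof.
move=> bf j0 f0 fpos; have Zj := ae_Z1_ge X p0_eq0 j.
have bfZ := bounded_rv_gen f j bf.
apply: Rint_gt0 => //; first by apply: filterS Zj => w; exact: f0.
rewrite lt0e; apply/andP; split; last exact: measure_ge0.
apply/negP => /eqP P0; have := gamma_lt1 j j0.
rewrite -gen_hit_gamma (_ : gen (fun k => (k == j)%:R) j = 1) ?ltxx //.
transitivity (\int[P]_w (1 : R)); last exact: (Rint_cst P 1).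
apply: Rint_eq.
- exact: (bounded_rv_gen (fun k => (k == j)%:R) j (bounded_hit j)).
- exact: bounded_rv_cst.
have fle : {ae P, forall w, f (Z_ X j 1 w) <= 0}.
  exists [set w | 0 < f (Z_ X j 1 w)]; split => //.
    exact: (measurable_preim _ [set k | 0 < f k] (measurable_Z X j 1)).
  by move=> w /=; rewrite ltNge => /negP.
apply: filterS2 Zj fle => w; rewrite leq_eqVlt eq_sym => /orP[/eqP ->|]; first by rewrite eqxx.
by move=> /fpos; rewrite ltNge => /negP.
Qed.

End generation_operator.

Theorem theorem3p18 (R : realType) (d : measure_display) (T : measurableType d)
  (P : probability T R) (X : bprei P)
  (M_fin : {ae P, forall w, (0 < M_ext (env X 0%N w) < +oo)%E})
  (H1_p0 : {ae P, forall w, p_ (env X 0%N w) 0%N = 0})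
  (H1_log : (0 < 'E_P[(fun w => ln (M_ (env X 0%N w)))%R] < +oo)%E)
  (H2 : (0 < P [set w | (0 < h_ (env X 0%N w) 0%N /\
                        0 < p_ (env X 0%N w) 1%N < 1)%R])%E)
  (H3 : (\int[P]_w ((M_ (env X 0%N w))^-1%:E * xlogx_moment (env X 0%N w))
           < +oo)%E)
  (H4 : exists2 delta : R, 0 < delta &
          ('E_P[(fun w => M_ (env X 0%N w) `^ delta)%R] < +oo)%E)
  (H5 : ('E_P[(fun w => (immigrants X 1%N w)%:R)%R] < +oo)%E) :
  forall i : nat, (1 <= i)%N ->
    [/\ (gamma_ X i)%:E = P [set w | Z_ X i 1 w = i],
        (0 < rcrit X i)%E,
        (forall r : R, 0 < r -> (r%:E < rcrit X i)%E ->
           exists2 Cenv : R, 0 < Cenv &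
             (fun n : nat => c_ X r ^- n * H_ X i n r) @ \oo --> Cenv),
        (exists2 Cbd : R, 0 < Cbd &
           forall r : R, r%:E = rcrit X i ->
             (fun n : nat => H_ X i n r / (n%:R * gamma_ X i ^+ n)) @ \oo
               --> Cbd)
      & (forall r : R, 0 < r -> (rcrit X i < r%:E)%E ->
           exists2 Csm : R, 0 < Csm &
             (fun n : nat => gamma_ X i ^- n * H_ X i n r) @ \oo --> Csm)].
Proof.
move=> i i0.
have eta_mean : (\int[P]_w ((immigrants X 1%N w)%:R : R)%:E < +oo)%E.
  by move: H5; rewrite unlock.
have cE := c_Mmom X M_fin H1_p0.
(* Everything about the process enters through [gen X]; from here on, the hypotheses of the abstract
   operator are verified for it. *)
have HE m (r : R) : 0 < r -> H_ X i m r = iter m (gen X) (npow r) i.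
  move=> r0; rewrite -iter_gen; last 2 first.
  - exact: bounded_npow.
  - by move=> k; exact: npow_ge0.
  by rewrite /H_ unlock.
have L0 := log_mean_ge0 X.
have c_lip (a b : R) : 0 <= a -> a <= b -> c_ X a - c_ X b <= (b - a) * log_mean X.
  by rewrite !cE; exact: Mmom_lip.
have c_dec (a b : R) : 0 <= a -> a < b -> c_ X b < c_ X a.
  by rewrite !cE; exact: Mmom_dec.
have g_lt : gamma_ X i < c_ X 0 by rewrite cE Mmom0; exact: gamma_lt1.
have gam_dec j k := gamma_decreasing X H2 j k.
have c_gt0 (a : R) : 0 < a -> 0 < c_ X a by rewrite cE => /ltW; exact: Mmom_gt0.
have c_le1 (a : R) : 0 < a -> c_ X a <= 1 by rewrite cE => /ltW; exact: Mmom_le1.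
have c_dec' (a b : R) : 0 < a -> a < b -> c_ X b < c_ X a by move=> /ltW; exact: c_dec.
have gen_npow (a : R) : 0 < a -> exists2 C : R, 0 <= C & forall j, (0 < j)%N ->
    `|gen X (npow a) j - c_ X a * npow a j| <= C * defect X j * npow a j.
  by rewrite cE; exact: (npow_defect X M_fin H1_p0 eta_mean).
have gle := @gen_le _ _ _ _ X H1_p0.
have glin := @gen_lin _ _ _ _ X.
have g1 := @gen_cst1 _ _ _ _ X.
have ghit := @gen_hit_gamma _ _ _ _ X H1_p0.
have ggt0 := @gen_gt0 _ _ _ _ X H1_p0 H2.
have def0 := defect_ge0 X.
have u0 := log_tail_ge0 X.
have bu := bounded_log_tail X M_fin H1_p0 H3.
have usmall := log_tail_small X M_fin H1_p0 H3.
have udrop := log_tail_drop X M_fin H1_p0 H3.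
split.
- exact: (gamma_hit X H1_p0).
- exact: (critical_exponent_gt0 (c_ X) (log_mean X) (gamma_ X i) L0 c_lip g_lt).
- move=> r r0 rlt; have gc := lt_critical_exponent (c_ X) (gamma_ X i) c_dec r r0 rlt.
  have [C C0 HC] := @iterQ_env_regime R (gen X) (gamma_ X) gle glin g1 ghit ggt0 gam_dec
    (c_ X) (defect X) (log_tail X) c_gt0 c_le1 c_dec' gen_npow def0 u0 bu usmall udrop r i r0 i0 gc.
  by exists C => //; under eq_cvg do rewrite HE //.
(* When [rcrit] is not a real number, no [r] satisfies the equation and any positive constant
   serves; otherwise [r] can only be [a]. *)
- case rE : (rcrit X i) => [a| |]; [|by exists 1|by exists 1].
  have ca := at_critical_exponent (c_ X) (log_mean X) (gamma_ X i) L0 c_lip c_dec g_lt a (esym rE).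
  have a0 : 0 < a.
    rewrite -lte_fin -rE.
    exact: (critical_exponent_gt0 (c_ X) (log_mean X) (gamma_ X i) L0 c_lip g_lt).
  have [C C0 HC] := @iterQ_boundary_regime R (gen X) (gamma_ X) gle glin g1 ghit ggt0 gam_dec
    (c_ X) (defect X) (log_tail X) c_gt0 c_le1 c_dec' gen_npow def0 u0 bu usmall udrop a i a0 i0
    (esym ca).
  by exists C => // r [->]; under eq_cvg do rewrite HE //.
- move=> r r0 rgt.
  have cg := gt_critical_exponent (c_ X) (log_mean X) (gamma_ X i) L0 c_lip c_dec g_lt r r0 rgt.
  have [C C0 HC] := @iterQ_small_regime R (gen X) (gamma_ X) gle glin g1 ghit gam_dec
    (c_ X) (defect X) (log_tail X) c_gt0 c_le1 gen_npow def0 u0 usmall udrop r i r0 i0 cg.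
  by exists C => //; under eq_cvg do rewrite HE //.
Qed.
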